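(* Let $d \geq 2$ and $n \geq d$ be integers. Then for all real $B \geq 2$ and $A \geq B^{1/(n+1-d)}$, \[ \frac{1}{\# \mathbb{V}_{d,n}(A)} \sum_{V \in \mathbb{V}_{d,n}(A)} N_V(B) = C_{d,n} \frac{B}{A} \left( 1 + O\left( \frac{B^{1/(n+1-d)}}{A} + \frac{\log B}{B^{1/(n+1-d)}} \right) \right), \] where the implied constant depends only on $d$ and $n$, and $C_{d,n} > 0$ is the constant \[ C_{d,n} = \frac{1}{2\zeta(n+1)} \cdot \frac{V_{N_{d,n}-1}}{V_{N_{d,n}}} \cdot \frac{\zeta(N_{d,n})}{\zeta(N_{d,n}-1)} \cdot \int_{\mathcal{B}_{n+1}(1)} \frac{\mathrm{d}\mathbf{t}}{\|\nu_{d,n}(\mathbf{t})\|}. \]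
   Context: $\|\cdot\|$ is the Euclidean norm; $\mathcal{B}_N(u) = \{\mathbf{y} \in \mathbb{R}^N : \|\mathbf{y}\| \leq u\}$ and $V_N$ is the volume of $\mathcal{B}_N(1)$; $\zeta$ is the Riemann zeta function. $\mathbb{Z}^N_{\mathrm{prim}}$ is the set of integer vectors in $\mathbb{Z}^N$ whose coordinates have gcd $1$. $N_{d,n} = \binom{n+d}{d}$, and $\nu_{d,n} : \mathbb{R}^{n+1} \to \mathbb{R}^{N_{d,n}}$ is the Veronese map listing all monomials of degree $d$ in the $n+1$ coordinates in lexicographic order. Degree $d$ hypersurfaces in $\mathbb{P}^n$ over $\mathbb{Q}$ are parametrized by their coefficient vectors, i.e. by $\mathbb{V}_{d,n} = \mathbb{P}^{N_{d,n}-1}(\mathbb{Q})$; for $V \in \mathbb{V}_{d,n}$, $\mathbf{a}_V \in \mathbb{Z}^{N_{d,n}}_{\mathrm{prim}}$ is either of its two primitive coefficient vectors, and $\mathbb{V}_{d,n}(A) = \{V : \|\mathbf{a}_V\| \leq A\}$. For $x \in \mathbb{P}^n(\mathbb{Q})$ with primitive integral representative $\mathbf{x} \in \mathbb{Z}^{n+1}_{\mathrm{prim}}$, $H(x) = \|\mathbf{x}\|^{n+1-d}$. For $V \in \mathbb{V}_{d,n}$, $N_V(B) = \#\{x \in V(\mathbb{Q}) : H(x) \leq B\}$. *)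

(* Defs.v *)
From HB Require Import structures.
From mathcomp Require Import all_boot all_order all_algebra.
From mathcomp Require Import all_classical all_reals all_analysis.
Unset Printing Implicit Defensive.
Import Order.TTheory GRing.Theory Num.Theory.
Import numFieldNormedType.Exports.
Local Open Scope classical_set_scope.
Local Open Scope ring_scope.

Definition Ndn (d n : nat) : nat := 'C(n + d, d).

Definition monom (d n : nat) :=
  {e : {ffun 'I_n.+1 -> 'I_d.+1} | (\sum_(i < n.+1) (e i : nat) == d)%N}.

Definition zeta (R : realType) (s : nat) : R :=
  limn (series (fun k : nat => (k.+1%:R : R) ^- s)).

(* Iterated one-dimensional Lebesgue integral over R^k of a function of the
   coordinate list [:: t_0; ...; t_(k-1)] (for nonnegative measurable
   integrands this is the k-dimensional Lebesgue integral, by Tonelli). *)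
Fixpoint iint (R : realType) (k : nat) (f : seq R -> \bar R) : \bar R :=
  match k with
  | 0 => f [::]
  | k'.+1 => (\int[@lebesgue_measure R]_(x in [set: R]) iint R k' (fun s => f (x :: s)))%E
  end.

Definition normS (R : realType) (s : seq R) : R :=
  Num.sqrt (\sum_(x <- s) x ^+ 2).

Definition Vball (R : realType) (N : nat) : R :=
  fine (iint R N (fun s : seq R => (if normS R s <= 1 then 1 else 0)%:E)).

(* || nu_{d,n}(t) ||, t = [:: t_0; ...; t_n]: Euclidean norm of the vector of
   all degree-d monomials in t (the norm does not depend on their order). *)
Definition veronese_norm (R : realType) (d n : nat) (t : seq R) : R :=
  Num.sqrt (\sum_(e : monom d n)
              (\prod_(i < n.+1) (nth 0 t i) ^+ (val e i : nat)) ^+ 2).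

Definition Cdn (R : realType) (d n : nat) : R :=
  let N := Ndn d n in
  (2 * zeta R n.+1)^-1 * (Vball R N.-1 / Vball R N) *
  (zeta R N / zeta R N.-1) *
  fine (iint R n.+1 (fun t : seq R =>
     (if normS R t <= 1 then (veronese_norm R d n t)^-1 else 0)%:E)).

Definition znorm (R : realType) (T : finType) (a : {ffun T -> int}) : R :=
  Num.sqrt (\sum_(i : T) ((a i)%:~R : R) ^+ 2).

Definition primitive (T : finType) (a : {ffun T -> int}) : bool :=
  (\big[gcdn/0%N]_(i : T) `|a i|%N == 1)%N.

Definition form_eval (d n : nat) (a : {ffun monom d n -> int})
  (x : {ffun 'I_n.+1 -> int}) : int :=
  \sum_(e : monom d n) a e * \prod_(i < n.+1) x i ^+ (val e i : nat).

(* Primitive coefficient vectors a with ||a|| <= A;  each V in V_{d,n}(A)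
   corresponds to exactly two of them (a_V and -a_V). *)
Definition coeffs_upto (R : realType) (d n : nat) (A : R) :
  set {ffun monom d n -> int} :=
  [set a | primitive _ a /\ znorm R _ a <= A].

(* Primitive integral points x with F_a(x) = 0 and H(x) = ||x||^{n+1-d} <= B;
   each rational point of V corresponds to exactly two of them (x and -x). *)
Definition points_upto (R : realType) (d n : nat) (a : {ffun monom d n -> int})
  (B : R) : set {ffun 'I_n.+1 -> int} :=
  [set x | primitive _ x /\ form_eval d n a x = 0 /\ znorm R _ x ^+ (n.+1 - d) <= B].

Definition NV (R : realType) (d n : nat) (a : {ffun monom d n -> int}) (B : R) : R :=
  (\sum_(x \in points_upto R d n a B) (1 : R)) / 2.

Definition cardV (R : realType) (d n : nat) (A : R) : R :=
  (\sum_(a \in coeffs_upto R d n A) (1 : R)) / 2.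

(* sum_{V in V_{d,n}(A)} N_V(B)  (each V is counted once, via a_V and -a_V) *)
Definition sumNV (R : realType) (d n : nat) (A B : R) : R :=
  (\sum_(a \in coeffs_upto R d n A) NV R d n a B) / 2.

Definition avgNV (R : realType) (d n : nat) (A B : R) : R :=
  sumNV R d n A B / cardV R d n A.

(* Main.v *)
Require Import Defs.
From HB Require Import structures.
From mathcomp Require Import all_boot all_order all_algebra.
From mathcomp Require Import all_classical all_reals all_analysis measurable_realfun.
From mathcomp Require Import ring lra zify.
Import Order.TTheory GRing.Theory Num.Theory.
Import HBNNSimple.
Import numFieldNormedType.Exports.
Local Open Scope classical_set_scope.
Local Open Scope ring_scope.

Set Implicit Arguments.
Unset Strict Implicit.

(** Exchange the order of summation and fix a primitive point x. The condition
    F_a(x) = 0 puts a in the lattice of integer vectors orthogonal to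
    nu = nu_{d,n}(x), of covolume ||nu||. With rho = |x|_oo = |x_{i0}|, dropping
    the coordinate of x_{i0}^d identifies it with the index rho^d lattice of
    integer vectors whose pairing with nu is 0 modulo rho^d. Every residue modulo
    rho^d is represented by a vector of size O(rho): write it in base x_{i0} with
    digits that are combinations of the x_i^j, i <> i0. Translating by these
    vectors compares the lattice points of norm <= U with all integer points in an
    ellipsoid, with relative error O(rho / U) for U >= rho. For U < rho the mixed
    monomial x_j^(d-1) x_l, not used in the representation, gives the bound
    O(U^2 rho^(N-3-d)), and this is summable in the Moebius inversion that passes
    to primitive a. It remains to sum 1 / ||nu(x)||, homogeneous of degree -d, over
    primitive x, which is done by comparison with the integral on unit cells. *)

(** * Integrals of arbitrary nonnegative functions *)

(** The dropped coordinate is one where |nu_e| is largest. Solving for it turns the squared norm on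
    the hyperplane into |y|^2 + (c.y)^2 with c_e = nu_e / nu_{e0} and all |c_e| <= 1, so the
    distortion of the ellipsoid is bounded uniformly in x, and rho^d sqrt(1 + |c|^2) = ||nu||
    recovers the covolume. Short residue representatives take the place of a reduced basis: they
    make the rho^d classes equinumerous up to a change of O(rho) in the radius, so each has its
    share rho^-d of the ellipsoid. The resulting errors A^(N-2) rho^(1-d), summed over |x| <= X =
    B^(1/(n+1-d)), give the relative error X / A. Moebius inversion needs the count at every radius
    A / k, hence also far below rho, where the ellipsoid comparison says nothing; the exponent in
    U^2 is just enough for a convergent sum of k^-2. The logarithm comes from the variation
    O(rho^(-d-1)) of 1 / ||nu|| over a unit cell, whose sum over |x| <= X is O(log X) when d = n. *)

Section Integral.
Variable R : realType.
Local Open Scope ereal_scope.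
Local Notation leb := (@lebesgue_measure R).
Local Notation "'int1' f" := (\int[leb]_(x in [set: R]) f x) (at level 10, f at level 8).

(* The integral of a nonnegative function is the supremum of the integrals of the
   simple functions below it: monotonicity and affine substitution then need no
   measurability, which would be awkward to carry through [iint]. *)
Lemma integral_le_sup (f : R -> \bar R) (C : \bar R) : (forall x, 0 <= f x) ->
  (forall h : {nnsfun (measurableTypeR R) >-> R}, (forall x, (h x)%:E <= f x) -> sintegral leb h <= C) ->
  int1 f <= C.
Proof.
move=> f0 H; rewrite ge0_integralTE //.
by apply: ge_ereal_sup => _ /= [h hf <-]; exact: H.
Qed.

Lemma sintegral_le_integral (f : R -> \bar R) (h : {nnsfun (measurableTypeR R) >-> R}) :
  (forall x, (h x)%:E <= f x) -> sintegral leb h <= int1 f.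
Proof.
move=> hf; rewrite ge0_integralTE; last first.
  by move=> x; apply: le_trans (hf x); rewrite lee_fin.
by apply: ereal_sup_ubound; exists h.
Qed.

Lemma integral_monotone (f g : R -> \bar R) : (forall x, 0 <= f x) ->
  (forall x, f x <= g x) -> int1 f <= int1 g.
Proof.
move=> f0 fg; apply: integral_le_sup => // h hf.
by apply: sintegral_le_integral => x; apply: le_trans (hf x) (fg x).
Qed.

Lemma integralZ_le (f : R -> \bar R) (c : R) : (forall x, 0 <= f x) -> (0 < c)%R ->
  c%:E * int1 f <= int1 (fun x => c%:E * f x).
Proof.
move=> f0 c0; rewrite muleC -lee_pdivlMr //.
apply: integral_le_sup => // h hf.
rewrite lee_pdivlMr // muleC -sintegralrM.
have c0' := ltW c0.
rewrite -[X in sintegral _ X]/(scale_nnsfun h c0' : _ -> _).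
apply: sintegral_le_integral => x /=.
by rewrite EFinM lee_pmul2l // ?lte_fin // fin_numE.
Qed.

Lemma integralZ (f : R -> \bar R) (c : R) : (forall x, 0 <= f x) -> (0 < c)%R ->
  int1 (fun x => c%:E * f x) = c%:E * int1 f.
Proof.
move=> f0 c0; apply/eqP; rewrite eq_le integralZ_le // andbT.
rewrite -lee_pdivrMl //.
have := @integralZ_le (fun x => c%:E * f x) c^-1 _ _.
under [X in _ <= X]eq_integral do rewrite muleA -EFinM mulVf ?gt_eqF // mul1e.
by apply => [x|]; rewrite ?invr_gt0 // mule_ge0 // lee_fin ltW.
Qed.

Section affine.
Variables (a b : R).
Hypothesis a0 : (0 < a)%R.
Let aff (y : measurableTypeR R) : measurableTypeR R := (a * y + b)%R.
Let maff : measurable_fun (setT : set (measurableTypeR R)) aff.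
Proof. by apply: measurable_realfun.measurable_funD => //; apply: measurable_realfun.measurable_funM. Qed.

(** The set function on the right is a measure with the Lebesgue values on half-open intervals,
    hence is Lebesgue measure by uniqueness. *)
Lemma lebesgue_affine (A : set (measurableTypeR R)) : measurable A ->
  leb A = a%:E * leb (aff @^-1` A).
Proof.
move=> mA.

pose aff' : {mfun (measurableTypeR R) >-> (measurableTypeR R)} := HB.pack aff (isMeasurableFun.Build _ _ (measurableTypeR R) (measurableTypeR R) aff maff).
have := @lebesgue_measure_unique R (mscale (NngNum (ltW a0)) (pushforward leb aff')) _ A mA.
apply=> X [[c d]] /= _ <-.
rewrite /mscale /= /pushforward /=.
have -> : (aff @^-1` `]c, d]) = [set` `](((c - b) / a)%R), (((d - b)/a)%R)]].
  apply/seteqP; split => y /=; rewrite !in_itv /= /aff.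
    by rewrite ltr_pdivrMr // ler_pdivlMr // [(y * a)%R]mulrC ltrBlDr lerBrDr.
  by rewrite ltr_pdivrMr // ler_pdivlMr // [(y * a)%R]mulrC ltrBlDr lerBrDr.
rewrite !lebesgue_measure_itv /= !lte_fin ltr_pM2r ?invr_gt0 // ltrD2r.
case: ifP => _; last by rewrite mule0.
rewrite -!EFinB -EFinM; congr EFin; field. by rewrite gt_eqF.
Qed.

(** Composition with [aff] sends simple functions below [f] to simple functions below the composite.
    The converse inequality is this one for the inverse affine map, see [integral_affine]. *)
Lemma integral_affine_le (f : R -> \bar R) : (forall x, 0 <= f x) ->
  int1 f <= a%:E * int1 (fun y => f (aff y)).
Proof.
move=> f0; apply: integral_le_sup => // h hf.
have [h' Hh'] : exists h' : {nnsfun (measurableTypeR R) >-> R}, forall x, h' x = h (aff x).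
  pose g : measurableTypeR R -> R := fun x => h (aff x).
  have mg : measurable_fun setT g by apply: measurableT_comp.
  have fg : finite_set (range g).
    by apply: (sub_finite_set _ (fimfunP h)) => x /= [y _ <-]; exists (aff y).
  have pg : forall x, (0 <= g x)%R by move=> x; rewrite /g /=.
  pose g1 : {nnsfun (measurableTypeR R) >-> R} := HB.pack g (isMeasurableFun.Build _ _ (measurableTypeR R) R g mg) (FiniteImage.Build _ _ g fg) (isNonNegFun.Build _ _ g pg).
  by exists g1.
have -> : sintegral leb h = a%:E * sintegral leb h'.
  rewrite !sintegralET ge0_mule_fsumr; last first.
    by move=> x; apply: nnsfun_mulemu_ge0.
  apply: eq_fsbigr => x _; rewrite muleCA; congr (_ * _).
  rewrite lebesgue_affine //; congr (_ * leb _).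
  by apply/seteqP; split => y /=; rewrite Hh'.
rewrite lee_pmul2l // ?fin_numE // ?lte_fin //.
by apply: sintegral_le_integral => x /=; rewrite Hh'.
Qed.
End affine.

Lemma integral_affine (a b : R) (f : R -> \bar R) : (0 < a)%R -> (forall x, 0 <= f x) ->
  int1 f = a%:E * int1 (fun y => f (a * y + b)%R).
Proof.
move=> a0 f0; apply/eqP; rewrite eq_le integral_affine_le //=.
rewrite -lee_pdivlMl //.
have V : (0 < a^-1)%R by rewrite invr_gt0.
have := @integral_affine_le a^-1 (- b / a)%R V (fun y => f (a * y + b)%R) (fun y => f0 _).
have -> // : (fun y => f (a * (a^-1 * y + - b / a) + b)%R) = f.
by apply/funext => x; congr f; field; rewrite gt_eqF.
Qed.

End Integral.

Section IteratedIntegral.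
Variable R : realType.
Local Notation leb := (@lebesgue_measure R).
Local Open Scope ereal_scope.
Implicit Types f g : seq R -> \bar R.

Lemma iint_ge0 k f : (forall s, 0 <= f s) -> 0 <= iint R k f.
Proof.
elim: k f => [|k IH] f f0 //=.
by apply: integral_ge0 => x _; apply: IH => s.
Qed.

Lemma iint_le k f g : (forall s, 0 <= f s) ->
  (forall s, size s = k -> f s <= g s) -> iint R k f <= iint R k g.
Proof.
elim: k f g => [|k IH] f g f0 fg /=; first exact: fg.
apply: integral_monotone => [x|x]; first exact: iint_ge0.
by apply: IH => // s sk; apply: fg => /=; rewrite sk.
Qed.

Lemma iint_eq k f g : (forall s, size s = k -> f s = g s) -> iint R k f = iint R k g.
Proof.
elim: k f g => [|k IH] f g fg /=; first exact: fg.
apply: eq_integral => x _.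
by apply: IH => // s sk; apply: fg => /=; rewrite sk.
Qed.

Lemma iintZ k f (c : R) : (forall s, 0 <= f s) -> (0 < c)%R ->
  iint R k (fun s => c%:E * f s) = c%:E * iint R k f.
Proof.
move=> + c0; elim: k f => [|k IH] f f0 //=.
rewrite -integralZ //; last by move=> x; apply: iint_ge0.
by apply: eq_integral => x _; rewrite IH.
Qed.

(** [iint] puts the first coordinate outermost; completing the square in [iint_ellipsoid] works on
    the innermost integral, that of the last coordinate. *)
Lemma iint_rcons k f : iint R k.+1 f =
  iint R k (fun s => \int[leb]_(y in [set: R]) f (rcons s y)).
Proof.
elim: k f => [|k IH] f //.
by apply: eq_integral => x _; exact: (IH (fun s => f (x :: s))).
Qed.

Lemma iint_scale k f (a : R) : (forall s, 0 <= f s) -> (0 < a)%R ->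
  iint R k f = (a ^+ k)%:E * iint R k (fun s => f [seq (a * x)%R | x <- s]).
Proof.
move=> + a0; elim: k f => [|k IH] f f0 /=; first by rewrite expr0 mul1e.
rewrite (@integral_affine _ a 0) //; last by move=> x; apply: iint_ge0.
rewrite exprS EFinM -muleA; congr (_ * _).
rewrite -integralZ; last by rewrite exprn_gt0.
  by apply: eq_integral => x _; rewrite addr0 IH.
by move=> x; apply: iint_ge0.
Qed.

Let measurable_scaled_indic (a : \bar R) (D : set R) : measurable D ->
  measurable_fun [set: measurableTypeR R] (fun x : measurableTypeR R => a * (\1_D x)%:E).
Proof.
move=> mD; apply: measurable_funeM.
by apply/measurable_EFinP; exact: measurable_indic.
Qed.

Let integral_scaled_indic (a : \bar R) (D : set R) : measurable D -> 0 <= a ->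
  \int[leb]_(x in [set: R]) (a * (\1_D x)%:E) = a * leb D.
Proof.
move=> mD a0; rewrite ge0_integralZl //; first by rewrite integral_indic // setIT.
by apply/measurable_EFinP; exact: measurable_indic.
Qed.

(** Additivity, unlike monotonicity, relies on measurability, so it is proved for combinations of
    box indicators; slicing at the first coordinate gives such a combination again. The series will
    carry the dyadic majorant at the origin, the finite sum the unit cells. *)
Lemma iint_boxes (J : Type) k (c : nat -> \bar R) (D : nat -> nat -> set R)
    (r : seq J) (c' : J -> \bar R) (D' : J -> nat -> set R) :
  (forall j, 0 <= c j) -> (forall j i, measurable (D j i)) ->
  (forall j, 0 <= c' j) -> (forall j i, measurable (D' j i)) ->
  iint R k (fun s => \sum_(j <oo) (c j * (\prod_(i < k) \1_(D j i) (nth 0%R s i))%:E)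
       + \sum_(j <- r) (c' j * (\prod_(i < k) \1_(D' j i) (nth 0%R s i))%:E)) =
  \sum_(j <oo) (c j * \prod_(i < k) leb (D j i)) + \sum_(j <- r) (c' j * \prod_(i < k) leb (D' j i)).
Proof.
move=> + + + +; elim: k c D c' D' => [|k IH] c D c' D' c0 mD c'0 mD' /=.
  congr (_ + _).
    by apply: eq_eseriesr => j _; rewrite !big_ord0.
  by apply: eq_bigr => j _; rewrite !big_ord0.
have leb0 A : 0 <= leb A by [].
have P0 (D0 : nat -> nat -> set R) j : 0 <= \prod_(i < k) leb (D0 j i.+1).
  by apply: prode_ge0.
have P'0 j : 0 <= \prod_(i < k) leb (D' j i.+1) by apply: prode_ge0.
have a0 (e : \bar R) D0 (x : R) : 0 <= e -> 0 <= e * (\1_D0 x)%:E.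
  by move=> e0; apply: mule_ge0 => //; rewrite lee_fin indicE.
transitivity (\int[leb]_(x in [set: R]) (
   \sum_(j <oo) (c j * \prod_(i < k) leb (D j i.+1)) * (\1_(D j 0%N) x)%:E
   + \sum_(j <- r) (c' j * \prod_(i < k) leb (D' j i.+1)) * (\1_(D' j 0%N) x)%:E)).
  apply: eq_integral => x _.
  transitivity (iint R k (fun s => \sum_(j <oo) ((c j * (\1_(D j 0%N) x)%:E) * (\prod_(i < k) \1_(D j i.+1) (nth 0%R s i))%:E)
       + \sum_(j <- r) ((c' j * (\1_(D' j 0%N) x)%:E) * (\prod_(i < k) \1_(D' j i.+1) (nth 0%R s i))%:E))).
    apply: iint_eq => s _; congr (_ + _).
      by apply: eq_eseriesr => j _; rewrite big_ord_recl /= EFinM muleA.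
    by apply: eq_bigr => j _; rewrite big_ord_recl /= EFinM muleA.
  rewrite (IH _ (fun j i => D j i.+1) _ (fun j i => D' j i.+1)) //; try by move=> j; apply: a0.
  congr (_ + _).
    by apply: eq_eseriesr => j _; rewrite -!muleA; congr (_ * _); rewrite muleC.
  by apply: eq_bigr => j _; rewrite -!muleA; congr (_ * _); rewrite muleC.
rewrite ge0_integralD //.
- congr (_ + _).
    rewrite integral_nneseries //.
    + apply: eq_eseriesr => j _; rewrite integral_scaled_indic //; last by rewrite mule_ge0.
      by rewrite big_ord_recl /= -muleA; congr (_ * _); rewrite muleC.
    + by move=> j; apply: measurable_scaled_indic.
    + by move=> j x _; apply: a0; rewrite mule_ge0.
  rewrite ge0_integral_sum //.
  + apply: eq_bigr => j _; rewrite integral_scaled_indic //; last by rewrite mule_ge0.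
    by rewrite big_ord_recl /= -muleA; congr (_ * _); rewrite muleC.
  + by move=> j; apply: measurable_scaled_indic.
  + by move=> j x _; apply: a0; rewrite mule_ge0.
- by move=> x _; apply: nneseries_ge0 => j _ _; apply: a0; rewrite mule_ge0.
- apply: ge0_emeasurable_sum.
    by move=> j x _ _; apply: a0; rewrite mule_ge0.
  by move=> j _; apply: measurable_scaled_indic.
- by move=> x _; apply: sume_ge0 => j _; apply: a0; rewrite mule_ge0.
- apply: emeasurable_sum => j; exact: measurable_scaled_indic.
Qed.

End IteratedIntegral.

(** * Volumes of ellipsoids by completing squares *)

Section Ellipsoid.
Variable R : realType.

Definition sqn (k : nat) (s : seq R) : R := \sum_(i < k) nth 0 s i ^+ 2.
Definition dotn (k : nat) (c : nat -> R) (s : seq R) : R := \sum_(i < k) c i * nth 0 s i.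

Lemma sqn_rcons k s y : size s = k -> sqn k.+1 (rcons s y) = sqn k s + y ^+ 2.
Proof.
move=> sk; rewrite /sqn big_ord_recr /= nth_rcons sk ltnn eqxx; congr (_ + _).
by apply: eq_bigr => i _; rewrite nth_rcons sk ltn_ord.
Qed.

Lemma dotn_rcons k c s y : size s = k -> dotn k.+1 c (rcons s y) = dotn k c s + c k * y.
Proof.
move=> sk; rewrite /dotn big_ord_recr /= nth_rcons sk ltnn eqxx; congr (_ + _).
by apply: eq_bigr => i _; rewrite nth_rcons sk ltn_ord.
Qed.

(* Complete the square in the last variable; the new inner integral is again a
   function of a form [|s|^2 + (c''.s)^2] with [c'' = c / sqrt (1 + c_k^2)]. *)
Lemma iint_ellipsoid k (c : nat -> R) (phi : R -> \bar R) : (forall q, 0 <= phi q)%E ->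
  iint R k (fun s => phi (sqn k s + dotn k c s ^+ 2)) =
  (((Num.sqrt (1 + \sum_(i < k) c i ^+ 2))^-1)%:E * iint R k (fun s => phi (sqn k s)))%E.
Proof.
elim: k c phi => [|k IH] c phi phi0.
  by rewrite /= big_ord0 addr0 sqrtr1 invr1 mul1e /sqn /dotn !big_ord0 expr0n addr0.
rewrite !iint_rcons.
pose g := Num.sqrt (1 + c k ^+ 2).
have c0 : 0 <= c k ^+ 2 by apply: sqr_ge0.
have g2 : g ^+ 2 = 1 + c k ^+ 2 by rewrite sqr_sqrtr //; lra.
have g0 : 0 < g by rewrite sqrtr_gt0; lra.
have gN : g != 0 by rewrite gt_eqF.
pose Phi q := (\int[@lebesgue_measure R]_(y in [set: R]) phi (q + y ^+ 2)%R)%E.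
have Phi0 q : (0 <= Phi q)%E by apply: integral_ge0.
have -> : iint R k (fun s => \int[@lebesgue_measure R]_(y in [set: R]) phi (sqn k.+1 (rcons s y)))%E =
   iint R k (fun s => Phi (sqn k s)).
  apply: iint_eq => s sk; apply: eq_integral => y _; by rewrite sqn_rcons.
pose c'' i := c i / g.
have -> : iint R k (fun s => \int[@lebesgue_measure R]_(y in [set: R])
     phi (sqn k.+1 (rcons s y) + dotn k.+1 c (rcons s y) ^+ 2)%R)%E =
   iint R k (fun s => (g^-1)%:E * Phi (sqn k s + dotn k c'' s ^+ 2)%R)%E.
  apply: iint_eq => s sk.
  pose u := dotn k c s.
  have du : dotn k c'' s = u / g.
    by rewrite /u /dotn mulr_suml; apply: eq_bigr => i _; rewrite /c'' mulrAC.
  (* As g^2 = 1 + c_k^2, one has y^2 + (u + c_k y)^2 = (g y + c_k u / g)^2 + (u / g)^2; this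
     substitution absorbs the factor g^-1. *)
  rewrite /Phi [in RHS](@integral_affine _ g (c k * u / g)) // muleA -EFinM mulVf // mul1e.
  apply: eq_integral => y _; congr phi.
  rewrite sqn_rcons // dotn_rcons // -/u du.
  rewrite -!addrA; congr (_ + _).
  have e1 : u ^+ 2 / g ^+ 2 * (1 + c k ^+ 2) = u ^+ 2 by rewrite -g2 mulrVK // unitfE expf_neq0.
  have -> : (u / g) ^+ 2 = u ^+ 2 / g ^+ 2 by rewrite exprMn exprVn.
  have -> : (g * y + c k * u / g) ^+ 2 = (1 + c k ^+ 2) * y ^+ 2 + 2 * c k * u * y + c k ^+ 2 * (u ^+ 2 / g ^+ 2).
    rewrite -g2; field; exact: gN.
  nra.
rewrite iintZ //; last by rewrite invr_gt0.
rewrite IH // muleA; congr (_ * _)%E.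
rewrite -EFinM; congr EFin; rewrite -invfM; congr (_^-1).
rewrite /g -sqrtrM ?addr_ge0 //; congr (Num.sqrt _).
rewrite big_ord_recr /= mulrDr mulr1 mulr_sumr.
have -> : \sum_(i < k) (1 + c k ^+ 2) * c'' i ^+ 2 = \sum_(i < k) c i ^+ 2.
  apply: eq_bigr => i _; rewrite /c'' -g2; field; exact: gN.
lra.
Qed.

End Ellipsoid.

(** * Lattice points and volumes *)

Section Boxes.
Variable T : finType.
Implicit Types (z : {ffun T -> int}) (K : nat).

Definition intbox K : seq {ffun T -> int} :=
  [seq [ffun i => ((g i : 'I_(2 * K).+1) : nat)%:Z - K%:Z] | g : {ffun T -> 'I_(2 * K).+1}].

Lemma mem_intbox K z : (z \in intbox K) = [forall i, (`|z i| <= K)%N].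
Proof.
apply/idP/forallP => [/mapP [g _ ->] i|H].
  rewrite ffunE; have := ltn_ord (g i). move: (nat_of_ord (g i)) => a. lia.
have h i : (`|(z i + K%:Z)%R|%N < (2 * K).+1)%N by have := H i; lia.
apply/mapP; exists [ffun i => Ordinal (h i)]; first by rewrite mem_enum.
by apply/ffunP => i; rewrite !ffunE /=; have := H i; lia.
Qed.

Lemma uniq_intbox K : uniq (intbox K).
Proof.
rewrite map_inj_uniq ?enum_uniq // => g1 g2 /ffunP H.
by apply/ffunP => i; apply/val_inj => /=; have := H i; rewrite !ffunE; lia.
Qed.

Lemma size_intbox K : size (intbox K) = ((2 * K).+1 ^ #|T|)%N.
Proof. by rewrite size_map -cardE card_ffun card_ord. Qed.

Variable R : realType.

Lemma normz_le_znorm z i : (`|z i|%N)%:R <= znorm R T z.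
Proof.
rewrite -[X in X <= _]ger0_norm ?ler0n // -sqrtr_sqr /znorm.
rewrite ler_wsqrtr // (bigD1 i) //= natr_absz.
rewrite -[X in X <= _]addr0 lerD //; last first.
  by apply: sumr_ge0 => j _; apply: sqr_ge0.
by rewrite intr_norm real_normK ?num_real.
Qed.

Lemma znorm_ge0 z : 0 <= znorm R T z. Proof. exact: sqrtr_ge0. Qed.

Definition zball (U : R) := [seq z <- intbox (Num.trunc U) | znorm R T z <= U].

Lemma mem_zball U z : (z \in zball U) = (znorm R T z <= U).
Proof.
rewrite mem_filter; case: (boolP (_ <= U)) => //= zU.
rewrite mem_intbox; apply/forallP => i.
have U0 : 0 <= U by apply: le_trans (znorm_ge0 z) zU.
by rewrite truncn_ge_nat //; apply: le_trans (normz_le_znorm z i) zU.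
Qed.

Lemma uniq_zball U : uniq (zball U).
Proof. exact/filter_uniq/uniq_intbox. Qed.

Lemma size_inj_le (T1 T2 : eqType) (s1 : seq T1) (s2 : seq T2) (f : T1 -> T2) :
  uniq s1 -> {in s1 &, injective f} -> {in s1, forall x, f x \in s2} ->
  (size s1 <= size s2)%N.
Proof.
move=> u1 fi fs; rewrite -(size_map f); apply: uniq_leq_size.
  by rewrite map_inj_in_uniq.
by move=> _ /mapP [x xs ->]; apply: fs.
Qed.

Lemma znorm_sq z : znorm R T z ^+ 2 = \sum_i ((z i)%:~R : R) ^+ 2.
Proof. by rewrite sqr_sqrtr // sumr_ge0 // => i _; apply: sqr_ge0. Qed.

(** The squared norm of a vector of a hyperplane in terms of the coordinates left after solving for
    one of them, which equals -(c.y). *)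
Definition ellq (c y : T -> R) : R := \sum_i y i ^+ 2 + (\sum_i c i * y i) ^+ 2.

Lemma ellq_ge c y : \sum_i y i ^+ 2 <= ellq c y.
Proof. by rewrite lerDl sqr_ge0. Qed.

(* Minkowski, from [(a+b)^2 <= (1 + D/U) a^2 + (1 + U/D) b^2] *)
Lemma ellq_add c y w (U D : R) : 0 < U -> 0 < D -> ellq c y <= U ^+ 2 -> ellq c w <= D ^+ 2 ->
  ellq c (fun i => y i + w i) <= (U + D) ^+ 2.
Proof.
move=> U0 D0 yU wD.
have key (a b : R) : (a + b) ^+ 2 <= (1 + D / U) * a ^+ 2 + (1 + U / D) * b ^+ 2.
  rewrite -subr_ge0.
  have -> : (1 + D / U) * a ^+ 2 + (1 + U / D) * b ^+ 2 - (a + b) ^+ 2 = (D * a - U * b) ^+ 2 / (U * D).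
    by field; rewrite !gt_eqF.
  by rewrite divr_ge0 ?sqr_ge0 // ltW // mulr_gt0.
apply: (@le_trans _ _ ((1 + D / U) * ellq c y + (1 + U / D) * ellq c w)).
  rewrite /ellq !mulrDr addrACA lerD //.
    rewrite !mulr_sumr -big_split /=; apply: ler_sum => i _; exact: key.
  rewrite (_ : \sum_i c i * (y i + w i) = \sum_i c i * y i + \sum_i c i * w i) //.
  by rewrite -big_split /=; apply: eq_bigr => i _; rewrite mulrDr.
apply: (@le_trans _ _ ((1 + D / U) * U ^+ 2 + (1 + U / D) * D ^+ 2)).
  by apply: lerD; apply: ler_wpM2l => //; rewrite addr_ge0 // divr_ge0 // ltW.
rewrite le_eqVlt; apply/orP; left; apply/eqP; field; by rewrite !gt_eqF.
Qed.

Lemma ellq_small c w (D : R) : (forall i, `|c i| <= 1) -> (forall i, `|w i| <= D) ->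
  ellq c w <= ((#|T|.+1)%:R * D) ^+ 2.
Proof.
move=> c1 wD.
(* Only a point of [T] forces D >= 0. *)
have [T0|T0] := posnP #|T|.
  have e i : (i : T) \in pred0 by rewrite -(card0_eq T0) inE.
  rewrite /ellq !big1; try by move=> i; have := e i.
  by rewrite expr0n addr0 sqr_ge0.
have D0 : 0 <= D.
  by case/card_gt0P: T0 => i _; apply: le_trans (normr_ge0 _) (wD i).
have h1 : \sum_i w i ^+ 2 <= #|T|%:R * D ^+ 2.
  rewrite -sum1_card natr_sum mulr_suml.
  apply: ler_sum => i _; rewrite mul1r -[_ ^+ 2]real_normK ?num_real //.
  by rewrite ler_pXn2r // nnegrE.
have h2 : `|\sum_i c i * w i| <= #|T|%:R * D.
  apply: le_trans (ler_norm_sum _ _ _) _.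
  rewrite -sum1_card natr_sum mulr_suml.
  apply: ler_sum => i _; rewrite mul1r normrM -[D]mul1r.
  exact: ler_pM.
have h3 : (\sum_i c i * w i) ^+ 2 <= (#|T|%:R * D) ^+ 2.
  rewrite -[X in X <= _]real_normK ?num_real // ler_pXn2r // nnegrE //.
  by rewrite mulr_ge0.
apply: le_trans (lerD h1 h3) _.
have hT : 0 <= #|T|%:R :> R by [].
rewrite -natr1; have := sqr_ge0 D; nra.
Qed.

End Boxes.

(** * Sums over integer points as integrals over unit cells *)

Section Cells.
Variables (R : realType) (T : finType).
Local Notation leb := (@lebesgue_measure R).

Definition rcoord (s : seq R) (i : T) : R := nth 0 s (enum_rank i).
Definition floorv (y : T -> R) : {ffun T -> int} := [ffun i => Num.floor (y i)].
Definition inbox (D : R) (y : T -> R) : bool := [forall i, `|y i| <= D].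

Lemma sum_rcoord (V : nmodType) (g : T -> R -> V) (s : seq R) :
  \sum_i g i (rcoord s i) = \sum_(j < #|T|) g (enum_val j) (nth 0 s j).
Proof.
rewrite [RHS](reindex (@enum_rank T)) /=; last exact/onW_bij/enum_rank_bij.
by apply: eq_bigr => i _; rewrite enum_rankK.
Qed.

Lemma prod_indic k (D : nat -> set R) (s : seq R) :
  \prod_(i < k) \1_(D i) (nth 0 s i) = [forall i : 'I_k, nth 0 s i \in D i]%:R :> R.
Proof.
case: forallP => [H|H].
  by rewrite big1 // => i _; rewrite indicE H.
have /existsP [i Hi] : [exists i : 'I_k, nth 0 s i \notin D i].
  by rewrite -negb_forall; apply/negP => /forallP.
by rewrite (bigD1 i) //= indicE (negbTE Hi) mul0r.
Qed.

(** A unit cell has volume one, so a function constant on the cells integrates to the sum of its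
    values. Every comparison of a lattice sum with an integral passes through this identity; the
    series of cubes is there for the singularity of 1 / ||nu|| at the origin. *)
Lemma iint_cells (L : seq {ffun T -> int}) (w : {ffun T -> int} -> R) (c del : nat -> R) :
  uniq L -> (forall z, 0 <= w z) -> (forall j, 0 <= c j) -> (forall j, 0 <= del j) ->
  (iint R #|T| (fun s => \sum_(j <oo) (c j * (inbox (del j) (rcoord s))%:R)%:E
     + (if floorv (rcoord s) \in L then w (floorv (rcoord s)) else 0)%:E)
  = \sum_(j <oo) (c j * (2 * del j) ^+ #|T|)%:E + (\sum_(z <- L) w z)%:E)%E.
Proof.
move=> uL w0 c0 d0.
pose D (j i : nat) : set R := [set` `[- del j, del j]].
pose D' (z : {ffun T -> int}) (i : nat) : set R :=
  if insub i is Some i' then [set` `[(z (enum_val (i' : 'I_#|T|)))%:~R, (z (enum_val i') + 1)%:~R[] else setT.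
have mD' z i : measurable (D' z i) by rewrite /D'; case: insubP.
have D'E z (i : 'I_#|T|) : D' z i = [set` `[(z (enum_val i))%:~R, (z (enum_val i) + 1)%:~R[].
  by rewrite /D'; case: insubP => [i' _ /val_inj -> //|]; rewrite ltn_ord.
have := @iint_boxes R _ #|T| (fun j => (c j)%:E) D L (fun z => (w z)%:E) D'.
rewrite /= => H.
transitivity (\sum_(j <oo) ((c j)%:E * \prod_(i < #|T|) leb (D j i)) +
  \sum_(z <- L) ((w z)%:E * \prod_(i < #|T|) leb (D' z i)))%E.
  rewrite -H //; last by move=> j i; apply: measurable_itv.
  apply: iint_eq => s _; congr (_ + _)%E.
    apply: eq_eseriesr => j _; rewrite -EFinM; congr EFin; congr (_ * _).
    rewrite prod_indic; congr (_%:R); congr nat_of_bool.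
    apply/forallP/forallP => Hi i.
      have := Hi (enum_val i); rewrite /rcoord enum_valK.
      by rewrite inE /D /= in_itv /= ler_norml.
    have := Hi (enum_rank i); by rewrite inE /D /= in_itv /= ler_norml.
  under eq_bigr => z _.
    rewrite prod_indic.
    have -> : [forall i : 'I_#|T|, nth 0 s i \in D' z i] = (z == floorv (rcoord s)).
      apply/forallP/eqP => [Hi|-> i].
        apply/ffunP => i; rewrite ffunE; apply/esym/eqP; rewrite floor_eq.
        by have := Hi (enum_rank i); rewrite D'E inE /= in_itv /= enum_rankK.
      rewrite D'E inE /= in_itv /= ffunE /rcoord enum_valK.
      by rewrite -floor_eq.
    over.
  case: ifP => zL.
    rewrite (bigD1_seq (floorv (rcoord s))) //= eqxx mule1 big1 ?adde0 //.
    by move=> z /negbTE ->; rewrite mule0.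
  rewrite big1_seq // => z /andP [_ zz]; case: eqP => [E|]; last by rewrite mule0.
  by rewrite -E zz in zL.
congr (_ + _)%E.
  apply: eq_eseriesr => j _; rewrite EFinM; congr (_ * _)%E.
  have E : leb (D j 0%N) = (2 * del j)%:E.
    rewrite lebesgue_measure_itv /= lte_fin; case: ltP => h.
      by rewrite -EFinB; congr EFin; ring.
    by congr EFin; have := d0 j; lra.
  elim: #|T| => [|k IH]; first by rewrite big_ord0.
  by rewrite big_ord_recr /= IH [leb _]E exprSr EFinM.
rewrite -sumEFin; apply: eq_bigr => z _.
rewrite big1 ?mule1 // => i _; rewrite D'E lebesgue_measure_itv /= lte_fin ltr_int ltrDl /=.
by rewrite -EFinB intrD; congr EFin; ring.
Qed.

End Cells.

Section Volume.
Variable R : realType.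

Lemma iint_inbox k (del : R) : 0 <= del ->
  iint R k (fun s => [forall i : 'I_k, `|nth 0 s i| <= del]%:R%:E) = ((2 * del) ^+ k)%:E.
Proof.
move=> d0.
pose D (i : nat) : set R := [set` `[- del, del]].
have E0 (F : nat -> \bar R) : (\sum_(j <oo) (0 * F j) = 0)%E.
  by apply: eseries0 => j _ _; rewrite mul0e.
have E (i : nat) : lebesgue_measure (D i) = (2 * del)%:E.
  rewrite lebesgue_measure_itv /= lte_fin; case: ltP => h.
    by rewrite -EFinB; congr EFin; ring.
  by congr EFin; lra.
have := @iint_boxes R _ k (fun=> 0%E) (fun _ => D) [:: tt] (fun=> 1%E) (fun _ => D).
rewrite E0 add0e big_seq1 mul1e => H.
transitivity (\prod_(i < k) lebesgue_measure (D i))%E.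
  rewrite -H //; try by move=> j i; apply: measurable_itv.
  apply: iint_eq => s _; rewrite E0 add0e big_seq1 mul1e prod_indic.
  congr (_%:R%:E); congr nat_of_bool; apply: eq_forallb => i.
  by rewrite mem_setE /= in_itv /= ler_norml.
under eq_bigr do rewrite E.
elim: (k) => [|j IH]; first by rewrite big_ord0.
by rewrite big_ord_recr /= IH exprSr EFinM.
Qed.

Lemma normS_le k (s : seq R) (U : R) : size s = k -> 0 <= U ->
  (normS R s <= U) = (sqn k s <= U ^+ 2).
Proof.
move=> sk U0; rewrite /normS /sqn (big_nth 0) sk big_mkord.
set x := \sum_(i < k) _.
have x0 : 0 <= x by apply: sumr_ge0 => i _; exact: sqr_ge0.
by rewrite -[U in LHS]ger0_norm // -sqrtr_sqr ler_psqrt // nnegrE sqr_ge0.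
Qed.

Lemma if_natr (b : bool) : (if b then 1 else 0 : R) = b%:R.
Proof. by case: b. Qed.

(** [Vball] is a [fine], so finiteness must be known before it is a volume. The ball lies between
    the cubes of half-side 1 / (k + 1) and 1, which gives finiteness and positivity. *)
Lemma iint_ball1 k : iint R k (fun s => (if normS R s <= 1 then 1 else 0)%:E) = (Vball R k)%:E
  /\ 0 < Vball R k.
Proof.
set I := iint R k _.
have I0 : (I <= (2 ^+ k)%:E)%E.
  rewrite -[2]mulr1 -iint_inbox //; apply: iint_le.
    by move=> s; rewrite lee_fin; case: ifP.
  move=> s sk; rewrite lee_fin if_natr ler_nat; case: (boolP (_ <= _)) => // H.
  rewrite lt0b; apply/forallP => i; apply: le_trans H.
  rewrite -sqrtr_sqr ler_wsqrtr // (big_nth 0) sk big_mkord (bigD1 i) //=.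
  by rewrite lerDl sumr_ge0 // => j _; apply: sqr_ge0.
pose e : R := (k.+1%:R)^-1.
have e0 : 0 < e by rewrite invr_gt0.
have I1 : (((2 * e) ^+ k)%:E <= I)%E.
  rewrite -(iint_inbox _ (ltW e0)); apply: iint_le.
    by move=> s; rewrite lee_fin ler0n.
  move=> s sk; rewrite lee_fin if_natr ler_nat; case: forallP => // H.
  rewrite lt0b (@normS_le k) // expr1n /sqn.
  apply: (@le_trans _ _ (\sum_(i < k) e ^+ 2)).
    apply: ler_sum => i _; rewrite -[X in X <= _]real_normK ?num_real //.
    by rewrite ler_pXn2r ?nnegrE // ltW.
  rewrite sumr_const card_ord -[X in X <= _]mulr_natl /e exprVn ler_pdivrMr ?exprn_gt0 //.
  by rewrite mul1r -natrX ler_nat; lia.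
have If : I \is a fin_num.
  rewrite ge0_fin_numE; first by apply: le_lt_trans I0 (ltry _).
  by apply: iint_ge0 => s; rewrite lee_fin; case: ifP.
split; first by rewrite /Vball -/I fineK.
rewrite /Vball -/I -lte_fin fineK //; apply: lt_le_trans I1.
by rewrite lte_fin exprn_gt0 // mulr_gt0.
Qed.

Lemma Vball_gt0 k : 0 < Vball R k. Proof. by case: (iint_ball1 k). Qed.

Variable T : finType.
Local Notation k := #|T|.

Lemma iint_ellq (c : T -> R) (U : R) : 0 < U ->
  iint R k (fun s => (ellq c (rcoord s) <= U ^+ 2)%R%:R%:E) =
  (Vball R k / Num.sqrt (1 + \sum_i c i ^+ 2) * U ^+ k)%:E.
Proof.
move=> U0.
pose c' (j : nat) : R := if insub j is Some i then c (enum_val (i : 'I_#|T|)) else 0.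
have c'E (i : 'I_k) : c' i = c (enum_val i).
  by rewrite /c'; case: insubP => [i' _ /val_inj -> //|]; rewrite ltn_ord.
have -> : \sum_i c i ^+ 2 = \sum_(j < k) c' j ^+ 2.
  rewrite [RHS](reindex (@enum_rank T)) /=; last exact/onW_bij/enum_rank_bij.
  by apply: eq_bigr => i _; rewrite c'E enum_rankK.
have P (q : R) : (0 <= ((q <= U ^+ 2)%R%:R : R)%:E)%E by rewrite lee_fin ler0n.
have := @iint_ellipsoid R k c' (fun q => (q <= U ^+ 2)%R%:R%:E) P.
rewrite (@iint_scale _ _ (fun s => (sqn k s <= U ^+ 2)%R%:R%:E) U) //.
have -> : iint R k (fun s => (sqn k [seq U * x | x <- s] <= U ^+ 2)%R%:R%:E) = (Vball R k)%:E.
  have [<- _] := iint_ball1 k; apply: iint_eq => s sk.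
  rewrite if_natr (@normS_le k) // expr1n; congr (_%:R%:E); congr nat_of_bool.
  have -> : sqn k [seq U * x | x <- s] = U ^+ 2 * sqn k s.
    rewrite /sqn mulr_sumr; apply: eq_bigr => i _.
    by rewrite (nth_map 0) ?sk // exprMn.
  by rewrite -[X in _ <= X]mulr1 ler_pM2l // exprn_gt0.
move=> H.
rewrite (_ : Vball R k / _ * _ = (Num.sqrt (1 + \sum_(j < k) c' j ^+ 2))^-1 * (U ^+ k * Vball R k)); last by ring.
rewrite !EFinM -H.
  apply: iint_eq => s _; congr (_%:R%:E); congr nat_of_bool; congr (_ <= _).
  rewrite /ellq /sqn /dotn; congr (_ + _ ^+ 2).
    exact: (sum_rcoord (fun i x => x ^+ 2)).
  rewrite (sum_rcoord (fun i x => c i * x)); apply: eq_bigr => i _.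
  by rewrite c'E.
Qed.

Definition ellz (c : T -> R) (z : {ffun T -> int}) : R := ellq c (fun i => (z i)%:~R).

(* The filtered list is exhaustive because [ellz c z] dominates [|z|^2], see [mem_ellball]. *)
Definition ellball (c : T -> R) (U : R) : seq {ffun T -> int} :=
  [seq z <- zball T U | ellz c z <= U ^+ 2].

Lemma mem_ellball c U z : 0 <= U -> (z \in ellball c U) = (ellz c z <= U ^+ 2).
Proof.
move=> U0; rewrite mem_filter mem_zball; case: (boolP (_ <= U ^+ 2)) => //= H.
rewrite -[znorm _ _ _]ger0_norm ?znorm_ge0 // -[X in _ <= X]ger0_norm //.
rewrite -ler_sqr ?nnegrE ?normr_ge0 // !real_normK ?num_real // znorm_sq.
by apply: le_trans H; apply: ellq_ge.
Qed.

Lemma uniq_ellball c U : uniq (ellball c U).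
Proof. exact/filter_uniq/uniq_zball. Qed.

(** A point count thus becomes an integral, which [iint_le] can compare with the volume of an
    ellipsoid. *)
Lemma iint_floor_in (L : seq {ffun T -> int}) : uniq L ->
  iint R k (fun s => (floorv (rcoord s) \in L)%:R%:E) = (size L)%:R%:E.
Proof.
move=> uL.
have := @iint_cells R T L (fun=> 1) (fun=> 0) (fun=> 0) uL.
rewrite eseries0; last by move=> j _ _; rewrite mul0r.
rewrite add0e (_ : \sum_(z <- L) 1 = (size L)%:R); last by rewrite -sum1_size natr_sum.
move=> <- //.
apply: iint_eq => s _; rewrite eseries0 ?add0e; last by move=> j _ _; rewrite mul0r.
by rewrite if_natr.
Qed.

Lemma floorv_dist (y : T -> R) i : 0 <= y i - (floorv y i)%:~R < 1.
Proof.
rewrite ffunE; have /andP [h1 h2] := floor_itv (y i).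
by rewrite subr_ge0 h1 /=; move: h2; rewrite intrD; lra.
Qed.

Variable c : T -> R.
Hypothesis c1 : forall i, `|c i| <= 1.

(** Fractional parts lie in [0, 1) and |c_i| <= 1, so by [ellq_small] and [ellq_add] rounding
    changes the ellipsoidal norm by at most k + 1. *)
Lemma ellq_of_floor U y : 0 < U -> ellz c (floorv y) <= U ^+ 2 -> ellq c y <= (U + k.+1%:R) ^+ 2.
Proof.
move=> U0 H.
have := @ellq_add T R c (fun i => (floorv y i)%:~R) (fun i => y i - (floorv y i)%:~R) U k.+1%:R U0 _ H.
rewrite (_ : (fun i => (floorv y i)%:~R + (y i - (floorv y i)%:~R)) = y); last first.
  by apply/funext => i; rewrite addrC subrK.
apply=> //; rewrite -[k.+1%:R]mulr1; apply: ellq_small => // i.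
have /andP [h1 h2] := floorv_dist y i.
by rewrite ger0_norm // ltW.
Qed.

Lemma floor_of_ellq U y : 0 < U -> ellq c y <= U ^+ 2 -> ellz c (floorv y) <= (U + k.+1%:R) ^+ 2.
Proof.
move=> U0 H.
have := @ellq_add T R c y (fun i => (floorv y i)%:~R - y i) U k.+1%:R U0 _ H.
rewrite (_ : (fun i => y i + ((floorv y i)%:~R - y i)) = fun i => (floorv y i)%:~R); last first.
  by apply/funext => i; rewrite addrC subrK.
apply=> //; rewrite -[k.+1%:R]mulr1; apply: ellq_small => // i.
have /andP [h1 h2] := floorv_dist y i.
by rewrite distrC ger0_norm // ltW.
Qed.

Lemma size_ellball_le U : 0 < U -> (size (ellball c U))%:R <=
  Vball R k / Num.sqrt (1 + \sum_i c i ^+ 2) * (U + k.+1%:R) ^+ k.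
Proof.
move=> U0; rewrite -lee_fin -iint_floor_in ?uniq_ellball // -iint_ellq; last first.
  by rewrite addr_gt0.
apply: iint_le => [s|s _]; first by rewrite lee_fin ler0n.
rewrite lee_fin ler_nat; case: (boolP (_ \in _)) => //.
rewrite (mem_ellball _ _ (ltW U0)) => H; rewrite lt0b.
exact: ellq_of_floor.
Qed.

Lemma size_ellball_ge U : k.+1%:R < U ->
  Vball R k / Num.sqrt (1 + \sum_i c i ^+ 2) * (U - k.+1%:R) ^+ k <= (size (ellball c U))%:R.
Proof.
move=> U0; have U0' : 0 < U - k.+1%:R by rewrite subr_gt0.
rewrite -lee_fin -iint_floor_in ?uniq_ellball // -iint_ellq //.
apply: iint_le => [s|s _]; first by rewrite lee_fin ler0n.
rewrite lee_fin ler_nat; case: (boolP (_ <= _)) => // H; rewrite lt0b.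
rewrite mem_ellball; last by apply: le_trans (ltW U0).
by rewrite -[U in X in _ <= X](subrK k.+1%:R); apply: floor_of_ellq.
Qed.

End Volume.

(** * Moebius inversion *)

Section Moebius.
Local Open Scope nat_scope.

Lemma sum_multiples (V : nmodType) (K k : nat) (P : pred nat) (F : nat -> V) : 0 < k ->
  (\sum_(l < K.+1 | (k %| l)%N && P l) F l = \sum_(j < (K %/ k)%N.+1 | P (k * j)%N) F (k * j)%N)%R.
Proof.
move=> k0.
have lt (j : 'I_(K %/ k).+1) : k * j < K.+1.
  have := ltn_ord j; rewrite ltnS leq_divRL // => H; by rewrite ltnS mulnC.
have lt' (l : 'I_K.+1) : l %/ k < (K %/ k).+1 by rewrite ltnS leq_div2r // -ltnS.
rewrite (reindex_onto (fun j => Ordinal (lt j)) (fun l => Ordinal (lt' l))) /=; last first.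
  by move=> l /andP [kl _]; apply/val_inj => /=; rewrite mulnC divnK.
apply: eq_bigl => j; rewrite dvdn_mulr //=.
suff -> : Ordinal (lt' (Ordinal (lt j))) == j by rewrite andbT.
by apply/eqP/val_inj => /=; rewrite mulKn.
Qed.

(** The value of the Moebius function at the e-th power of a prime; [mob] extends it
    multiplicatively. *)
Definition mobc (e : nat) : int := if e is e'.+1 then (if e' is 0 then - 1 else 0)%R else 1%R.
Definition mob (n : nat) : int := (\prod_(0 <= p < n.+1 | prime p) mobc (logn p n))%R.

(** Puts [mob j] and [mob (p * j)] on a common range of primes, where they differ in the factor at
    [p] only. *)
Lemma mob_widen n K : 0 < n -> n < K ->
  mob n = (\prod_(0 <= p < K | prime p) mobc (logn p n))%R.
Proof.
move=> n0 nK; rewrite /mob [RHS](big_cat_nat (n := n.+1)) //= [X in (_ * X)%R]big1_seq ?mulr1 //.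
move=> p /andP [pp]; rewrite mem_index_iota => /andP [np _].
rewrite (_ : logn p n = 0) //; apply/eqP; rewrite eqn0Ngt logn_gt0 mem_primes pp n0 /=.
by apply/negP => /(dvdn_leq n0); rewrite leqNgt np.
Qed.

Lemma mob_norm n : (`|mob n| <= 1)%R.
Proof.
rewrite /mob normr_prod.
suff /andP [] : (0 <= \prod_(0 <= p < n.+1 | prime p) `|mobc (logn p n)| <= 1)%R by [].
apply: (big_ind (fun x : int => (0 <= x <= 1)%R)) => //.
  by move=> x y /andP [x0 x1] /andP [y0 y1]; rewrite mulr_ge0 //= mulr_ile1.
by move=> p _; case: (logn p n) => [|[|e]].
Qed.

Lemma mob_mulp p j : prime p -> 0 < j -> mob (p * j)%N = (if (p %| j)%N then 0 else - mob j)%R.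
Proof.
move=> pp j0; have p0 := prime_gt0 pp.
have pj0 : 0 < p * j by rewrite muln_gt0 p0.
rewrite (@mob_widen (p * j) (p * j).+1) // (@mob_widen j (p * j).+1) //; last first.
  by rewrite ltnS leq_pmull.
have pin : p < (p * j).+1 by rewrite ltnS leq_pmulr.
rewrite !big_mkord (bigD1 (Ordinal pin)) // [X in (if _ then _ else - X)%R](bigD1 (Ordinal pin)) //=.
rewrite (eq_bigr (fun i : 'I__ => mobc (logn i j))); last first.
  move=> q /andP [pq qp]; rewrite lognM // logn_prime //.
  by rewrite (_ : (nat_of_ord q == p) = false) //; apply/negbTE.
rewrite lognM // logn_prime // eqxx add1n.
case: ifP => H.
  have : 0 < logn p j by rewrite logn_gt0 mem_primes pp j0.
  by case: (logn p j) => // e _; rewrite /= mul0r.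
have -> : logn p j = 0 by apply/eqP; rewrite eqn0Ngt logn_gt0 mem_primes pp j0 H.
by rewrite /= mul1r mulN1r.
Qed.

(* With [p = pdiv m], the terms [j] and [p * j], [j] prime to [p], cancel. *)
Lemma sum_mob m K : 0 < m -> m <= K -> (\sum_(k < K.+1 | (k %| m)%N) mob k = (m == 1%N)%:R :> int)%R.
Proof.
move=> m0 mK.
have -> : (\sum_(k < K.+1 | (k %| m)%N) mob k = \sum_(k < m.+1 | (k %| m)%N) mob k)%R.
  rewrite (big_ord_widen_cond _ (fun k => k %| m) mob (mK : m < K.+1)).
  apply: eq_bigl => k; case: (boolP (k %| m)) => //= km; rewrite ltnS.
  by rewrite (dvdn_leq m0 km).
have [->|m1] := eqVneq m 1.
  rewrite big_mkcond !big_ord_recr big_ord0 /=.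
  by rewrite /mob big_mkcond !big_nat_recr //= big_geq.
have pp : prime (pdiv m) by apply: pdiv_prime; case: m m0 m1 {mK} => [|[]].
set p := pdiv m in pp.
have pm : p %| m by apply: pdiv_dvd.
rewrite (bigID (fun k : 'I_m.+1 => p %| k)) /=.
under eq_bigl do rewrite andbC.
rewrite (sum_multiples m (fun l => l %| m) mob (prime_gt0 pp)).
have -> : (\sum_(j < (m %/ p)%N.+1 | (p * j %| m)%N) mob (p * j)%N =
   \sum_(j < (m %/ p)%N.+1 | (j %| m)%N && ~~ (p %| j)%N) - mob j)%R.
  rewrite (bigID (fun j : 'I__ => p %| j)) /= big1 ?add0r; last first.
    move=> j /andP [jm pj]; rewrite mob_mulp // ?pj //.
    rewrite lt0n; apply/negP => /eqP e; move: jm; rewrite e muln0 dvd0n; lia.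
  rewrite (eq_bigl (fun j : 'I__ => (j %| m) && ~~ (p %| j))).
    apply: eq_bigr => j /andP [jm /negbTE pj]; rewrite mob_mulp // ?pj //.
    exact: dvdn_gt0 jm.
  move=> j; case: (boolP (p %| j)) => pj; first by rewrite !andbF.
  by rewrite !andbT Gauss_dvd ?pm // prime_coprime.
rewrite (big_ord_widen_cond m.+1 (fun j => (j %| m) && ~~ (p %| j)) (fun j => - mob j)%R); last first.
  by rewrite ltnS leq_div.
rewrite [X in (X + _)%R](eq_bigl (fun j : 'I_m.+1 => (j %| m) && ~~ (p %| j))).
  by rewrite sumrN addNr.
move=> j /=; case: (boolP (j %| m)) => //= jm; case: (boolP (p %| j)) => //= pj.
rewrite ltnS leq_divRL ?prime_gt0 // dvdn_leq // mulnC Gauss_dvd ?pm //.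
by rewrite prime_coprime.
Qed.

End Moebius.

(** * Partial sums of zeta and of its inverse *)

Section Zeta.
Variable R : realType.

Definition zsum (s J : nat) : R := \sum_(0 <= k < J) (k.+1%:R : R) ^- s.

Lemma zsum0 s : zsum s 0 = 0. Proof. by rewrite /zsum big_geq. Qed.

Lemma big_ord_pos (V : nmodType) (J : nat) (F : nat -> V) :
  \sum_(j < J.+1 | (0 < j)%N) F j = \sum_(0 <= k < J) F k.+1.
Proof. by rewrite big_mkcond big_ord_recl /= add0r big_mkord. Qed.

(** The subtracted term makes the induction telescope, through 1 / (x + 1)^2 <= 1 / x - 1 / (x + 1);
    larger exponents are dominated by 2. *)
Lemma zsum_le_tail s J m : (2 <= s)%N -> zsum s (J + m.+1) - zsum s J <= 2 / J.+1%:R - (J + m.+1)%:R^-1.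
Proof.
move=> s2.
have le2 (x : nat) : (x.+1%:R : R) ^- s <= x.+1%:R ^- 2.
  rewrite lef_pV2 ?posrE ?exprn_gt0 //.
  by rewrite -(subnKC s2) exprD ler_peMr ?exprn_ge0 // exprn_ege1 // ler1n.
elim: m => [|m IH].
  rewrite addn1 /zsum big_nat_recr //= addrAC subrr add0r.
  apply: le_trans (le2 J) _.
  have : (1 : R) <= J.+1%:R by rewrite ler1n.
  move: (J.+1%:R : R) => x x1; have x0 : 0 < x by lra.
  rewrite (_ : 2 / x - x^-1 = x^-1); last by ring.
  rewrite lef_pV2 ?posrE ?exprn_gt0 //; nra.
rewrite /zsum in IH *; rewrite addnS big_nat_recr //=.
rewrite addrAC; apply: le_trans (lerD IH (le2 _)) _.
rewrite -addrA lerD2l; have -> : ((J + m.+1).+1%:R : R) = (J + m.+1)%:R + 1 by rewrite natr1.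
have : (1 : R) <= (J + m.+1)%:R by rewrite ler1n addnS.
move: ((J + m.+1)%:R : R) => x x1.
rewrite -subr_ge0.
have -> : - (x + 1)^-1 - (- x^-1 + (x + 1) ^- 2) = (x * (x + 1) ^+ 2)^-1.
  by field; rewrite !gt_eqF //; lra.
by rewrite invr_ge0 mulr_ge0 ?sqr_ge0 //; lra.
Qed.

Lemma zsum_mono s J L : (J <= L)%N -> zsum s J <= zsum s L.
Proof.
move=> JL; rewrite /zsum (big_cat_nat _ JL) //= lerDl; apply: sumr_ge0 => k _.
by rewrite invr_ge0 exprn_ge0.
Qed.

Lemma zsum_tail s J L : (2 <= s)%N -> zsum s L - zsum s J <= 2 / J.+1%:R.
Proof.
move=> s2; case: (leqP L J) => [LJ|JL].
  by apply: (@le_trans _ _ 0); rewrite ?subr_le0 ?zsum_mono // divr_ge0.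
have -> : L = (J + (L - J.+1).+1)%N by lia.
by apply: le_trans (zsum_le_tail _ _ s2) _; rewrite gerBl invr_ge0.
Qed.

Lemma zeta_tail s J : (2 <= s)%N -> 0 <= zeta R s - zsum s J <= 2 / J.+1%:R.
Proof.
move=> s2.
have ndz : nondecreasing_seq (zsum s) by move=> J' L; exact: zsum_mono.
have Bz L : zsum s L <= 2 by have := zsum_tail 0 L s2; rewrite zsum0 subr0 divr1.
have cz : cvgn (zsum s).
  apply: nondecreasing_is_cvgn => //; exists 2 => _ [L _ <-]; exact: Bz.
have -> : zeta R s = limn (zsum s) by [].
rewrite subr_ge0 (nondecreasing_cvgn_le ndz cz J) /= lerBlDr.
apply: limr_le => //; apply: nearW => L; rewrite -lerBlDr; exact: zsum_tail.
Qed.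

Lemma zeta_ge1 s : (2 <= s)%N -> 1 <= zeta R s.
Proof.
move=> s2; have /andP [h _] := zeta_tail 1 s2.
by move: h; rewrite /zsum big_nat1 expr1n invr1 subr_ge0.
Qed.

Lemma mobR_norm k : `|(mob k)%:~R : R| <= 1.
Proof. by rewrite -intr_norm (ler_int R _ 1) mob_norm. Qed.

Definition mobsum (s K : nat) : R := \sum_(k < K.+1 | (0 < k)%N) (mob k)%:~R * (k%:R : R) ^- s.

(** Grouping the pairs (k, j) by l = k j <= K leaves l = 1 alone, by [sum_mob]. Truncating the inner
    sum at K / k makes the identity exact at every finite K. *)
Lemma mobsum_hyperbola s K : (0 < K)%N ->
  \sum_(k < K.+1 | (0 < k)%N) (mob k)%:~R * (k%:R : R) ^- s * zsum s (K %/ k) = 1.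
Proof.
move=> K0.
transitivity (\sum_(k < K.+1 | (0 < k)%N) \sum_(l < K.+1 | (k %| l)%N && (0 < l)%N) (mob k)%:~R * (l%:R : R) ^- s).
  apply: eq_bigr => k k0.
  rewrite (sum_multiples K (fun l => (0 < l)%N) (fun l => (mob k)%:~R * (l%:R : R) ^- s) k0).
  under eq_bigl => j do rewrite muln_gt0 k0 /=.
  rewrite (big_ord_pos _ (fun j => (mob k)%:~R * ((k * j)%:R : R) ^- s)) /zsum mulr_sumr.
  by apply: eq_bigr => j _; rewrite natrM exprMn invfM mulrA.
rewrite (exchange_big_dep (fun l : 'I_K.+1 => (0 < l)%N)) /=; last by move=> k l _ /andP [].
transitivity (\sum_(l < K.+1 | (0 < l)%N) (l%:R : R) ^- s * (l == 1%N :> nat)%:R).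
  apply: eq_bigr => l l0.
  have lK : (l <= K)%N by rewrite -ltnS.
  have := congr1 (fun x : int => (x%:~R : R)) (sum_mob l0 lK).
  rewrite (_ : ((l == 1%N :> nat)%:R : int)%:~R = (l == 1%N :> nat)%:R); last by case: (_ == _).
  rewrite rmorph_sum /= => <-; rewrite mulr_sumr; apply: eq_big => [k|k _]; last by rewrite mulrC.
  by rewrite l0 andbT; case: (boolP (k %| l)%N) => kl; rewrite ?andbF // (dvdn_gt0 l0 kl).
rewrite (big_ord_pos _ (fun l => (l%:R : R) ^- s * (l == 1%N)%:R)).
rewrite big_ltn // eqxx expr1n invr1 mulr1 big1_seq ?addr0 //.
move=> l; rewrite mem_index_iota /= => /andP [l1 _].
by rewrite (_ : (l.+1 == 1%N) = false) ?mulr0 //; lia.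
Qed.

(** The tail of zeta beyond K / k is at most 2 k / K. This costs one factor k, and s >= 3 leaves the
    summable k^-2. *)
Lemma mobsum_zeta s K : (3 <= s)%N -> (0 < K)%N -> `|zeta R s * mobsum s K - 1| <= 4 / K%:R.
Proof.
move=> s3 K0; have s2 : (2 <= s)%N by lia.
rewrite -[X in _ - X](mobsum_hyperbola s K0) /mobsum mulr_sumr -sumrB.
apply: le_trans (ler_norm_sum _ _ _) _.
apply: (@le_trans _ _ (\sum_(k < K.+1 | (0 < k)%N) (2 / K%:R) * (k%:R : R) ^- 2)).
  apply: ler_sum => k k0.
  rewrite [zeta R s * _]mulrC -mulrBr !normrM -mulrA.
  have kR : 0 < (k%:R : R) by rewrite ltr0n.
  have /andP [t0 t1] := zeta_tail (K %/ k) s2.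
  apply: le_trans (_ : 1 * (k%:R ^- 3 * (2 / (K %/ k).+1%:R)) <= _).
    apply: ler_pM; rewrite ?mulr_ge0 ?mobR_norm //.
    rewrite ger0_norm ?invr_ge0 ?exprn_ge0 // ger0_norm //.
    apply: ler_pM => //; rewrite ?invr_ge0 ?exprn_ge0 //.
    rewrite lef_pV2 ?posrE ?exprn_gt0 //.
    by rewrite -(subnKC s3) exprD ler_peMr ?exprn_ge0 // exprn_ege1 // ler1n.
  rewrite mul1r [X in _ <= X]mulrC.
  have -> : (k%:R : R) ^- 3 = k%:R ^- 2 / k%:R by rewrite -invfM -exprSr.
  rewrite -mulrA ler_wpM2l ?invr_ge0 ?exprn_ge0 // mulrCA ler_wpM2l //.
  rewrite -invfM lef_pV2 ?posrE ?ltr0n ?mulr_gt0 ?ltr0n //.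
  rewrite -natrM ler_nat ltnW // mulnC; exact: ltn_ceil.
rewrite -mulr_sumr (big_ord_pos _ (fun k => (k%:R : R) ^- 2)).
have -> : 4 / K%:R = 2 / K%:R * 2 :> R by ring.
rewrite ler_wpM2l ?divr_ge0 //.
by have := @zsum_tail 2 0 K isT; rewrite zsum0 subr0 divr1.
Qed.

End Zeta.

(** * From all vectors to primitive ones, for weights homogeneous of degree -e *)

Section MoebiusInversion.
Variables (R : realType) (T : finType).
Implicit Types (a b : {ffun T -> int}).

Definition vcontent a : nat := \big[gcdn/0%N]_(i : T) `|a i|%N.
Definition zscale (k : nat) a : {ffun T -> int} := [ffun i => k%:Z * a i].

Lemma dvd_contentP k a : reflect (forall i, (k %| `|a i|)%N) (k %| vcontent a)%N.
Proof.
apply: (iffP idP) => [H i|H]; last first.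
  by apply: (big_ind (fun x => (k %| x)%N)) => // x y kx ky; rewrite dvdn_gcd kx.
apply: dvdn_trans H _; rewrite /vcontent (bigD1 i) //=; exact: dvdn_gcdl.
Qed.

Lemma content_gt0 a : a != 0 -> (0 < vcontent a)%N.
Proof.
apply: contraR; rewrite -eqn0Ngt => /eqP c0; apply/eqP/ffunP => i; rewrite ffunE.
have : (0 %| vcontent a)%N by rewrite c0.
by move/dvd_contentP => /(_ i); rewrite dvd0n absz_eq0 => /eqP.
Qed.

Lemma primitive_neq0 a : primitive T a -> a != 0.
Proof.
apply: contraL => /eqP ->; rewrite /primitive big1 // => i _.
by rewrite ffunE.
Qed.

Lemma znorm_eq0 a : (znorm R T a == 0) = (a == 0).
Proof.
apply/eqP/eqP => [H|->].
  apply/ffunP => i; rewrite ffunE.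
  have := normz_le_znorm R a i; rewrite H lern0 absz_eq0; exact/eqP.
by rewrite /znorm big1 ?sqrtr0 // => i _; rewrite ffunE expr0n.
Qed.

Lemma znorm_gt0 a : a != 0 -> 0 < znorm R T a.
Proof. by move=> a0; rewrite lt_neqAle eq_sym znorm_eq0 a0 znorm_ge0. Qed.

Lemma znorm_ge1 a : a != 0 -> 1 <= znorm R T a.
Proof.
move=> a0; have [i ai] : exists i, a i != 0.
  apply/existsP; apply: contraR a0; rewrite negb_exists => /forallP H.
  by apply/eqP/ffunP => i; rewrite ffunE; apply/eqP; have := H i; rewrite negbK.
by apply: le_trans (normz_le_znorm R a i); rewrite ler1n absz_gt0.
Qed.

Lemma content_le a : a != 0 -> (vcontent a)%:R <= znorm R T a.
Proof.
move=> a0; have [i ai] : exists i, a i != 0.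
  apply/existsP; apply: contraR a0; rewrite negb_exists => /forallP H.
  by apply/eqP/ffunP => i; rewrite ffunE; apply/eqP; have := H i; rewrite negbK.
apply: le_trans (normz_le_znorm R a i); rewrite ler_nat dvdn_leq ?absz_gt0 //.
by move: (dvdnn (vcontent a)) => /dvd_contentP.
Qed.

Lemma znorm_scale k a : znorm R T (zscale k a) = k%:R * znorm R T a.
Proof.
rewrite /znorm -[k%:R]ger0_norm // -sqrtr_sqr -sqrtrM ?sqr_ge0 //; congr Num.sqrt.
by rewrite mulr_sumr; apply: eq_bigr => i _; rewrite ffunE intrM exprMn.
Qed.

Lemma zscale_eq0 k a : (0 < k)%N -> (zscale k a == 0) = (a == 0).
Proof.
move=> k0; apply/eqP/eqP => [/ffunP H|->]; apply/ffunP => i; rewrite ?ffunE ?mulr0 //.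
have := H i; rewrite !ffunE => /eqP; rewrite mulf_eq0 => /orP [|/eqP //].
by rewrite eqz_nat; case: k k0 {H}.
Qed.

Lemma zscale_inj k : (0 < k)%N -> injective (zscale k).
Proof.
move=> k0 a b /ffunP H; apply/ffunP => i; have := H i; rewrite !ffunE.
by apply: mulfI; rewrite eqz_nat -lt0n.
Qed.

Variable g : {ffun T -> int} -> R.
Variable e : nat.
Hypothesis g_hom : forall k a, (0 < k)%N -> g (zscale k a) = k%:R ^- e * g a.

Definition zsumS (Y : R) : R := \sum_(a <- zball T Y | a != 0) g a.
Lemma zsumS_small Y : Y < 1 -> zsumS Y = 0.
Proof.
move=> Y1; apply: big1_seq => z; rewrite mem_zball => /andP [z0 zY].
by have := znorm_ge1 z0; lra.
Qed.

Definition zsumP (Y : R) : R := \sum_(a <- zball T Y | primitive T a) g a.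

Lemma sum_div_content k Y : (0 < k)%N ->
  \sum_(a <- zball T Y | (a != 0) && (k %| vcontent a)%N) g a = k%:R ^- e * zsumS (Y / k%:R).
Proof.
move=> k0; rewrite /zsumS mulr_sumr -big_filter -[RHS]big_filter.
have k0R : 0 < (k%:R : R) by rewrite ltr0n.
rewrite (perm_big (map (zscale k) [seq b <- zball T (Y / k%:R) | b != 0])) /=; last first.
  apply: uniq_perm.
  - exact/filter_uniq/uniq_zball.
  - rewrite map_inj_uniq; last exact: zscale_inj.
    exact/filter_uniq/uniq_zball.
  move=> a; rewrite mem_filter mem_zball; apply/idP/mapP.
    move=> /andP [/andP [a0 /dvd_contentP ka] aY].
    have E : a = zscale k [ffun i => (a i %/ k%:Z)%Z].
      apply/ffunP => i; rewrite !ffunE mulrC divzK //.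
      by have := ka i; rewrite dvdzE.
    exists [ffun i => (a i %/ k%:Z)%Z] => //.
    rewrite mem_filter mem_zball -(zscale_eq0 _ k0) -E a0 /=.
    by rewrite ler_pdivlMr // mulrC -znorm_scale -E.
  move=> [b]; rewrite mem_filter mem_zball => /andP [b0 bY] ->.
  rewrite zscale_eq0 // b0 znorm_scale mulrC -ler_pdivlMr // bY andbT /=.
  by apply/dvd_contentP => i; rewrite ffunE abszM dvdn_mulr.
by rewrite big_map; apply: eq_bigr => b _; apply: g_hom.
Qed.

Lemma zsumP_mob Y K : Y <= K%:R ->
  zsumP Y = \sum_(k < K.+1 | (0 < k)%N) (mob k)%:~R * (k%:R ^- e * zsumS (Y / k%:R)).
Proof.
move=> YK.
transitivity (\sum_(a <- zball T Y | a != 0) \sum_(k < K.+1 | (k %| vcontent a)%N) (mob k)%:~R * g a).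
  rewrite /zsumP big_mkcond [RHS]big_mkcond [LHS]big_seq [RHS]big_seq.
  apply: eq_bigr => a; rewrite mem_zball => aY.
  case: (boolP (a == 0)) => a0 /=.
    by case: ifP => // /primitive_neq0; rewrite a0.
  have cK : (vcontent a <= K)%N.
    by rewrite -(ler_nat R); apply: le_trans (content_le a0) (le_trans aY YK).
  rewrite -mulr_suml -rmorph_sum /= (sum_mob (content_gt0 a0) cK) /primitive -/(vcontent a).
  by case: (_ == _); rewrite ?mul1r ?mul0r.
rewrite (exchange_big_dep (fun k : 'I_K.+1 => (0 < k)%N)) /=; last first.
  by move=> a k a0; apply: dvdn_gt0; apply: content_gt0.
by apply: eq_bigr => k k0; rewrite -sum_div_content // mulr_sumr.
Qed.

(** The hypothesis covers all k, including those with Y / k < 1 where the sum is empty, so the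
    inversion can be truncated at any large K; letting K grow replaces [mobsum] by 1 / zeta at no
    cost. The 2 bounds the sum of k^-2. *)
Lemma zsumP_asymp (s : nat) (Y M E : R) : (3 <= s)%N ->
  (forall k, (0 < k)%N -> `|k%:R ^- e * zsumS (Y / k%:R) - M / k%:R ^+ s| <= E / k%:R ^+ 2) ->
  `|zsumP Y - M / zeta R s| <= 2 * E.
Proof.
move=> s3 H.
have s2 : (2 <= s)%N by lia.
have E0 : 0 <= E by have := le_trans (normr_ge0 _) (H 1%N isT); rewrite expr1n divr1.
have z1 := zeta_ge1 R s2; have z0 : 0 < zeta R s by lra.
apply/ler_addgt0Pr => eps eps0.
(* K >= Y is required by [zsumP_mob], and K >= 4 |M| / eps makes the passage from [mobsum] to 1 /
   zeta cost at most eps. *)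
pose K := (Num.trunc (`|Y| + 4 * `|M| / eps)).+1.
have K1 : `|Y| + 4 * `|M| / eps < K%:R.
  have h : 0 <= `|Y| + 4 * `|M| / eps.
    by rewrite addr_ge0 // divr_ge0 ?mulr_ge0 // ltW.
  by have /andP [] := truncn_itv h.
have h4 : 0 <= 4 * `|M| / eps by rewrite divr_ge0 ?mulr_ge0 // ltW.
have YK : Y <= K%:R.
  by apply: le_trans (ler_norm Y) _; apply: ltW; apply: le_lt_trans K1; rewrite lerDl.
have K0 : 0 < (K%:R : R) by rewrite ltr0n.
have MK : 4 * `|M| / K%:R <= eps.
  rewrite ler_pdivrMr // [eps * _]mulrC -ler_pdivrMr //; apply: ltW.
  by apply: le_lt_trans K1; rewrite lerDr.
have A : `|zsumP Y - M * mobsum R s K| <= 2 * E.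
  rewrite (zsumP_mob YK) /mobsum mulr_sumr -sumrB.
  apply: le_trans (ler_norm_sum _ _ _) _.
  apply: (@le_trans _ _ (\sum_(k < K.+1 | (0 < k)%N) E * (k%:R : R) ^- 2)).
    apply: ler_sum => k k0; rewrite [M * _]mulrCA -mulrBr normrM -[X in _ <= X]mul1r.
    apply: ler_pM => //; first exact: mobR_norm.
    exact: H.
  rewrite -mulr_sumr (big_ord_pos _ (fun k => (k%:R : R) ^- 2)) mulrC ler_wpM2r //.
  by have := @zsum_tail R 2 0 K isT; rewrite zsum0 subr0 divr1.
have B : `|M * mobsum R s K - M / zeta R s| <= 4 * `|M| / K%:R.
  have -> : M * mobsum R s K - M / zeta R s = M / zeta R s * (zeta R s * mobsum R s K - 1).
    by field; rewrite gt_eqF.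
  rewrite normrM mulrC [4 * _]mulrC -mulrA [X in _ <= X]mulrC.
  apply: ler_pM => //; first exact: mobsum_zeta.
  rewrite normrM normfV (gtr0_norm z0) ler_pdivrMr // ler_peMr //.
rewrite -(subrKA (M * mobsum R s K)).
apply: le_trans (ler_normD _ _) _; apply: lerD => //.
exact: le_trans MK.
Qed.

End MoebiusInversion.

(** * Elementary estimates of powers and harmonic sums *)

Section PowerEstimates.
Variable R : realType.

Lemma exprB_le k (a b : R) : 0 <= a -> a <= b -> b ^+ k.+1 - a ^+ k.+1 <= k.+1%:R * (b - a) * b ^+ k.
Proof.
move=> a0 ab; have b0 : 0 <= b by apply: le_trans ab.
elim: k => [|k IH]; first by rewrite !expr1 mul1r expr0 mulr1.
have := ler_wpM2l b0 IH.
have h : a ^+ k.+1 <= b ^+ k.+1 by rewrite ler_pXn2r.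
have := ler_wpM2r (_ : 0 <= b - a) h; rewrite subr_ge0 => /(_ ab).
have -> : (k.+2%:R : R) = k.+1%:R + 1 by rewrite natr1.
rewrite !exprS.
move: (b ^+ k) (a ^+ k) (k.+1%:R : R) => u v w; nra.
Qed.

(** Converts counts between balls of radii U - D and U + D into an error relative to U. The lower
    bound is asked for D < U only: otherwise x >= 0 is enough, because then U^(k+1) <= D U^k. *)
Lemma sandwich k (W U D c x : R) : 0 <= W -> 0 < U -> 0 <= D -> D <= c * U -> 0 <= x ->
  x <= W * (U + D) ^+ k.+1 -> (D < U -> W * (U - D) ^+ k.+1 <= x) ->
  `|x - W * U ^+ k.+1| <= W * (k.+1%:R * (1 + c) ^+ k) * (D * U ^+ k).
Proof.
move=> W0 U0 D0 Dc x0 xu xl.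
have c0 : 0 <= c by rewrite -(pmulr_lge0 _ U0); apply: le_trans Dc.
have P1 : 1 <= (1 + c) ^+ k by apply: exprn_ege1; rewrite lerDl.
have K1 : 1 <= k.+1%:R * (1 + c) ^+ k.
  by apply: (le_trans P1); rewrite ler_peMl ?ler1n //; apply: le_trans P1.
have Uk : 0 <= U ^+ k by rewrite exprn_ge0 // ltW.
have DU : 0 <= D * U ^+ k by rewrite mulr_ge0.
have E : W * (k.+1%:R * (1 + c) ^+ k) * (D * U ^+ k) = W * (k.+1%:R * D * ((1 + c) ^+ k * U ^+ k)) by ring.
rewrite E ler_norml; apply/andP; split; last first.
  apply: le_trans (lerB xu (lexx _)) _; rewrite -mulrBr ler_wpM2l //.
  have UD : U <= U + D by rewrite lerDl.
  apply: le_trans (exprB_le k (ltW U0) UD) _.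
  rewrite [U + D]addrC addrK; apply: ler_wpM2l; first by rewrite mulr_ge0.
  by rewrite -exprMn; apply: lerXn2r; rewrite ?nnegrE; nra.
rewrite -lerN2 opprK opprB.
case: (ltP D U) => DUl.
  apply: le_trans (lerB (lexx _) (xl DUl)) _; rewrite -mulrBr ler_wpM2l //.
  have UD : U - D <= U by rewrite gerBl.
  have U0' : 0 <= U - D by rewrite subr_ge0 ltW.
  apply: le_trans (exprB_le k U0' UD) _.
  rewrite subKr; apply: ler_wpM2l; first by rewrite mulr_ge0.
  by rewrite ler_peMl.
apply: le_trans (lerB (lexx _) x0) _; rewrite subr0 ler_wpM2l //.
have -> : k.+1%:R * D * ((1 + c) ^+ k * U ^+ k) = k.+1%:R * (1 + c) ^+ k * (D * U ^+ k) by ring.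
rewrite exprS; apply: (@le_trans _ _ (D * U ^+ k)); first by rewrite ler_wpM2r.
by rewrite ler_peMl.
Qed.

Lemma harmonic_le K : \sum_(0 <= r < K.+1) (r.+1%:R : R)^-1 <= 1 + ln K.+1%:R.
Proof.
elim: K => [|K IH]; first by rewrite big_nat1 ln1 addr0 invr1.
rewrite big_nat_recr //=; apply: le_trans (lerD IH (lexx _)) _.
rewrite -addrA lerD2l.
have x0 : 0 < (K.+2%:R : R) by [].
have h : -1 < - (K.+2%:R : R)^-1 by rewrite ltrN2 invf_lt1 // ltr1n.
have := le_ln1Dx h.
have -> : 1 - (K.+2%:R : R)^-1 = K.+1%:R / K.+2%:R.
  have -> : (K.+2%:R : R) = K.+1%:R + 1 by rewrite natr1.
  have : 0 < (K.+1%:R : R) by []. 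
  by move: (K.+1%:R : R) => y y0; field; rewrite gt_eqF //; lra.
rewrite ln_div ?posrE //; move: (ln _) (ln _) (_^-1) => a b c; lra.
Qed.

End PowerEstimates.

(** * Sums of weights depending on the sup norm *)

Section SumsOverBoxes.
Variables (R : realType) (T : finType).

Definition rhoz (z : {ffun T -> int}) : nat := \max_i `|z i|%N.

Lemma rhoz_ge (z : {ffun T -> int}) i : (`|z i| <= rhoz z)%N.
Proof. exact: (@leq_bigmax_cond T xpredT (fun i => `|z i|%N) i). Qed.

Lemma rhoz_le z K : (rhoz z <= K)%N = (z \in intbox T K).
Proof.
rewrite mem_intbox; apply/bigmax_leqP/forallP => H i; first exact: H.
by move=> _; exact: H.
Qed.

Lemma rhoz_eq0 z : (rhoz z == 0%N) = (z == 0).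
Proof.
apply/eqP/eqP => [H|->].
  apply/ffunP => i; rewrite ffunE; apply/eqP; rewrite -absz_eq0 -leqn0 -H.
  exact: rhoz_ge.
by apply/eqP; rewrite -leqn0; apply/bigmax_leqP => i _; rewrite ffunE.
Qed.

(** A sup-norm shell is a difference of two cubes and is counted exactly; this is why the error
    terms are expressed through [rhoz]. *)
Lemma sum_rhoz (h : nat -> R) K :
  \sum_(z <- intbox T K | z != 0) h (rhoz z) =
  \sum_(0 <= r < K) h r.+1 * (((2 * r.+1).+1 ^ #|T|)%:R - ((2 * r).+1 ^ #|T|)%:R).
Proof.
have perm K' : perm_eq [seq z <- intbox T K'.+1 | (rhoz z <= K')%N] (intbox T K').
  apply: uniq_perm; [by apply/filter_uniq/uniq_intbox|exact: uniq_intbox|].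
  move=> z; rewrite mem_filter rhoz_le andbC; case: (boolP (z \in intbox T K')) => // H.
    by rewrite andbT -rhoz_le ltnW // ltnS rhoz_le.
  by rewrite andbF.
elim: K => [|K IH].
  rewrite big_geq // big1_seq // => z; rewrite -rhoz_le leqn0 rhoz_eq0 => /andP [/negP //].
rewrite big_nat_recr //= -IH (bigID (fun z => (rhoz z <= K)%N)) /=.
congr (_ + _).
  rewrite -(perm_big _ (perm K)) big_filter_cond.
  by apply: eq_bigl => z; rewrite andbC.
rewrite big_seq_cond (eq_bigr (fun=> h K.+1)); last first.
  move=> z /andP [zb /andP [_ H]]; congr h; apply/eqP.
  by rewrite eqn_leq rhoz_le zb ltnNge.
rewrite -big_seq_cond (eq_bigl (fun z => ~~ (rhoz z <= K)%N)); last first.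
  by move=> z; case: (boolP (z == 0)) => //= /eqP ->; rewrite (_ : rhoz 0 = 0%N) //; apply/eqP; rewrite rhoz_eq0.
rewrite big_const_seq iter_addr_0 -[X in X = _]mulr_natr; congr (_ * _).
have := count_predC (fun z => (rhoz z <= K)%N) (intbox T K.+1).
rewrite -size_filter (perm_size (perm K)) !size_intbox => E.
by rewrite -E natrD [X in X - _]addrC addrK.
Qed.

Lemma shell_le r : (0 < #|T|)%N ->
  ((2 * r.+1).+1 ^ #|T|)%:R - ((2 * r).+1 ^ #|T|)%:R <= (2 * #|T|%:R * 3 ^+ #|T|.-1) * r.+1%:R ^+ #|T|.-1 :> R.
Proof.
case: #|T| => // k _ /=; rewrite !natrX.
have h : ((2 * r).+1%:R : R) <= (2 * r.+1).+1%:R by rewrite ler_nat; lia.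
apply: le_trans (exprB_le k (ler0n _ _) h) _.
have -> : ((2 * r.+1).+1%:R : R) - (2 * r).+1%:R = 2 by rewrite -natrB; [congr (_%:R); lia|lia].
rewrite [k.+1%:R * 2]mulrC -[X in _ <= X]mulrA ler_wpM2l ?mulr_ge0 //.
rewrite -exprMn; apply: lerXn2r; rewrite ?nnegrE ?mulr_ge0 //.
by rewrite -natrM ler_nat; lia.
Qed.

Lemma sum_rhoz_le (h : nat -> R) K : (0 < #|T|)%N -> (forall r, 0 <= h r) ->
  \sum_(z <- intbox T K | z != 0) h (rhoz z) <=
  (2 * #|T|%:R * 3 ^+ #|T|.-1) * \sum_(0 <= r < K) h r.+1 * r.+1%:R ^+ #|T|.-1.
Proof.
move=> T0 h0; rewrite sum_rhoz mulr_sumr; apply: ler_sum => r _.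
by rewrite mulrCA ler_wpM2l // shell_le.
Qed.

End SumsOverBoxes.

(** * The Veronese norm *)

Section Monomials.
Variables d n : nat.

(** A monomial is given by the list of its d variables with repetition, so values and exponents of
    explicit monomials are read off lists. *)
Definition mon_ffun (l : seq 'I_n.+1) : {ffun 'I_n.+1 -> 'I_d.+1} :=
  [ffun i => inord (count_mem i l)].

Lemma mon_ffunE l i : size l = d -> (mon_ffun l i : nat) = count_mem i l.
Proof. by move=> sl; rewrite ffunE inordK // ltnS -sl count_size. Qed.

Lemma sum_count_mem (T : finType) (l : seq T) : (\sum_i count_mem i l = size l)%N.
Proof.
elim: l => [|x l IH] /=; first by rewrite big1.
rewrite big_split /= IH (bigD1 x) //= eqxx big1 ?addn0 // => i.
by rewrite eq_sym => /negbTE ->.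
Qed.

Lemma mon_subproof l : size l = d -> (\sum_(i < n.+1) (mon_ffun l i : nat) == d)%N.
Proof.
move=> sl; rewrite -[X in _ == X]sl -sum_count_mem; apply/eqP; apply: eq_bigr => i _.
exact: mon_ffunE.
Qed.

Definition mon l (sl : size l = d) : monom d n := exist _ (mon_ffun l) (mon_subproof sl).

Definition mval (A : comNzRingType) (x : 'I_n.+1 -> A) (e : monom d n) : A :=
  \prod_(i < n.+1) x i ^+ (val e i : nat).

Lemma mval_mon (A : comNzRingType) (x : 'I_n.+1 -> A) l (sl : size l = d) :
  mval x (mon sl) = \prod_(j <- l) x j.
Proof.
rewrite /mval /=; under eq_bigr => i _ do rewrite mon_ffunE //.
elim: l {sl} => [|j l IH] /=.
  by rewrite big_nil big1 // => i _; rewrite expr0.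
rewrite big_cons -IH [RHS]mulrC.
under eq_bigr => i _ do rewrite exprD mulrC.
rewrite big_split /=; congr (_ * _).
rewrite (bigD1 j) //= eqxx expr1 big1 ?mulr1 // => i.
by rewrite eq_sym => /negbTE ->; rewrite expr0.
Qed.

Lemma mval_morph (A B : comNzRingType) (f : {rmorphism A -> B}) (x : 'I_n.+1 -> A) e :
  f (mval x e) = mval (fun i => f (x i)) e.
Proof. by rewrite /mval rmorph_prod; apply: eq_bigr => i _; rewrite rmorphXn. Qed.

Lemma sum_expo (e : monom d n) : (\sum_(i < n.+1) (val e i : nat) = d)%N.
Proof. by case: e => /= f /eqP. Qed.

Definition purepow (i : 'I_n.+1) : monom d n := mon (size_nseq d i).

Lemma mval_purepow (A : comNzRingType) (x : 'I_n.+1 -> A) i : mval x (purepow i) = x i ^+ d.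
Proof.
rewrite mval_mon; elim: d => [|k IH] /=; first by rewrite big_nil expr0.
by rewrite big_cons IH exprS.
Qed.

Variable R : realType.
Implicit Types y w : 'I_n.+1 -> R.

Definition vn y : R := Num.sqrt (\sum_(e : monom d n) mval y e ^+ 2).

Lemma vn_sq y : vn y ^+ 2 = \sum_(e : monom d n) mval y e ^+ 2.
Proof. by rewrite sqr_sqrtr // sumr_ge0 // => e _; apply: sqr_ge0. Qed.

Lemma vn_ge0 y : 0 <= vn y. Proof. exact: sqrtr_ge0. Qed.

Lemma mval_le_vn y e : `|mval y e| <= vn y.
Proof.
rewrite -sqrtr_sqr /vn ler_wsqrtr // (bigD1 e) //= lerDl sumr_ge0 // => e' _.
exact: sqr_ge0.
Qed.

Lemma vn_ge y i : `|y i| ^+ d <= vn y.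
Proof. by rewrite -normrX -mval_purepow; apply: mval_le_vn. Qed.

(** The size bounds accompany the difference bound because the difference of two products involves
    both. The latter is |difference| <= d K^(d-1), multiplied by K so that degrees simply add in the
    induction. *)
Lemma mval_bounds y w (K : R) e : 1 <= K -> (forall i, `|y i| <= K) -> (forall i, `|w i| <= K) ->
  (forall i, `|w i - y i| <= 1) ->
  [/\ `|mval y e| <= K ^+ d, `|mval w e| <= K ^+ d & `|mval w e - mval y e| * K <= d%:R * K ^+ d].
Proof.
move=> K1 yK wK wy; have K0 : 0 <= K by lra.
pose P (a b : R) (m : nat) := [/\ `|a| <= K ^+ m, `|b| <= K ^+ m & `|b - a| * K <= m%:R * K ^+ m].
have P0 : P 1 1 0%N by split; rewrite ?normr1 ?expr0 // subrr normr0 !mul0r.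
have PM a1 b1 m1 a2 b2 m2 : P a1 b1 m1 -> P a2 b2 m2 -> P (a1 * a2) (b1 * b2) (m1 + m2)%N.
  move=> [A1 B1 D1] [A2 B2 D2]; rewrite /P exprD natrD; split.
  - by rewrite normrM ler_pM.
  - by rewrite normrM ler_pM.
  have -> : b1 * b2 - a1 * a2 = (b1 - a1) * b2 + a1 * (b2 - a2) by ring.
  apply: le_trans (ler_wpM2r K0 (ler_normD _ _)) _.
  rewrite mulrDl !normrM.
  have -> : (m1%:R + m2%:R) * (K ^+ m1 * K ^+ m2) = m1%:R * K ^+ m1 * K ^+ m2 + K ^+ m1 * (m2%:R * K ^+ m2) by ring.
  apply: lerD.
    by rewrite mulrAC ler_pM // mulr_ge0.
  by rewrite -mulrA ler_pM // mulr_ge0.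
have PX a b m : P a b 1%N -> P (a ^+ m) (b ^+ m) m.
  move=> H; elim: m => [|m IH]; first by rewrite !expr0.
  by rewrite !exprS -add1n; apply: PM.
suff : P (mval y e) (mval w e) (\sum_(i < n.+1) (val e i : nat))%N by rewrite sum_expo.
rewrite /mval; apply: (big_ind3 (fun a b m => P a b m)) => //.
move=> i _; apply: PX; split; rewrite ?expr1 //.
by rewrite ler_pM // mul1r.
Qed.

Lemma vn_le y (K : R) : 1 <= K -> (forall i, `|y i| <= K) -> vn y <= #|{: monom d n}|%:R * K ^+ d.
Proof.
move=> K1 yK; have K0 : 0 <= K by lra.
rewrite -[vn y]ger0_norm ?vn_ge0 // -[X in _ <= X]ger0_norm ?mulr_ge0 ?exprn_ge0 //.
rewrite -ler_sqr ?nnegrE ?normr_ge0 // !real_normK ?num_real // vn_sq.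
apply: (@le_trans _ _ (\sum_(e : monom d n) (K ^+ d) ^+ 2)).
  apply: ler_sum => e _; rewrite -[X in X <= _]real_normK ?num_real //.
  rewrite ler_pXn2r ?nnegrE ?exprn_ge0 //.
  have [] // := @mval_bounds y y K e K1 yK yK.
  by move=> i; rewrite subrr normr0.
rewrite sumr_const -[X in X <= _]mulr_natl exprMn ler_wpM2r ?exprn_ge0 //.
rewrite -natrX ler_nat; case: #|_| => // k; nia.
Qed.

Definition vdiffC : R := #|{: monom d n}|%:R * d%:R * 8 ^+ d.

(** 1 / [vn] is homogeneous of degree -d, so a unit step changes it by O(r^(-d-1)). The difference
    of squares in the numerator is polynomial. All coordinates are at most K = 2 r, which gives 4^d,
    and |w_i| >= r / 2 gives 2^d: hence the 8^d in [vdiffC]. *)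
Lemma vn_inv_diff y w (i : 'I_n.+1) : 2 <= `|y i| -> (forall j, `|y j| <= `|y i|) ->
  (forall j, `|w j - y j| <= 1) -> `|(vn w)^-1 - (vn y)^-1| <= vdiffC / `|y i| ^+ d.+1.
Proof.
move=> y2 yK wy; set r := `|y i| in y2 yK *.
have r0 : 0 < r by lra.
pose K := 2 * r; have K1 : 1 <= K by rewrite /K; lra.
have wK j : `|w j| <= K.
  have := ler_normD (w j - y j) (y j); rewrite subrK; have := wy j; have := yK j; rewrite /K; lra.
have yK' j : `|y j| <= K by have := yK j; rewrite /K; lra.
have wr : r / 2 <= `|w i|.
  have := ler_normD (w i) (y i - w i); rewrite addrC subrK -/r distrC; have := wy i; lra.
have vy : r ^+ d <= vn y by apply: vn_ge.
have vw : (r / 2) ^+ d <= vn w.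
  by apply: le_trans (vn_ge w i); apply: lerXn2r; rewrite ?nnegrE //; lra.
have rd0 : 0 < r ^+ d by rewrite exprn_gt0.
have rd20 : 0 < (r / 2) ^+ d by rewrite exprn_gt0 // divr_gt0.
have vy0 : 0 < vn y by lra.
have vw0 : 0 < vn w by lra.
have S : `|vn y ^+ 2 - vn w ^+ 2| * K <= #|{: monom d n}|%:R * (2 * d%:R * (K ^+ d * K ^+ d)).
  rewrite !vn_sq -sumrB.
  apply: le_trans (ler_wpM2r _ (ler_norm_sum _ _ _)) _; first by lra.
  rewrite mulr_suml -sum1_card natr_sum mulr_suml; apply: ler_sum => e _; rewrite mul1r.
  have [A B D] := mval_bounds e K1 yK' wK wy.
  have -> : mval y e ^+ 2 - mval w e ^+ 2 = (mval y e + mval w e) * (mval y e - mval w e) by ring.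
  rewrite normrM -mulrA [X in _ * (X * _)]distrC.
  have -> : 2 * d%:R * (K ^+ d * K ^+ d) = (2 * K ^+ d) * (d%:R * K ^+ d) by ring.
  apply: ler_pM => //; first by rewrite mulr_ge0 //; lra.
  by apply: le_trans (ler_normD _ _) _; lra.
have E : (vn w)^-1 - (vn y)^-1 = (vn y ^+ 2 - vn w ^+ 2) / (vn y * vn w * (vn y + vn w)).
  by field; rewrite !gt_eqF //; lra.
have den : r ^+ d * (r / 2) ^+ d * r ^+ d <= vn y * vn w * (vn y + vn w).
  have h1 := ltW rd0; have h2 := ltW rd20.
  by apply: ler_pM; [rewrite mulr_ge0 | | apply: ler_pM | lra].
have den0 : 0 < r ^+ d * (r / 2) ^+ d * r ^+ d by rewrite !mulr_gt0.
rewrite E normrM normfV [X in _ / X]gtr0_norm; last by lra.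
rewrite ler_pdivrMr; last by lra.
apply: le_trans (_ : vdiffC / r ^+ d.+1 * (r ^+ d * (r / 2) ^+ d * r ^+ d) <= _); last first.
  by rewrite ler_wpM2l // divr_ge0 ?exprn_ge0 ?mulr_ge0 // ltW.
rewrite -(ler_pM2r (_ : 0 < K)); last by lra.
apply: le_trans S _; rewrite le_eqVlt; apply/orP; left; apply/eqP.
rewrite /vdiffC /K exprSr !exprMn exprVn.
have -> : 8 ^+ d = 2 ^+ d * 2 ^+ d * 2 ^+ d :> R by rewrite -!exprMn; congr (_ ^+ d); ring.
by field; rewrite !gt_eqF ?exprn_gt0.
Qed.

Lemma veronese_normE (s : seq R) : veronese_norm R d n s = vn (rcoord s).
Proof.
rewrite /veronese_norm /vn; congr Num.sqrt; apply: eq_bigr => e _; congr (_ ^+ 2).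
by apply: eq_bigr => i _; rewrite /rcoord enum_rank_ord.
Qed.

End Monomials.

(** * Cellwise comparison of the sum of 1 / [vn] with its integral *)

Section VeroneseSum.
Variables (R : realType) (d n : nat).
Hypotheses (d0 : (0 < d)%N) (dn : (d <= n)%N).
Local Notation m := (n - d)%N.
Local Notation T := 'I_n.+1.
Local Notation D := (n.+2%:R : R).

Definition fz (z : {ffun T -> int}) : R := (vn d (fun i => (z i)%:~R : R))^-1.
(** The [+ 1] makes [wlow] vanish on the shell [rhoz z = 1], which is too close to the origin for
    [vn_inv_diff]. *)
Definition cellC : R := vdiffC d n R + 1.
Definition rhoR (z : {ffun T -> int}) : R := (rhoz z)%:R.
(* Bounds of [1 / vn] on the unit cell of corner [z]: [wlow] for all [z <> 0]
   (it vanishes when [rhoz z = 1]), [whigh] when [2 <= rhoz z]. *)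
Definition wlow z : R := Num.max 0 (fz z - cellC / rhoR z ^+ d.+1).
Definition whigh z : R := fz z + cellC / rhoR z ^+ d.+1.
Definition fball (Y : R) (s : seq R) : \bar R :=
  (if normS R s <= Y then (veronese_norm R d n s)^-1 else 0)%:E.
Definition veroneseI : R := fine (iint R n.+1 (fball 1)).

Lemma vdiffC_ge0 : 0 <= vdiffC d n R. Proof. by rewrite !mulr_ge0 ?exprn_ge0. Qed.
Lemma cellC_ge1 : 1 <= cellC. Proof. by rewrite lerDr vdiffC_ge0. Qed.
Lemma fz_ge0 z : 0 <= fz z. Proof. by rewrite invr_ge0 vn_ge0. Qed.
Lemma fball_ge0 Y s : (0 <= fball Y s)%E.
Proof. by rewrite lee_fin; case: ifP => // _; rewrite veronese_normE invr_ge0 vn_ge0. Qed.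
Lemma err_ge0 z : 0 <= cellC / rhoR z ^+ d.+1.
Proof. by rewrite divr_ge0 ?exprn_ge0 //; apply: le_trans cellC_ge1. Qed.
Lemma whigh_ge0 z : 0 <= whigh z. Proof. by rewrite addr_ge0 ?fz_ge0 ?err_ge0. Qed.

Lemma rhoz_attained (z : {ffun T -> int}) : exists i, `|z i|%N = rhoz z.
Proof.
have [|i _ Hi] := @eq_bigmax_cond T xpredT (fun i => `|z i|%N); first by rewrite card_ord.
by exists i; rewrite /rhoz Hi.
Qed.

Lemma normzR (x : int) : `|x%:~R : R| = `|x|%N%:R.
Proof. by rewrite -intr_norm natr_absz. Qed.

Lemma fz_rho z : z != 0 -> fz z <= (rhoR z ^+ d)^-1.
Proof.
move=> z0; have r0 : 0 < rhoR z by rewrite ltr0n lt0n rhoz_eq0.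
have [i Hi] := rhoz_attained z.
have h := vn_ge d (fun i => (z i)%:~R : R) i; rewrite normzR Hi -/(rhoR z) in h.
have h0 : 0 < rhoR z ^+ d by rewrite exprn_gt0.
by rewrite /fz lef_pV2 ?posrE //; apply: lt_le_trans h.
Qed.

Lemma cell_fz (y : T -> R) : (2 <= rhoz (floorv y))%N ->
  `|(vn d y)^-1 - fz (floorv y)| <= cellC / rhoR (floorv y) ^+ d.+1.
Proof.
move=> r2; have [i Hi] := rhoz_attained (floorv y).
have := @vn_inv_diff d n R (fun i => (floorv y i)%:~R) y i.
rewrite normzR Hi -/(rhoR _) -/(fz _) => H; apply: le_trans (H _ _ _) _.
- by rewrite ler_nat.
- by move=> j; rewrite normzR ler_nat rhoz_ge.
- by move=> j; have /andP [h1 h2] := floorv_dist y j; rewrite ger0_norm // ltW.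
by rewrite ler_wpM2r ?invr_ge0 ?exprn_ge0 // lerDl.
Qed.

Lemma wlow_cell (y : T -> R) : floorv y != 0 -> wlow (floorv y) <= (vn d y)^-1.
Proof.
move=> z0; have y0 : 0 <= (vn d y)^-1 by rewrite invr_ge0 vn_ge0.
rewrite ge_max y0 /=.
have r0 : (0 < rhoz (floorv y))%N by rewrite lt0n rhoz_eq0.
case: (ltnP 1 (rhoz (floorv y))) => r2.
  by have := cell_fz r2; rewrite ler_norml => /andP [h _]; lra.
apply: le_trans y0; have e : rhoR (floorv y) = 1 by rewrite /rhoR (_ : rhoz _ = 1%N) //; lia.
have := fz_rho z0; rewrite e !expr1n divr1 invr1; have := cellC_ge1; lra.
Qed.

Lemma whigh_cell (y : T -> R) : (2 <= rhoz (floorv y))%N -> (vn d y)^-1 <= whigh (floorv y).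
Proof. by move=> r2; have := cell_fz r2; rewrite ler_norml => /andP [_ h]; rewrite /whigh; lra. Qed.

(** A ball is the ellipsoid with c = 0, so [ellq_of_floor] and [floor_of_ellq] serve for balls
    too. *)
Lemma normS_ellq (s : seq R) (U : R) : size s = n.+1 -> 0 <= U ->
  (normS R s <= U) = (ellq (fun _ : T => 0) (rcoord s) <= U ^+ 2).
Proof.
move=> sk U0; rewrite (@normS_le R n.+1) // /ellq [X in _ + X ^+ 2]big1 ?expr0n ?addr0; last first.
  by move=> i _; rewrite mul0r.
congr (_ <= _); rewrite (sum_rcoord (fun i x => x ^+ 2)) /sqn.
by rewrite card_ord.
Qed.

Lemma znorm_ellz (z : {ffun T -> int}) (U : R) : 0 <= U ->
  (znorm R T z <= U) = (ellz (fun _ : T => 0) z <= U ^+ 2).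
Proof.
move=> U0; rewrite /ellz /ellq [X in _ + X ^+ 2]big1 ?expr0n ?addr0; last first.
  by move=> i _; rewrite mul0r.
rewrite -znorm_sq -[RHS]ler_sqr ?nnegrE ?sqr_ge0 //.
by rewrite !ler_pXn2r ?nnegrE ?exprn_ge0 ?znorm_ge0.
Qed.

Let c01 (i : T) : `|(fun _ : T => 0 : R) i| <= 1. Proof. by rewrite normr0. Qed.

(** The cells of the points of [L] are disjoint and stay in the ball of radius Y + D; D = n + 2 is
    the rounding loss [#|T|.+1]. *)
Lemma lower_cells (Y : R) (L : seq {ffun T -> int}) : 0 < Y -> uniq L ->
  {in L, forall z, z != 0 /\ znorm R T z <= Y} ->
  ((\sum_(z <- L) wlow z)%:E <= iint R n.+1 (fball (Y + D)))%E.
Proof.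
move=> Y0 uL LY.
have := @iint_cells R T L wlow (fun=> 0) (fun=> 0) uL.
rewrite eseries0; last by move=> j _ _; rewrite mul0r.
rewrite add0e card_ord => <- //; last by move=> z; rewrite le_max lexx.
apply: iint_le => [s|s sk].
  rewrite eseries0 ?add0e; last by move=> j _ _; rewrite mul0r.
  by rewrite lee_fin; case: ifP => // _; rewrite le_max lexx.
rewrite eseries0 ?add0e; last by move=> j _ _; rewrite mul0r.
case: ifP => zL; last exact: fball_ge0.
have [z0 zY] := LY _ zL.
rewrite /fball veronese_normE (normS_ellq sk); last by apply: addr_ge0 => //; apply: ltW.
have -> : ellq (fun _ : T => 0) (rcoord s) <= (Y + D) ^+ 2.
  have := ellq_of_floor c01 Y0 (_ : ellz (fun=> 0) (floorv (rcoord s)) <= Y ^+ 2).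
  by rewrite card_ord; apply; rewrite -znorm_ellz // ltW.
by rewrite lee_fin wlow_cell.
Qed.

(* Dyadic majorant of the singularity at 0; [vn] vanishes only at the origin,
   where the inverse is 0 by convention. *)
Lemma near_origin (y : T -> R) : (forall i, `|y i| <= 2) ->
  (((vn d y)^-1)%:E <= \sum_(j <oo) ((2 ^+ j) ^+ d * (inbox (2 / 2 ^+ j) y)%:R)%:E)%E.
Proof.
move=> y2.
have t0 j : (0 <= ((2 ^+ j) ^+ d * (inbox (2 / 2 ^+ j) y)%:R : R)%:E)%E.
  by rewrite lee_fin mulr_ge0 ?exprn_ge0.
pose i := [arg max_(i > (ord0 : T)) `|y i|]%O.
have iM j : `|y j| <= `|y i|.
  by rewrite /i; case: (@Order.TotalTheory.arg_maxP _ _ _ ord0 xpredT (fun i => `|y i|)) => // k _ H; apply: H.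
have [yi0|yi0] := eqVneq (y i) 0.
  suff -> : vn d y = 0 by rewrite invr0; apply: nneseries_ge0.
  apply/eqP; rewrite -sqrf_eq0 vn_sq; apply/eqP; apply: big1 => e _.
  apply/eqP; rewrite sqrf_eq0 /mval.
  have [j ej] : exists j, val e j != 0 :> nat.
    apply/existsP; rewrite -[[exists _, _]]negbK negb_exists; apply/negP => /forallP H.
    have := sum_expo e; rewrite big1; first by lia.
    by move=> j _; have := H j; rewrite negbK => /eqP.
  rewrite (bigD1 j) //= (_ : y j = 0); first by rewrite expr0n (negbTE ej) mul0r.
  by apply/eqP; rewrite -normr_le0; apply: le_trans (iM j) _; rewrite yi0 normr0.
set r := `|y i| in iM; have r0 : 0 < r by rewrite normr_gt0.
have ex : exists j, 2 / 2 ^+ j < r.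
  have h : 0 <= 2 / r by rewrite divr_ge0 // ltW.
  exists (Num.trunc (2 / r)).+1; rewrite ltr_pdivrMr ?exprn_gt0 // mulrC -ltr_pdivrMr //.
  have /andP [_ h1] := truncn_itv h; apply: lt_le_trans h1 _.
  by rewrite -natrX ler_nat ltnW // ltn_expl.
(* As r <= 2, the least such index is positive. Its predecessor j satisfies 2^-j < r <= 2 / 2^j, so
   the j-th term alone dominates: its cube contains y, and (2^j)^d >= r^-d. *)
case: (ex_minnP ex) => [[|j]]; first by rewrite expr0 divr1 ltNge y2.
move=> jr jmin.
have rj : r <= 2 / 2 ^+ j by rewrite leNgt; apply/negP => /jmin; rewrite ltnn.
have rj' : (2 ^+ j)^-1 < r.
  by apply: le_lt_trans jr; rewrite exprS invfM mulrA divff // mul1r.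
apply: (@le_trans _ _ (((2 ^+ j) ^+ d)%:E)).
  rewrite lee_fin -[X in _ <= X]invrK lef_pV2 ?posrE ?invr_gt0 ?exprn_gt0 //; last first.
    by apply: lt_le_trans (vn_ge d y i); rewrite exprn_gt0.
  apply: le_trans (vn_ge d y i); rewrite -exprVn.
  by apply: lerXn2r; rewrite ?nnegrE ?invr_ge0 ?exprn_ge0 ?normr_ge0 //; apply: ltW.
have := @nneseries_lim_ge R (fun j => ((2 ^+ j) ^+ d * (inbox (2 / 2 ^+ j) y)%:R)%:E) xpredT 0%N j.+1 (fun j _ _ => t0 j).
apply: le_trans; rewrite big_nat_recr //=.
have -> : inbox (2 / 2 ^+ j) y by apply/forallP => k; apply: le_trans (iM k) rj.
by rewrite mulr1 leeDr //; apply: sume_ge0.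
Qed.

(** Term j equals 4^(n+1) 2^(j (d - n - 1)), at most 4^(n+1) 2^-j since d <= n. This is the
    integrability of 1 / [vn] at the origin. *)
Lemma near_volume :
  (\sum_(j <oo) ((2 ^+ j) ^+ d * (2 * (2 / 2 ^+ j)) ^+ n.+1 : R)%:E <= (4 ^+ n.+1 * 2)%:E)%E.
Proof.
have geo N : \sum_(0 <= j < N) (2 ^+ j : R)^-1 <= 2 - (2 ^+ N)^-1 * 2.
  elim: N => [|N IH]; first by rewrite big_geq // expr0 invr1; lra.
  rewrite big_nat_recr //= exprS invfM; have : 0 < (2 ^+ N : R)^-1 by rewrite invr_gt0 exprn_gt0.
  by move: IH; move: (\sum_(_ <= _ < _) _) (_^-1) => a b; lra.
apply: lime_le.
  by apply: is_cvg_nneseries => j _ _; rewrite lee_fin mulr_ge0 ?exprn_ge0 // mulr_ge0 // divr_ge0 ?exprn_ge0.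
apply: nearW => N /=; rewrite sumEFin lee_fin.
apply: (@le_trans _ _ (\sum_(0 <= j < N) 4 ^+ n.+1 * (2 ^+ j : R)^-1)).
  apply: ler_sum => j _.
  have -> : 2 * (2 / 2 ^+ j) = 4 * (2 ^+ j)^-1 :> R by ring.
  rewrite exprMn mulrCA ler_wpM2l ?exprn_ge0 //.
  have p0 : 0 < (2 ^+ j : R) by rewrite exprn_gt0.
  have p1 : 1 <= (2 ^+ j : R) by rewrite exprn_ege1 // ler1n.
  have -> : n.+1 = (d + (n - d).+1)%N by lia.
  rewrite exprD mulrA -exprMn divff ?gt_eqF // expr1n mul1r exprVn lef_pV2 ?posrE ?exprn_gt0 //.
  by rewrite exprS; apply: ler_peMr; [exact: ltW | exact: exprn_ege1].
rewrite -mulr_sumr ler_wpM2l ?exprn_ge0 //; apply: le_trans (geo N) _.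
by rewrite gerBl mulr_ge0 ?invr_ge0 ?exprn_ge0.
Qed.

Definition nearC : R := 4 ^+ n.+1 * 2.

(** Cells with [rhoz z <= 1] lie in the cube |y_i| <= 2, where [near_origin] applies at the bounded
    cost [nearC]; on the others [whigh] is a majorant. Finiteness of the integral in [Cdn] also
    comes from here. *)
Lemma upper_cells (Y : R) : 0 < Y ->
  (iint R n.+1 (fball Y) <= (nearC + \sum_(z <- zball T (Y + D) | z != 0) whigh z)%:E)%E.
Proof.
move=> Y0; pose L := [seq z <- zball T (Y + D) | z != 0].
have uL : uniq L by apply/filter_uniq/uniq_zball.
have := @iint_cells R T L whigh (fun j => (2 ^+ j) ^+ d) (fun j => 2 / 2 ^+ j) uL whigh_ge0.
rewrite card_ord => H.
rewrite EFinD -big_filter -/L.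
have e1 j : 0 <= (2 ^+ j) ^+ d :> R by rewrite !exprn_ge0.
have e2 j : 0 <= 2 / 2 ^+ j :> R by rewrite divr_ge0 ?exprn_ge0.
apply: le_trans (leeD near_volume (lexx _)).
rewrite -H //; apply: iint_le => [s|s sk]; first exact: fball_ge0.
have ser0 : (0 <= \sum_(j <oo) ((2 ^+ j : R) ^+ d * (inbox (2 / 2 ^+ j) (rcoord s : T -> R))%:R)%:E)%E.
  by apply: nneseries_ge0 => j _ _; rewrite lee_fin mulr_ge0.
rewrite /fball veronese_normE; case: ifP => nY; last first.
  by apply: adde_ge0 => //; rewrite lee_fin; case: ifP => // _; apply: whigh_ge0.
set z := floorv _.
have zY : z \in zball T (Y + D).
  rewrite mem_zball znorm_ellz; last by apply: addr_ge0 => //; apply: ltW.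
  have := floor_of_ellq c01 Y0 (_ : ellq (fun=> 0) (rcoord s) <= Y ^+ 2).
  by rewrite card_ord; apply; rewrite -normS_ellq // ltW.
case: (ltnP 1 (rhoz z)) => r2.
  have zL : z \in L by rewrite mem_filter zY andbT -rhoz_eq0; lia.
  by rewrite zL; apply: le_trans (leeDr _ ser0); rewrite lee_fin; apply: whigh_cell.
apply: (@le_trans _ _ (\sum_(j <oo) ((2 ^+ j : R) ^+ d * (inbox (2 / 2 ^+ j) (rcoord s : T -> R))%:R)%:E)%E); last first.
  by rewrite leeDl // lee_fin; case: ifP => // _; apply: whigh_ge0.
apply: near_origin => i.
have /andP [h1 h2] := floorv_dist (rcoord s : T -> R) i.
have : `|(z i)%:~R : R| <= 1 by rewrite normzR lern1; apply: leq_trans (rhoz_ge z i) r2.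
rewrite !ler_norml => /andP [h3 h4]; apply/andP; rewrite -/z in h1 h2; split; lra.
Qed.

End VeroneseSum.

Section VeroneseAsymptotics.
Variables (R : realType) (d n : nat).
Hypotheses (d0 : (0 < d)%N) (dn : (d <= n)%N).
Local Notation m := (n - d)%N.
Local Notation T := 'I_n.+1.
Local Notation D := (n.+2%:R : R).
Local Notation fz := (@fz R d n).
Local Notation veroneseI := (veroneseI R d n).
Local Notation cellC := (cellC R d n).
Local Notation nearC := (nearC R n).
Local Notation wlow := (@wlow R d n).
Local Notation whigh := (@whigh R d n).
Local Notation fball := (@fball R d n).
Local Notation rhoR := (@rhoR R n).

Lemma mval_scale (A : comNzRingType) (a : A) (y : T -> A) (e : monom d n) :
  mval (fun i => a * y i) e = a ^+ d * mval y e.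
Proof.
rewrite /mval; under eq_bigr => i _ do rewrite exprMn.
by rewrite big_split /= prodrXr sum_expo.
Qed.

Lemma vn_scale (a : R) (y : T -> R) : 0 <= a -> vn d (fun i => a * y i) = a ^+ d * vn d y.
Proof.
move=> a0; rewrite /vn -[a ^+ d]ger0_norm ?exprn_ge0 // -sqrtr_sqr -sqrtrM ?sqr_ge0 //.
congr Num.sqrt; rewrite mulr_sumr; apply: eq_bigr => e _.
by rewrite mval_scale exprMn.
Qed.

Lemma iint_fball_scale (Y : R) : 0 < Y -> iint R n.+1 (fball Y) = ((Y ^+ m.+1)%:E * iint R n.+1 (fball 1))%E.
Proof.
move=> Y0; rewrite (@iint_scale R n.+1 (fball Y) Y (@fball_ge0 R d n Y) Y0).
have -> : iint R n.+1 (fun s => fball Y [seq Y * x | x <- s]) = iint R n.+1 (fun s => (Y ^- d)%:E * fball 1 s)%E.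
  apply: iint_eq => s sk; rewrite /fball -EFinM; congr EFin.
  have -> : normS R [seq Y * x | x <- s] = Y * normS R s.
    rewrite /normS big_map -[Y in RHS]ger0_norm ?(ltW Y0) // -sqrtr_sqr -sqrtrM ?sqr_ge0 //.
    by congr Num.sqrt; rewrite mulr_sumr; apply: eq_bigr => x _; rewrite exprMn.
  rewrite -[X in _ <= X]mulr1 ler_pM2l //.
  case: ifP => // _; last by rewrite mulr0.
  rewrite !veronese_normE -invfM -vn_scale ?(ltW Y0) //; congr (vn d _)^-1.
  by apply/funext => i; rewrite /rcoord enum_rank_ord (nth_map 0) //= sk ltn_ord.
rewrite iintZ ?invr_gt0 ?exprn_gt0 //; last by move=> s; apply: fball_ge0.
rewrite muleA -EFinM; congr (_%:E * _)%E.
have -> : n.+1 = (m.+1 + d)%N by lia.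
by rewrite exprD mulfK // expf_neq0 // gt_eqF.
Qed.

Lemma iint_fball1 : iint R n.+1 (fball 1) = veroneseI%:E.
Proof.
rewrite /veroneseI fineK // ge0_fin_numE.
  by apply: le_lt_trans (upper_cells d0 dn ltr01) (ltry _).
by apply: iint_ge0 => s; apply: fball_ge0.
Qed.

Lemma iint_fball (Y : R) : 0 < Y -> iint R n.+1 (fball Y) = (Y ^+ m.+1 * veroneseI)%:E.
Proof. by move=> Y0; rewrite iint_fball_scale // iint_fball1 EFinM. Qed.

(** One far cell suffices: at z = (t, 0, ..., 0) the value [fz z] is at least 1 / (Nm t^d), which
    exceeds [cellC] / t^(d+1) once t > [cellC] Nm. Homogeneity carries positivity back to the unit
    ball. *)
Lemma veroneseI_gt0 : 0 < veroneseI.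
Proof.
pose Nm : R := #|{: monom d n}|%:R.
have Nm0 : 0 < Nm by rewrite ltr0n; apply/card_gt0P; exists (purepow d ord0).
have C1 := cellC_ge1 R d n.
pose t := (Num.trunc (cellC * Nm)).+1.
have tC : cellC * Nm < t%:R.
  have h : 0 <= cellC * Nm by rewrite mulr_ge0 ?(ltW Nm0) //; lra.
  by have /andP [] := truncn_itv h.
have t1 : 1 <= (t%:R : R) by rewrite ler1n.
have t0 : 0 < (t%:R : R) by [].
pose z : {ffun T -> int} := [ffun i => if i == ord0 then t%:Z else 0].
have zle i : (`|z i| <= t)%N by rewrite ffunE; case: eqP.
have z0 : z != 0.
  by apply/eqP => /ffunP /(_ ord0); rewrite !ffunE eqxx.
have rz : rhoz z = t.
  apply/eqP; rewrite eqn_leq; apply/andP; split; first by apply/bigmax_leqP => i _; apply: zle.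
  by apply: leq_trans (rhoz_ge z ord0); rewrite ffunE eqxx.
have zn := znorm_gt0 R z0.
have uL : uniq [:: z] by [].
have := lower_cells d0 dn zn uL _; rewrite big_seq1 iint_fball; last by apply: addr_gt0.
rewrite lee_fin => H.
have Yp : 0 < (znorm R T z + D) ^+ m.+1 by rewrite exprn_gt0 // addr_gt0.
rewrite -(pmulr_rgt0 _ Yp); apply: lt_le_trans (H _); last first.
  by move=> a; rewrite inE => /eqP ->.
rewrite /wlow lt_max; apply/orP; right; rewrite subr_gt0.
have v1 := @vn_le d n R (fun i => (z i)%:~R) t%:R t1 (fun i => _).
have {}v1 : vn d (fun i => (z i)%:~R : R) <= Nm * t%:R ^+ d.
  by apply: v1 => i; rewrite normzR ler_nat.
have v0 : 0 < vn d (fun i => (z i)%:~R : R).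
  by apply: lt_le_trans (vn_ge d _ ord0); rewrite exprn_gt0 // normr_gt0 ffunE eqxx pnatr_eq0.
apply: lt_le_trans (_ : (Nm * t%:R ^+ d)^-1 <= _); last first.
  by rewrite /fz lef_pV2 ?posrE // mulr_gt0 // exprn_gt0.
rewrite /rhoR rz -[X in _ < X]mul1r ltr_pdivlMr ?mulr_gt0 ?exprn_gt0 //.
have td : 0 < (t%:R : R) ^+ d by rewrite exprn_gt0.
rewrite -(ltr_pM2r t0) mul1r.
rewrite (_ : _ * t%:R = cellC * Nm) //.
by rewrite exprSr; field; rewrite !gt_eqF.
Qed.

Definition errC : R := 2 * n.+1%:R * 3 ^+ n * cellC.

(** The shell of radius r contributes O(r^(n-d-1)) = O(r^m / r). Bounding r^m by Y^m leaves a
    harmonic sum: this treats all d <= n alike, though the logarithm is only forced for m = 0. *)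
Lemma sum_err_le (Y : R) : 1 <= Y ->
  \sum_(z <- zball T Y | z != 0) cellC / rhoR z ^+ d.+1 <= errC * (Y ^+ m * (1 + ln Y)).
Proof.
move=> Y1; have Y0 : 0 <= Y by lra.
pose h r : R := cellC / r%:R ^+ d.+1.
have C0 : 0 <= cellC by apply: le_trans (cellC_ge1 _ _ _).
have h0 r : 0 <= h r by rewrite divr_ge0 ?exprn_ge0.
case EK : (Num.trunc Y) => [|K].
  by move: EK => /eqP; rewrite -leqn0 leqNgt truncn_gt0 Y1.
have KY : K.+1%:R <= Y by rewrite -EK truncn_le.
apply: (@le_trans _ _ (\sum_(z <- intbox T K.+1 | z != 0) h (rhoz z))).
  rewrite /zball EK big_filter_cond big_mkcond [X in _ <= X]big_mkcond.
  apply: ler_sum => z _; case: (_ <= Y) => /=; first by case: (_ != 0).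
  by case: (_ != 0).
apply: le_trans (sum_rhoz_le _ _ h0) _; first by rewrite card_ord.
rewrite card_ord /= /errC -[X in _ <= X]mulrA ler_wpM2l ?mulr_ge0 ?exprn_ge0 //.
apply: (@le_trans _ _ (\sum_(0 <= r < K.+1) cellC * (Y ^+ m * (r.+1%:R)^-1))).
  rewrite !big_nat; apply: ler_sum => r rK; rewrite /h -mulrA ler_wpM2l //.
  have -> : n = (d + m)%N by lia.
  rewrite [X in Y ^+ X](_ : _ = m); last by lia.
  have r0 : 0 < (r.+1%:R : R) by [].
  rewrite exprD exprSr invfM -mulrA mulrCA mulKf ?expf_neq0 ?gt_eqF // mulrC ler_wpM2r ?invr_ge0 //.
  apply: lerXn2r; rewrite ?nnegrE //; apply: le_trans KY; rewrite ler_nat; lia.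
rewrite -!mulr_sumr ler_wpM2l // ler_wpM2l ?exprn_ge0 //.
apply: le_trans (harmonic_le R K) _; rewrite lerD2l ler_ln ?posrE //; lra.
Qed.

(** The constant of [sandwich] for W = 1 and c = D. *)
Definition powC : R := m.+1%:R * (1 + D) ^+ m * D.

Definition veroneseC : R := veroneseI * powC + nearC + errC.

Lemma powC_ge0 : 0 <= powC.
Proof. by rewrite /powC; apply: mulr_ge0 => //; apply: mulr_ge0 => //; apply: exprn_ge0; apply: addr_ge0. Qed.

Lemma nearC_ge0 : 0 <= nearC.
Proof. by rewrite mulr_ge0 ?exprn_ge0. Qed.

Lemma errC_ge0 : 0 <= errC.
Proof. by rewrite /errC !mulr_ge0 ?exprn_ge0 //; apply: le_trans (cellC_ge1 _ _ _). Qed.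

Lemma veroneseC_ge0 : 0 <= veroneseC.
Proof.
apply: addr_ge0; last exact: errC_ge0.
apply: addr_ge0; last exact: nearC_ge0.
by apply: mulr_ge0; [exact/ltW/veroneseI_gt0|exact: powC_ge0].
Qed.

Lemma zsumS_veronese (Y : R) : 1 <= Y ->
  `|zsumS fz Y - veroneseI * Y ^+ m.+1| <= veroneseC * (Y ^+ m * (1 + ln Y)).
Proof.
move=> Y1; have Y0 : 0 < Y by lra.
have L0 : 0 <= ln Y by apply: ln_ge0.
have I0 := veroneseI_gt0.
have E := sum_err_le Y1.
have Ym : 0 < Y ^+ m by rewrite exprn_gt0.
have Ym1 : 1 <= Y ^+ m by apply: exprn_ege1.
have DY : D <= D * Y by rewrite ler_peMr.
have Dn0 : 0 <= D by [].
have P1 : `|(Y + D) ^+ m.+1 - Y ^+ m.+1| <= powC * Y ^+ m.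
  have := @sandwich R m 1 Y D D ((Y + D) ^+ m.+1) ler01 Y0 Dn0 DY.
  rewrite !mul1r => H; rewrite /powC -[X in _ <= X]mulrA; apply: H => //.
    by rewrite exprn_ge0 // addr_ge0 // ltW.
  move=> h; apply: lerXn2r; rewrite ?nnegrE; lra.
(* For Y <= D there is no ball of radius Y - D; the lower comparison degenerates to 0, which
   [sandwich] admits. *)
have P2 : `|(if D < Y then (Y - D) ^+ m.+1 else 0) - Y ^+ m.+1| <= powC * Y ^+ m.
  have := @sandwich R m 1 Y D D (if D < Y then (Y - D) ^+ m.+1 else 0) ler01 Y0 Dn0 DY.
  rewrite !mul1r => H; rewrite /powC -[X in _ <= X]mulrA; apply: H => //.
  - by case: ifP => // h; rewrite exprn_ge0 // subr_ge0 ltW.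
  - case: ifP => h; last by rewrite exprn_ge0 // addr_ge0 // ltW.
    apply: lerXn2r; rewrite ?nnegrE; lra.
  - by move=> ->.
have n0 := nearC_ge0.
have e0 := errC_ge0.
have S0 : 0 <= zsumS fz Y by apply: sumr_ge0 => z _; apply: fz_ge0.
have up : (if D < Y then (Y - D) ^+ m.+1 else 0) * veroneseI <= nearC + (zsumS fz Y + errC * (Y ^+ m * (1 + ln Y))).
  case: ifP => h; last by rewrite mul0r addr_ge0 // addr_ge0 // mulr_ge0 // mulr_ge0 ?addr_ge0 // ltW.
  have YD : 0 < Y - D by rewrite subr_gt0.
  have := upper_cells d0 dn YD; rewrite iint_fball // lee_fin subrK => H.
  apply: le_trans H _; rewrite lerD2l big_split /= lerD2l; exact: E.
have low : zsumS fz Y - errC * (Y ^+ m * (1 + ln Y)) <= (Y + D) ^+ m.+1 * veroneseI.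
  pose L := [seq z <- zball T Y | z != 0].
  have uL : uniq L by apply/filter_uniq/uniq_zball.
  have := lower_cells d0 dn Y0 uL _; rewrite iint_fball; last by rewrite addr_gt0.
  rewrite lee_fin => H; apply: le_trans (H _); last first.
    by move=> z; rewrite mem_filter mem_zball => /andP [].
  rewrite big_filter; apply: le_trans (lerB (lexx _) E) _.
  rewrite -sumrB; apply: ler_sum => z _; rewrite /wlow le_max lexx orbT //.
have pY : 0 <= Y ^+ m * ln Y by rewrite mulr_ge0 // ltW.
have p0 := powC_ge0.
move: P1 P2 up low; rewrite !ler_norml /veroneseC.
move: ((Y + D) ^+ m.+1) (if D < Y then _ else _) => u v.
have -> : (veroneseI * powC + nearC + errC) * (Y ^+ m * (1 + ln Y)) =
  veroneseI * (powC * Y ^+ m) + veroneseI * powC * (Y ^+ m * ln Y) + nearC * Y ^+ m + nearC * (Y ^+ m * ln Y) + errC * (Y ^+ m * (1 + ln Y)) by ring.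
have a1 : 0 <= veroneseI * powC * (Y ^+ m * ln Y) by rewrite !mulr_ge0 // ltW.
have a2 : 0 <= nearC * (Y ^+ m * ln Y) by rewrite mulr_ge0.
have a3 : nearC <= nearC * Y ^+ m by rewrite ler_peMr.
move=> /andP [_ h1] /andP [h2 _] h3 h4.
have h1' : u * veroneseI <= veroneseI * Y ^+ m.+1 + veroneseI * (powC * Y ^+ m).
  by rewrite -mulrDr mulrC ler_wpM2l ?(ltW I0) //; lra.
have h2' : veroneseI * Y ^+ m.+1 - veroneseI * (powC * Y ^+ m) <= v * veroneseI.
  by rewrite -mulrBr mulrC ler_wpM2r ?(ltW I0) //; lra.
apply/andP; split; lra.
Qed.

Lemma fz_scale k z : fz (zscale k z) = k%:R ^- d * fz z.
Proof.
rewrite /fz -invfM -vn_scale //; congr (vn d _)^-1.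
by apply/funext => i; rewrite ffunE intrM.
Qed.

Hypothesis n2 : (2 <= n)%N.

(** Since k^-d (X / k)^m = X^m k^-n, the bound n >= 2 provides the k^-2 asked for by [zsumP_asymp].
    For k > X the sum is empty and the main term itself is charged to the error, hence [veroneseI]
    in the constant. *)
Lemma zsumP_veronese (X : R) : 1 <= X ->
  `|zsumP fz X - veroneseI * X ^+ m.+1 / zeta R n.+1| <= 2 * ((veroneseC + veroneseI) * (X ^+ m * (1 + ln X))).
Proof.
move=> X1; have X0 : 0 < X by lra.
have L0 : 0 <= ln X by apply: ln_ge0.
have I0 := veroneseI_gt0; have V0 := veroneseC_ge0.
have Xm : 0 <= X ^+ m by rewrite exprn_ge0 // ltW.
apply: (zsumP_asymp (e := d)) => //; first by move=> k a _; apply: fz_scale.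
move=> k k0; have kR : 0 < (k%:R : R) by rewrite ltr0n.
have k1 : 1 <= (k%:R : R) by rewrite ler1n.
have E1 : k%:R ^- d * (X / k%:R) ^+ m = X ^+ m * k%:R ^- n.
  by rewrite exprMn exprVn mulrCA -invfM -exprD (_ : (d + m)%N = n) //; lia.
have kn : (k%:R : R) ^- n <= k%:R ^- 2.
  rewrite lef_pV2 ?posrE ?exprn_gt0 //.
  by rewrite -(subnKC n2) exprD ler_peMr ?exprn_ge0 // exprn_ege1.
have E2 : veroneseI * X ^+ m.+1 / k%:R ^+ n.+1 = k%:R ^- d * (veroneseI * (X / k%:R) ^+ m.+1).
  have -> : k%:R ^- d * (veroneseI * (X / k%:R) ^+ m.+1) = veroneseI * (k%:R ^- d * (X / k%:R) ^+ m) * (X / k%:R).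
    by rewrite [_ ^+ m.+1]exprSr; ring.
  by rewrite E1 !exprSr invfM; ring.
have kd : 0 <= k%:R ^- d :> R by rewrite invr_ge0 exprn_ge0.
rewrite E2 -mulrBr normrM ger0_norm //.
have main W : 0 <= W -> k%:R ^- d * (W * ((X / k%:R) ^+ m * (1 + ln X))) <= W * (X ^+ m * (1 + ln X)) / k%:R ^+ 2.
  move=> W0.
  have -> : k%:R ^- d * (W * ((X / k%:R) ^+ m * (1 + ln X))) = W * (1 + ln X) * (k%:R ^- d * (X / k%:R) ^+ m) by ring.
  rewrite E1; have -> : W * (X ^+ m * (1 + ln X)) / k%:R ^+ 2 = W * (1 + ln X) * (X ^+ m * k%:R ^- 2) by ring.
  by rewrite ler_wpM2l ?mulr_ge0 ?addr_ge0 // ler_wpM2l.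
have Yk : 0 <= (X / k%:R) ^+ m by rewrite exprn_ge0 // divr_ge0 // ltW.
apply: le_trans (main _ (_ : 0 <= veroneseC + veroneseI)); last by rewrite addr_ge0 // ltW.
rewrite ler_wpM2l //.
case: (ltP (X / k%:R) 1) => Xk.
  rewrite zsumS_small // sub0r normrN normrM (gtr0_norm I0) normrX ger0_norm ?divr_ge0 ?(ltW X0) //.
  apply: (@le_trans _ _ (veroneseI * ((X / k%:R) ^+ m * (1 + ln X)))); last first.
    by rewrite ler_wpM2r ?mulr_ge0 ?addr_ge0 // lerDr.
  rewrite ler_wpM2l ?(ltW I0) // exprSr ler_wpM2l //; lra.
apply: le_trans (zsumS_veronese Xk) _.
have L1 : 0 <= ln (X / k%:R) by apply: ln_ge0.
apply: ler_pM => //.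
- by rewrite mulr_ge0 // addr_ge0.
- by rewrite lerDl; apply: ltW.
rewrite ler_wpM2l // lerD2l ler_ln ?posrE //; last by lra.
by rewrite ler_pdivrMr // ler_peMr // ltW.
Qed.

End VeroneseAsymptotics.

(** * Hyperplane lattices *)

Section Residues.
Variables d n : nat.
Local Notation T := 'I_n.+1.

Lemma bezout_content (I : finType) (y : {ffun I -> int}) :
  exists u : {ffun I -> int}, \sum_i u i * y i = (vcontent y)%:Z.
Proof.
rewrite /vcontent.
apply: (big_ind (fun g : nat => exists u : {ffun I -> int}, \sum_i u i * y i = g%:Z)).
- by exists 0; apply: big1 => i _; rewrite ffunE mul0r.
- move=> g1 g2 [u1 H1] [u2 H2].
  have [a [b ab]] := Bezoutz g1%:Z g2%:Z.
  exists [ffun i => a * u1 i + b * u2 i].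
  transitivity (a * g1%:Z + b * g2%:Z); last by rewrite ab.
  rewrite -H1 -H2 !mulr_sumr -big_split /=; apply: eq_bigr => i _.
  by rewrite ffunE mulrDl !mulrA.
move=> i _; exists [ffun j => if j == i then sgz (y i) else 0].
rewrite (bigD1 i) //= ffunE eqxx big1 ?addr0; last first.
  by move=> j /negbTE ji; rewrite ffunE ji mul0r.
by rewrite abszEsg.
Qed.

Lemma content_pow (I : finType) (y : {ffun I -> int}) D : primitive I y ->
  vcontent [ffun i => y i ^+ D] = 1%N.
Proof.
move=> /eqP py; apply/eqP; apply: contraT => c1; set c := vcontent _ in c1.
have [p pp pc] : exists2 p, prime p & (p %| c)%N.
  case E : c c1 => [|[|c']] // _; first by exists 2.
  by exists (pdiv c'.+2); [apply: pdiv_prime|apply: pdiv_dvd].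
have : (p %| vcontent y)%N.
  apply/dvd_contentP => i; have /dvd_contentP /(_ i) := pc.
  by rewrite ffunE abszX Euclid_dvdX // => /andP [].
by rewrite /vcontent py dvdn1 => /eqP p1; rewrite p1 in pp.
Qed.

Variable x : {ffun T -> int}.
Hypothesis xprim : primitive T x.
Variable i0 : T.
Hypothesis xi0 : x i0 != 0.
Local Notation r := (`|x i0|%N).

(* One digit in base [x i0]; solvable since the [x i ^ D] are coprime. *)
Lemma residue_step D (q : int) : (0 < D)%N ->
  exists t : T -> int, [/\ forall i, 0 <= t i < r%:Z, t i0 = 0 &
    (x i0 %| q - \sum_i t i * x i ^+ D)%Z].
Proof.
move=> D0; have [u Hu] := bezout_content [ffun i => x i ^+ D].
rewrite content_pow // in Hu.
exists (fun i => if i == i0 then 0 else ((q * u i) %% x i0)%Z); rewrite eqxx; split => //.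
  move=> i; case: eqP => _; first by rewrite lexx ltz_nat absz_gt0.
  by rewrite modz_ge0 // abszE ltz_mod.
have -> : q - \sum_i (if i == i0 then 0 else (q * u i %% x i0)%Z) * x i ^+ D =
  \sum_i (q * u i - (if i == i0 then 0 else (q * u i %% x i0)%Z)) * x i ^+ D.
  under [RHS]eq_bigr => i _ do rewrite mulrBl.
  rewrite sumrB; congr (_ - _).
  rewrite -[LHS]mulr1 -[1]/(1%N%:Z) -Hu mulr_sumr; apply: eq_bigr => i _.
  by rewrite ffunE mulrA.
apply: (big_ind (fun z => (x i0 %| z)%Z)) => //.
  by move=> a b; apply: rpredD.
move=> i _; case: eqP => [->|_].
  by apply: dvdz_mull; rewrite -(prednK D0) exprS dvdz_mulr.
apply: dvdz_mulr; rewrite {1}(divz_eq (q * u i) (x i0)) addrK; exact: dvdz_mull.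
Qed.

Lemma size_digits k (i : T) : (k <= d)%N -> size (nseq k i0 ++ nseq (d - k) i) = d.
Proof. by move=> kd; rewrite size_cat !size_nseq subnKC. Qed.

Definition digitmon k (kd : (k <= d)%N) i : monom d n := mon (size_digits i kd).

Lemma mval_nseq (A : comNzRingType) (y : T -> A) k i : \prod_(j <- nseq k i) y j = y i ^+ k.
Proof. by elim: k => [|k IH] /=; rewrite ?big_nil ?big_cons ?IH ?exprS ?expr0. Qed.

Lemma mval_digitmon k (kd : (k <= d)%N) i : mval x (digitmon kd i) = x i0 ^+ k * x i ^+ (d - k).
Proof. by rewrite mval_mon big_cat /= !mval_nseq. Qed.

Lemma digitmonE k (kd : (k <= d)%N) i j :
  (val (digitmon kd i) j : nat) = ((i0 == j) * k + (i == j) * (d - k))%N.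
Proof.
by rewrite /= mon_ffunE ?size_digits // count_cat !count_nseq.
Qed.

Lemma purepowE (i j : T) : (val (purepow d i) j : nat) = ((i == j) * d)%N.
Proof. by rewrite /= mon_ffunE ?size_nseq // count_nseq. Qed.

Variable e1 : monom d n.
Hypothesis e1P : exists j l, [/\ j != l, j != i0, l != i0, (0 < (val e1 j : nat))%N & (0 < (val e1 l : nat))%N].

Definition lin (a : {ffun monom d n -> int}) : int := \sum_e a e * mval x e.

Lemma digitmon_neq0 k (kd : (k <= d)%N) i : (k < d)%N -> i != i0 -> digitmon kd i != purepow d i0.
Proof.
move=> kd' ii; apply/eqP => /(congr1 (fun e : monom d n => (val e i0 : nat))).
rewrite digitmonE purepowE eqxx (negbTE ii); lia.
Qed.

(** A digit monomial involves [i0] and at most one other variable, whereas [e1] involves two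
    others. *)
Lemma digitmon_neq1 k (kd : (k <= d)%N) i : digitmon kd i != e1.
Proof.
case: e1P => j [l [jl ji0 li0 ej el]]; apply/eqP => H.
have := congr1 (fun e : monom d n => (val e j : nat)) H; have := congr1 (fun e : monom d n => (val e l : nat)) H.
rewrite !digitmonE ![i0 == _]eq_sym (negbTE ji0) (negbTE li0) /=.
case: (eqVneq i j) => [->|ij].
  by rewrite (negbTE jl) !mul0n => El _; rewrite -El in el.
by rewrite !mul0n => _ Ej; rewrite -Ej in ej.
Qed.

(** After k digits the remainder is x_{i0}^k c. [residue_step] expresses c modulo x_{i0} through the
    x_i^(d-k), and multiplying by x_{i0}^k turns these into values of monomials of degree d. Each
    round adds at most n + 1 digits below r to a coefficient. *)
Lemma residue_rep k (q : int) : (k <= d)%N ->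
  exists s : {ffun monom d n -> int},
   [/\ forall e, 0 <= s e <= (k * n.+1 * r)%:Z, s (purepow d i0) = 0, s e1 = 0 &
     (x i0 ^+ k %| q - lin s)%Z].
Proof.
elim: k => [|k IH] kd.
  exists 0; split; try by rewrite ffunE.
    by move=> e; rewrite ffunE.
  by rewrite expr0 dvd1z.
have kd' : (k <= d)%N by apply: ltnW.
have [s [s0 se0 se1 /dvdzP [c Hc]]] := IH kd'.
have dk : (0 < d - k)%N by rewrite subn_gt0.
have [t [t0 ti0 Ht]] := residue_step c dk.
pose s' : {ffun monom d n -> int} := [ffun e => s e + \sum_i (if digitmon kd' i == e then t i else 0)].
exists s'; split.
- move=> e; rewrite ffunE.
  have h1 : 0 <= \sum_i (if digitmon kd' i == e then t i else 0) :> int.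
    by apply: sumr_ge0 => i _; case: ifP => // _; have /andP [] := t0 i.
  have h2 : \sum_i (if digitmon kd' i == e then t i else 0) <= (n.+1 * r)%:Z.
    have -> : (n.+1 * r)%:Z = \sum_(i : T) r%:Z.
      by rewrite sumr_const card_ord -mulr_natl PoszM natz.
    by apply: ler_sum => i _; have := t0 i; case: ifP => _; lia.
  by have := s0 e; rewrite mulSn mulnDl; lia.
- rewrite ffunE se0 add0r big1 // => i _; case: eqP => // H.
  (* For i = i0 the digit monomial is the pure power itself, but its digit was chosen 0. *)
  have [->//|ii] := eqVneq i i0.
  by have := digitmon_neq0 kd' kd ii; rewrite H eqxx.
- rewrite ffunE se1 add0r big1 // => i _; case: eqP => // H.
  by have := digitmon_neq1 kd' i; rewrite H eqxx.
have -> : lin s' = lin s + x i0 ^+ k * \sum_i t i * x i ^+ (d - k).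
  rewrite /lin; under eq_bigr => e _ do rewrite ffunE mulrDl.
  rewrite big_split /=; congr (_ + _).
  under eq_bigr => e _ do rewrite mulr_suml.
  rewrite exchange_big mulr_sumr /=; apply: eq_bigr => i _.
  rewrite (bigD1 (digitmon kd' i)) //= eqxx big1 ?addr0; last first.
    by move=> e; rewrite eq_sym => /negbTE ->; rewrite mul0r.
  by rewrite mval_digitmon mulrCA.
rewrite opprD addrA Hc mulrC -mulrBr exprSr; exact: dvdz_mul.
Qed.

End Residues.

Lemma big_sig_pred (V : nmodType) (I : finType) (P : pred I) (F : I -> V) :
  \sum_(i | P i) F i = \sum_(j : {i | P i}) F (val j).
Proof.
rewrite (@reindex_omap _ _ _ _ {j : I | P j} val insub) /=; last first.
  by move=> i Pi; rewrite insubT.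
by apply: eq_bigl => -[i Pi] /=; rewrite Pi /= insubT /= eqxx.
Qed.

(** * The hyperplane lattice at radii above rho *)

Section Hyperplane.
Variables (R : realType) (d n : nat).
Local Notation T := 'I_n.+1.
Variable x : {ffun T -> int}.
Variable i0 : T.
Hypothesis xi0 : x i0 != 0.
Hypothesis xmax : forall i, (`|x i| <= `|x i0|)%N.
Local Notation r := (`|x i0|%N).
Local Notation M := (r ^ d)%N.
Local Notation e0 := (purepow d i0).
Local Notation nu := (mval (d := d) x).
Local Notation lin := (@lin d n x).
Local Notation T' := {e : monom d n | e != e0}.

Lemma r_gt0 : (0 < r)%N. Proof. by rewrite absz_gt0. Qed.
Lemma M_gt0 : (0 < M)%N. Proof. by rewrite expn_gt0 r_gt0. Qed.
Lemma nu_e0 : nu e0 = x i0 ^+ d. Proof. exact: mval_purepow. Qed.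
Lemma nu_e0_abs : `|nu e0|%N = M. Proof. by rewrite nu_e0 abszX. Qed.
Lemma nu_e0_neq0 : nu e0 != 0. Proof. by rewrite nu_e0 expf_neq0. Qed.

Lemma nu_le e : (`|nu e| <= M)%N.
Proof.
have -> : M = (r ^ (\sum_(i < n.+1) (val e i : nat)))%N by rewrite sum_expo.
rewrite /mval expn_sum.
apply: (big_ind2 (fun a b => (`|a| <= b)%N)) => //.
  by move=> a1 b1 a2 b2 h1 h2; rewrite abszM leq_mul.
move=> i _; rewrite abszX; case: (posnP (val e i : nat)) => [->|ep]; first by rewrite !expn0.
by rewrite leq_exp2r.
Qed.

Definition resv (a : {ffun monom d n -> int}) : {ffun T' -> int} := [ffun e => a (val e)].
Definition linz (z : {ffun T' -> int}) : int := \sum_(e : T') z e * nu (val e).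
(** Inverse of [resv] on the hyperplane: the equation determines the dropped coordinate, the
    quotient being exact when [nu e0] divides [linz z]. *)
Definition liftv (z : {ffun T' -> int}) : {ffun monom d n -> int} :=
  [ffun e => if insub e is Some e' then z e' else - (linz z %/ nu e0)%Z].
Definition ellcoef (e : T') : R := (nu (val e))%:~R / (nu e0)%:~R.

Lemma ellcoef_le1 e : `|ellcoef e| <= 1.
Proof.
rewrite normrM normfV !normzR nu_e0_abs ler_pdivrMr ?ltr0n ?M_gt0 // mul1r ler_nat.
exact: nu_le.
Qed.

Lemma linE a : lin a = a e0 * nu e0 + linz (resv a).
Proof.
rewrite /lin (bigD1 e0) //= (big_sig_pred (fun e => e != e0)); congr (_ + _).
by apply: eq_bigr => e _; rewrite ffunE.
Qed.

Lemma liftvK : cancel liftv resv.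
Proof. by move=> z; apply/ffunP => e; rewrite !ffunE valK. Qed.

Lemma liftv_e0 z : liftv z e0 = - (linz z %/ nu e0)%Z.
Proof. by rewrite ffunE insubF ?eqxx. Qed.

Lemma lin_liftv z : (nu e0 %| linz z)%Z -> lin (liftv z) = 0.
Proof. by move=> h; rewrite linE liftvK liftv_e0 mulNr divzK // addNr. Qed.

Lemma resv_inj a b : lin a = 0 -> lin b = 0 -> resv a = resv b -> a = b.
Proof.
move=> la lb ab.
have E : a e0 = b e0.
  apply: (mulIf nu_e0_neq0); apply: (addIr (linz (resv a))).
  by rewrite -linE [in RHS]ab -linE la lb.
apply/ffunP => e; case: (eqVneq e e0) => [->//|ee].
have /ffunP /(_ (Sub e ee)) := ab; by rewrite !ffunE.
Qed.

(** On the hyperplane the dropped coordinate is minus the pairing of [ellcoef] with the others, so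
    its square is the second term of [ellq]. *)
Lemma znorm_ellz_res a : lin a = 0 -> znorm R (monom d n) a ^+ 2 = ellz ellcoef (resv a).
Proof.
move=> la; rewrite znorm_sq (bigD1 e0) //= (big_sig_pred (fun e => e != e0)).
rewrite /ellz /ellq addrC; congr (_ + _).
  by apply: eq_bigr => e _; rewrite ffunE.
have nuR : (nu e0)%:~R != 0 :> R by rewrite intr_eq0 nu_e0_neq0.
have -> : \sum_i ellcoef i * (resv a i)%:~R = (linz (resv a))%:~R / (nu e0)%:~R.
  rewrite /linz rmorph_sum /= mulr_suml; apply: eq_bigr => e _.
  by rewrite intrM /ellcoef; ring.
have -> : linz (resv a) = - (a e0 * nu e0) by apply/eqP; rewrite -addr_eq0 addrC -linE la.
by rewrite intrN intrM mulNr mulfK // sqrrN.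
Qed.

Lemma linzB (z w : {ffun T' -> int}) : linz [ffun e => z e - w e] = linz z - linz w.
Proof.
by rewrite /linz -sumrB; apply: eq_bigr => e _; rewrite ffunE mulrBl.
Qed.

Lemma linzD (z w : {ffun T' -> int}) : linz [ffun e => z e + w e] = linz z + linz w.
Proof.
by rewrite /linz -big_split; apply: eq_bigr => e _; rewrite ffunE mulrDl.
Qed.

Definition hyper (U : R) := [seq a <- zball (monom d n) U | lin a == 0].
Definition ellclass (q : int) (U : R) := [seq z <- ellball ellcoef U | (nu e0 %| linz z - q)%Z].

Lemma sum_ellclass (U : R) : (\sum_(q < M) size (ellclass q%:Z U) = size (ellball ellcoef U))%N.
Proof.
rewrite -(count_predT (ellball ellcoef U)) -sum1_count.
transitivity (\sum_(q < M) \sum_(z <- ellball ellcoef U | (nu e0 %| (linz z - q%:Z)%R)%Z) 1)%N.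
  by apply: eq_bigr => q _; rewrite size_filter -sum1_count.
rewrite (exchange_big_dep predT) //=; apply: eq_bigr => z _.
have h0 : 0 <= (linz z %% nu e0)%Z by rewrite modz_ge0 // nu_e0_neq0.
have h1 : (linz z %% nu e0)%Z < M%:Z.
  by rewrite -nu_e0_abs; have := ltz_mod (linz z) nu_e0_neq0; rewrite abszE.
have qM : (`|(linz z %% nu e0)%Z| < M)%N by lia.
rewrite (bigD1 (Ordinal qM)) /=; last first.
  by rewrite gez0_abs // {1}(divz_eq (linz z) (nu e0)) addrK dvdz_mull.
rewrite big1 ?addn0 // => q /andP [dq /negP qn]; case: qn.
apply/eqP/val_inj => /=; rewrite -eqz_mod_dvd in dq.
move/eqP: dq => ->; rewrite -modz_abs nu_e0_abs modz_small //; have := ltn_ord q; lia.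
Qed.

Variable s : int -> {ffun monom d n -> int}.
Variable c0 : nat.
Hypothesis s_bound : forall q e, 0 <= s q e <= (c0 * r)%:Z.
Hypothesis s_e0 : forall q, s q e0 = 0.
Hypothesis s_rep : forall q, (nu e0 %| q - lin (s q))%Z.

Let Dl : R := (#|{: T'}|.+1)%:R * (c0 * r)%:R.

Lemma linz_res_s q : (nu e0 %| linz (resv (s q)) - q)%Z.
Proof. by have := s_rep q; rewrite linE s_e0 mul0r add0r -opprB rpredN. Qed.

Lemma s_small q : ellq ellcoef (fun e => (resv (s q) e)%:~R) <= Dl ^+ 2.
Proof.
apply: ellq_small => e; first exact: ellcoef_le1.
rewrite ffunE normzR ler_nat; have /andP [] := s_bound q (val e); move: (s q _) (c0 * r)%N => a b; lia.
Qed.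

Lemma s_smallN q : ellq ellcoef (fun e => - (resv (s q) e)%:~R) <= Dl ^+ 2.
Proof.
apply: ellq_small => e; first exact: ellcoef_le1.
rewrite ffunE normrN normzR ler_nat; have /andP [] := s_bound q (val e); move: (s q _) (c0 * r)%N => a b; lia.
Qed.

Hypothesis c00 : (0 < c0)%N.

Lemma Dl_gt0 : 0 < Dl.
Proof. by rewrite /Dl mulr_gt0 // ltr0n ?muln_gt0 ?c00 ?r_gt0. Qed.

(* Translation by the representative [s q] maps the hyperplane lattice onto the
   vectors of residue [q]. *)
Lemma hyper_le_class q (U : R) : 0 < U -> (size (hyper U) <= size (ellclass q (U + Dl)))%N.
Proof.
move=> U0; apply: (@size_inj_le _ _ _ _ (fun a => [ffun e => resv a e + resv (s q) e])).
- exact/filter_uniq/uniq_zball.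
- move=> a b; rewrite !mem_filter => /andP [/eqP la _] /andP [/eqP lb _] /ffunP H.
  apply: resv_inj => //; apply/ffunP => e; have := H e; rewrite [LHS]ffunE [RHS]ffunE.
  exact: addIr.
move=> a; rewrite mem_filter mem_zball => /andP [/eqP la aU].
have DU : 0 < U + Dl by rewrite addr_gt0 // Dl_gt0.
rewrite mem_filter (mem_ellball _ _ (ltW DU)); apply/andP; split.
  rewrite linzD -addrA rpredD ?linz_res_s //.
  have -> : linz (resv a) = - (a e0 * nu e0) by apply/eqP; rewrite -addr_eq0 addrC -linE la.
  by rewrite rpredN dvdz_mull.
rewrite /ellz; have -> : (fun e => ([ffun e => resv a e + resv (s q) e] e)%:~R : R) =
   (fun e => (resv a e)%:~R + (resv (s q) e)%:~R) by apply/funext => e; rewrite ffunE intrD.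
apply: ellq_add => //; [exact: Dl_gt0| |exact: s_small].
rewrite -/(ellz ellcoef (resv a)) -znorm_ellz_res // ler_pXn2r // nnegrE ?znorm_ge0 //; exact: ltW.
Qed.

(** Translating back by [s q] makes the pairing divisible by [nu e0], and [liftv] then restores the
    dropped coordinate. *)
Lemma class_le_hyper q (U : R) : 0 < U -> (size (ellclass q U) <= size (hyper (U + Dl)))%N.
Proof.
move=> U0; apply: (@size_inj_le {ffun T' -> int} {ffun monom d n -> int} _ _ (fun z => liftv [ffun e => z e - resv (s q) e])).
- exact/filter_uniq/uniq_ellball.
- move=> z w _ _ /(can_inj liftvK) /ffunP H; apply/ffunP => e; have := H e.
  rewrite [LHS]ffunE [RHS]ffunE; exact: addIr.
move=> z; rewrite mem_filter (mem_ellball _ _ (ltW U0)) => /andP [zq zU].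
have DU : 0 < U + Dl by rewrite addr_gt0 // Dl_gt0.
set w := [ffun e => _].
have lw : lin (liftv w) = 0.
  apply: lin_liftv; rewrite /w linzB.
  have -> : linz z - linz (resv (s q)) = (linz z - q) - (linz (resv (s q)) - q) by ring.
  by rewrite rpredB ?linz_res_s.
rewrite mem_filter lw eqxx mem_zball /=.
rewrite -(ler_pXn2r (n := 2)) // ?nnegrE ?znorm_ge0 //; last exact: ltW.
rewrite znorm_ellz_res // liftvK /ellz.
have -> : (fun e => (w e)%:~R : R) = (fun e => (z e)%:~R + - (resv (s q) e)%:~R).
  by apply/funext => e; rewrite ffunE intrB.
apply: ellq_add => //; [exact: Dl_gt0| exact: s_smallN].
Qed.

Local Notation N' := #|{: T'}|.
Let W : R := Vball R N' / Num.sqrt (1 + \sum_e ellcoef e ^+ 2).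
Let Dt : R := (N'.+1 * (c0 + 1) * r)%:R.

(** As r >= 1, the translation loss [Dl] and the rounding loss N' + 1 together are at most a fixed
    multiple of r. *)
Lemma Dl_Dt : Dl + N'.+1%:R <= Dt.
Proof.
rewrite /Dl /Dt -natrM -natrD ler_nat; have := r_gt0; move: r => k; nia.
Qed.

(** Each of the M residue classes in the enlarged ellipsoid has at least as many points as the
    hyperplane, and together they exhaust the integer points there. *)
Lemma hyper_upper (U : R) : 0 < U -> M%:R * (size (hyper U))%:R <= W * (U + Dt) ^+ N'.
Proof.
move=> U0; have D0 := Dl_gt0.
have U1 : 0 < U + Dl by rewrite addr_gt0.
apply: (@le_trans _ _ ((size (ellball ellcoef (U + Dl)))%:R)).
  rewrite -sum_ellclass -natrM ler_nat -[X in (X * _)%N]card_ord -sum_nat_const.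
  by apply: leq_sum => q _; apply: hyper_le_class.
apply: le_trans (size_ellball_le ellcoef_le1 U1) _.
rewrite ler_wpM2l ?divr_ge0 ?sqrtr_ge0 ?(ltW (Vball_gt0 _ _)) //.
have := Dl_Dt; have n0 : 0 <= N'.+1%:R :> R by [].
move=> h; apply: lerXn2r; rewrite ?nnegrE; lra.
Qed.

Lemma hyper_lower (U : R) : Dt < U -> W * (U - Dt) ^+ N' <= M%:R * (size (hyper U))%:R.
Proof.
move=> DU; have D0 := Dl_gt0; have DD := Dl_Dt.
have n0 : 0 <= N'.+1%:R :> R by [].
have U1 : N'.+1%:R < U - Dl by lra.
apply: (@le_trans _ _ ((size (ellball ellcoef (U - Dl)))%:R)); last first.
  rewrite -sum_ellclass -natrM ler_nat -[X in (X * _)%N]card_ord -sum_nat_const.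
  apply: leq_sum => q _; rewrite -[U in hyper U](subrK Dl); apply: class_le_hyper; lra.
apply: le_trans (size_ellball_ge ellcoef_le1 U1).
rewrite ler_wpM2l ?divr_ge0 ?sqrtr_ge0 ?(ltW (Vball_gt0 _ _)) //.
apply: lerXn2r; rewrite ?nnegrE; lra.
Qed.

(** The index r^d times the volume factor of the ellipsoid is the covolume ||nu|| of the hyperplane
    lattice. *)
Lemma M_vn : M%:R * Num.sqrt (1 + \sum_e ellcoef e ^+ 2) = vn d (fun i => (x i)%:~R : R).
Proof.
rewrite -[M%:R]ger0_norm // -sqrtr_sqr -sqrtrM ?sqr_ge0 //; congr Num.sqrt.
have nuE e : mval (fun i => (x i)%:~R : R) e = (nu e)%:~R.
  by rewrite -(mval_morph (intmul 1 : {rmorphism int -> R})).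
rewrite (bigD1 e0) //= (big_sig_pred (fun e => e != e0)) mulrDr mulr1 nuE.
have nuM : (nu e0)%:~R ^+ 2 = (M%:R : R) ^+ 2.
  by rewrite -nu_e0_abs -normzR real_normK ?num_real.
rewrite nuM; congr (_ + _); rewrite mulr_sumr; apply: eq_bigr => e _.
rewrite nuE /ellcoef exprMn -nuM exprVn mulrCA divff ?mulr1 //.
by rewrite sqrf_eq0 intr_eq0 nu_e0_neq0.
Qed.

End Hyperplane.

(** * The hyperplane lattice at radii below rho *)

Section SmallHyperplane.
Variables (d n : nat).
Local Notation T := 'I_n.+1.
Variable x : {ffun T -> int}.
Variable i0 : T.
Hypothesis xi0 : x i0 != 0.
Local Notation r := (`|x i0|%N).
Local Notation M := (r ^ d)%N.
Local Notation e0 := (purepow d i0).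
Local Notation nu := (mval (d := d) x).
Local Notation lin := (@lin d n x).
Local Notation V := {ffun monom d n -> int}.

Variable e1 : monom d n.
Hypothesis e01 : e1 != e0.
Variable s : int -> V.
Variable c0 : nat.
Hypothesis s_bound : forall q e, 0 <= s q e <= (c0 * r)%:Z.
Hypothesis s_e0 : forall q, s q e0 = 0.
Hypothesis s_e1 : forall q, s q e1 = 0.
Hypothesis s_rep : forall q, (nu e0 %| q - lin (s q))%Z.

Local Notation T2 := {e : monom d n | (e != e0) && (e != e1)}.

Lemma linD (a b : V) : lin [ffun e => a e + b e] = lin a + lin b.
Proof. by rewrite /lin -big_split; apply: eq_bigr => e _; rewrite ffunE mulrDl. Qed.

Lemma linZ (k : int) (a : V) : lin [ffun e => k * a e] = k * lin a.
Proof. by rewrite /lin mulr_sumr; apply: eq_bigr => e _; rewrite ffunE mulrA. Qed.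

Variable t : nat.
Hypothesis t0 : (0 < t)%N.
Hypothesis tr : (t <= r)%N.

Definition smallhyper : seq V := [seq a <- intbox (monom d n) t | lin a == 0].
(** Fixing the coordinate at [e1] makes differences vanish there, so translates of a fibre live in N
    - 2 coordinates. *)
Definition fibre (c : int) : seq V := [seq a : V <- smallhyper | a e1 == c].

Lemma mem_fibre c a : a \in fibre c -> [/\ lin a = 0, a e1 = c & forall e, (`|a e| <= t)%N].
Proof.
by rewrite mem_filter mem_filter mem_intbox => /andP [/eqP ac /andP [/eqP la /forallP at_]].
Qed.

Lemma uniq_fibre c : uniq (fibre c).
Proof. exact/filter_uniq/filter_uniq/uniq_intbox. Qed.

Lemma size_smallhyper : (size smallhyper = \sum_(j < (2 * t).+1) size (fibre (j%:Z - t%:Z)))%N.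
Proof.
transitivity (\sum_(j < (2 * t).+1) \sum_(a <- smallhyper | ((a : V) e1 == j%:Z - t%:Z)%R) 1)%N; last first.
  by apply: eq_bigr => j _; rewrite size_filter -sum1_count.
rewrite (exchange_big_dep predT) //= -[LHS]sum1_size big_seq [RHS]big_seq.
apply: eq_bigr => a; rewrite mem_filter mem_intbox => /andP [_ /forallP /(_ e1) ha].
have jl : (`|(a e1 + t%:Z)%R| < (2 * t).+1)%N by move: (a e1) ha => b hb; lia.
have jE : (`|(a e1 + t%:Z)%R|%N)%:Z = a e1 + t%:Z by rewrite gez0_abs //; move: (a e1) ha => b hb; lia.
rewrite (bigD1 (Ordinal jl)) /=; last by rewrite jE addrK.
rewrite big1 // => j /andP [/eqP ej /negP []].
by apply/eqP/val_inj; rewrite /= ej subrK absz_nat.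
Qed.

(** For |v| <= 4t and j <= [nshift] the multiple j v has sup norm at most r. With t <= r for the
    point itself and c0 r for the representative, translates stay within [boxrad]. *)
Definition nshift := (r %/ (4 * t))%N.
Definition boxrad := ((2 + c0) * r)%N.

Section Translates.
Variables (c : int) (v : V).
Hypotheses (lv : lin v = 0) (v1 : v e1 = 0) (vle : forall e, (`|v e| <= 4 * t)%N).
Hypothesis vgt : exists e, (2 * t < `|v e|)%N.

Definition transl (p : V * ('I_nshift.+1 * 'I_M)) : {ffun T2 -> int} :=
  [ffun e => p.1 (val e) + (p.2.1 : nat)%:Z * v (val e) + s (p.2.2 : nat)%:Z (val e)].

Lemma transl_box p : p.1 \in fibre c -> transl p \in intbox {: T2} boxrad.
Proof.
case: p => a [j q] /= /mem_fibre [_ _ ha]; rewrite mem_intbox; apply/forallP => e.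
rewrite ffunE /=.
have h1 := ha (val e); have h2 := vle (val e); have := s_bound (q : nat)%:Z (val e).
have hj : (j * (4 * t) <= r)%N.
  by apply: leq_trans (leq_trunc_div r (4 * t)); rewrite leq_mul2r -ltnS ltn_ord orbT.
have h3 : (`|((j : nat)%:Z * v (val e))%R| <= r)%N.
  by rewrite abszM absz_nat; apply: leq_trans hj; rewrite leq_mul2l h2 orbT.
rewrite /boxrad mulnDl; move: (_ * v _) (s _ _) (a _) h3 h1 (c0 * r)%N => A B C; lia.
Qed.

(** Pairing with nu gives q modulo r^d, hence q; the equation then gives the coordinate at [e0], so
    a + j v is known. Two points of the fibre differ by at most 2t in each coordinate while some |v
    e| > 2t, so j and then a are determined. *)
Lemma transl_inj (p p' : V * ('I_nshift.+1 * 'I_M)) : p.1 \in fibre c -> p'.1 \in fibre c ->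
  transl p = transl p' -> p = p'.
Proof.
case: p p' => a [j q] [a' [j' q']] /= /mem_fibre [la ae1 ha] /mem_fibre [la' a'e1 ha'] /ffunP H.
pose w : V := [ffun e => a e + (j : nat)%:Z * v e].
pose w' : V := [ffun e => a' e + (j' : nat)%:Z * v e].
have lw : lin w = 0.
  have -> : w = [ffun e => a e + [ffun e => (j : nat)%:Z * v e] e] by apply/ffunP => e; rewrite !ffunE.
  by rewrite linD linZ lv mulr0 addr0.
have lw' : lin w' = 0.
  have -> : w' = [ffun e => a' e + [ffun e => (j' : nat)%:Z * v e] e] by apply/ffunP => e; rewrite !ffunE.
  by rewrite linD linZ lv mulr0 addr0.
(* At [e1], which [transl] omits, both sides are c: the fibre fixes the coordinate, and [v] and
   [s q] vanish there. *)
have agree e : e != e0 -> w e + s (q : nat)%:Z e = w' e + s (q' : nat)%:Z e.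
  move=> ee0; have [->|ee1] := eqVneq e e1.
    by rewrite !s_e1 !ffunE v1 !mulr0 ae1 a'e1.
  have P : (e != e0) && (e != e1) by rewrite ee0.
  by have := H (Sub e P); rewrite !ffunE.
have qq : (nu e0 %| (q : nat)%:Z - (q' : nat)%:Z)%Z.
  have E1 : lin [ffun e => w e + s (q : nat)%:Z e] - lin [ffun e => w' e + s (q' : nat)%:Z e]
     = (w e0 - w' e0) * nu e0.
    rewrite /lin -sumrB (bigD1 e0) //= big1 ?addr0; last first.
      by move=> e ee0; rewrite !ffunE -mulrBl; have := agree e ee0; rewrite !ffunE => ->; rewrite subrr mul0r.
    by rewrite -mulrBl !ffunE !s_e0 !addr0.
  rewrite !linD lw lw' !add0r in E1.
  have -> : (q : nat)%:Z - (q' : nat)%:Z = ((q : nat)%:Z - lin (s (q : nat)%:Z)) -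
    ((q' : nat)%:Z - lin (s (q' : nat)%:Z)) + (lin (s (q : nat)%:Z) - lin (s (q' : nat)%:Z)) by ring.
  by apply: rpredD; [apply: rpredB; apply: s_rep|rewrite E1 dvdz_mull].
have q_eq : q = q'.
  apply/val_inj => /=; move: qq; rewrite -eqz_mod_dvd -!(modz_abs _ (nu e0)) nu_e0_abs.
  have h1 := ltn_ord q; have h2 := ltn_ord q'.
  by rewrite !modz_small ?ltz_nat ?h1 ?h2 //= => /eqP [].
subst q'.
have ww : w = w'.
  apply: (resv_inj xi0 lw lw'); apply/ffunP => e; rewrite [LHS]ffunE [RHS]ffunE.
  exact: (addIr (s (q : nat)%:Z (val e)) (agree _ (valP e))).
have jj : j = j'.
  apply/val_inj => /=; apply/eqP; apply: contraT => jn.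
  have [e ve] := vgt.
  have /ffunP /(_ e) := ww; rewrite !ffunE => E.
  have h1 := ha e; have h2 := ha' e.
  have E2 : ((j' : nat)%:Z - (j : nat)%:Z) * v e = a e - a' e.
    by rewrite mulrBl; move: E; move: ((j : nat)%:Z * v e) ((j' : nat)%:Z * v e) (a e) (a' e) => A1 A2 A3 A4; lia.
  have E3 : (`|((j' : nat)%:Z - (j : nat)%:Z)%R| * `|v e| <= 2 * t)%N by rewrite -abszM E2; move: (a e) (a' e) h1 h2 => A3 A4; lia.
  have E4 : (0 < `|((j' : nat)%:Z - (j : nat)%:Z)%R|)%N by lia.
  have : (`|v e| <= 2 * t)%N by apply: leq_trans E3; rewrite leq_pmull.
  by rewrite leqNgt ve.
subst j'; congr (_, _); apply/ffunP => e.
by have /ffunP /(_ e) := ww; rewrite !ffunE => /addIr.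
Qed.

Lemma size_fibre_transl : (size (fibre c) * (nshift.+1 * M) <= (2 * boxrad).+1 ^ #|{: T2}|)%N.
Proof.
rewrite -size_intbox.
have <- : size [seq (a, p) | a <- fibre c, p <- enum {: 'I_nshift.+1 * 'I_M}] = (size (fibre c) * (nshift.+1 * M))%N.
  by rewrite size_allpairs -cardE card_prod !card_ord.
apply: (@size_inj_le _ _ _ _ transl).
- by apply: allpairs_uniq; rewrite ?uniq_fibre ?enum_uniq // => -[a p] [a' p'] _ _ [-> ->].
- move=> p p' /allpairsP [[a1 p1] /= [h1 _ ->]] /allpairsP [[a2 p2] /= [h2 _ ->]].
  exact: transl_inj.
by move=> p /allpairsP [[a1 p1] /= [h1 _ ->]]; apply: transl_box.
Qed.

End Translates.

Hypothesis N3 : (d.+1 <= #|{: T2}|)%N.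

(* If the fibre has two elements, a multiple [v] of their difference has sup norm
   in (2t, 4t]; the translates by [j v + s q], [j <= r / 4t], [q < r^d], of the
   fibre are pairwise distinct and stay in a box of side O(r). *)
Lemma size_fibre c : (size (fibre c) * M * r <= 4 * t * (2 * boxrad).+1 ^ #|{: T2}|)%N.
Proof.
have r0 : (0 < r)%N by rewrite absz_gt0.
case Ef : (fibre c) => [|a [|b l]] //.
  (* A single point: r^(d+1) <= r^(N-2) by [N3]. *)
  rewrite mul1n -expnSr; apply: leq_trans (_ : r ^ #|{: T2}| <= _)%N.
    by rewrite leq_pexp2l.
  apply: leq_trans (_ : (2 * boxrad).+1 ^ #|{: T2}| <= _)%N; last by rewrite leq_pmull // muln_gt0.
  by rewrite leq_exp2r; [rewrite /boxrad; nia|apply: leq_trans N3].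
rewrite -Ef.
have /mem_fibre [la ae ha] : a \in fibre c by rewrite Ef mem_head.
have /mem_fibre [lb be hb] : b \in fibre c by rewrite Ef !inE eqxx orbT.
have ab : a != b.
  by have := uniq_fibre c; rewrite Ef /= inE negb_or => /andP [/andP [ab _] _].
pose u : V := [ffun e => a e + [ffun e => -1 * b e] e].
have lu : lin u = 0 by rewrite linD linZ la lb mulr0 addr0.
have uE e : u e = a e - b e by rewrite !ffunE mulN1r.
have u0 : u != 0.
  apply: contra ab => /eqP /ffunP H; apply/eqP/ffunP => e.
  by have := H e; rewrite uE ffunE => /eqP; rewrite subr_eq0 => /eqP.
have p0 : (0 < rhoz u)%N by rewrite lt0n rhoz_eq0.
have p2 : (rhoz u <= 2 * t)%N.
  by apply/bigmax_leqP => e _; rewrite uE; move: (a e) (b e) (ha e) (hb e) => A1 A2; lia.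
(* The least k with k |u| > 2t in sup norm; |u| <= 2t keeps k |u| within 4t. *)
pose k := (2 * t %/ rhoz u).+1.
pose v : V := [ffun e => k%:Z * u e].
have kp1 : (2 * t < k * rhoz u)%N by apply: ltn_ceil.
have kp2 : (k * rhoz u <= 4 * t)%N.
  by rewrite /k mulSn; have := leq_trunc_div (2 * t) (rhoz u); lia.
have S := @size_fibre_transl c v.
have {S}S : (size (fibre c) * (nshift.+1 * M) <= (2 * boxrad).+1 ^ #|{: T2}|)%N.
  apply: S.
  - by rewrite linZ lu mulr0.
  - by rewrite ffunE uE ae be subrr mulr0.
  - move=> e; rewrite ffunE abszM absz_nat; apply: leq_trans kp2.
    by rewrite leq_mul2l rhoz_ge orbT.
  have [|e _ He] := @eq_bigmax_cond _ xpredT (fun e => `|u e|%N).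
    by apply/card_gt0P; exists e0.
  by exists e; rewrite ffunE abszM absz_nat -He.
have Jr : (r <= nshift.+1 * (4 * t))%N by apply: ltnW; apply: ltn_ceil; rewrite muln_gt0.
apply: leq_trans (_ : size (fibre c) * M * (nshift.+1 * (4 * t)) <= _)%N.
  by rewrite leq_mul2l Jr orbT.
have -> : (size (fibre c) * M * (nshift.+1 * (4 * t)) = 4 * t * (size (fibre c) * (nshift.+1 * M)))%N by ring.
by rewrite leq_mul2l S orbT.
Qed.

(** There are 2t + 1 <= 3t fibres, each bounded with a further factor 4t: hence 12 t^2. *)
Lemma size_smallhyper_le : (size smallhyper * M * r <= 12 * (2 * c0 + 5) ^ #|{: T2}| * t ^ 2 * r ^ #|{: T2}|)%N.
Proof.
have r0 : (0 < r)%N by rewrite absz_gt0.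
rewrite size_smallhyper !big_distrl /=.
apply: leq_trans (leq_sum _ (fun j _ => size_fibre _)) _.
rewrite sum_nat_const card_ord.
have h : ((2 * boxrad).+1 <= (2 * c0 + 5) * r)%N by rewrite /boxrad; nia.
have hK : ((2 * boxrad).+1 ^ #|{: T2}| <= (2 * c0 + 5) ^ #|{: T2}| * r ^ #|{: T2}|)%N.
  by rewrite -expnMn leq_exp2r //; apply: leq_trans N3.
move: hK; move: ((2 * boxrad).+1 ^ _)%N ((2 * c0 + 5) ^ _)%N (r ^ #|{: T2}|)%N => A B C ABC.
apply: leq_trans (_ : (2 * t).+1 * (4 * t * (B * C)) <= _)%N; first by rewrite !leq_mul.
by have -> : (12 * B * t ^ 2 * C = 3 * t * (4 * t * (B * C)))%N; [ring|rewrite leq_mul //; lia].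
Qed.

End SmallHyperplane.

Section Counting.
Variables d n : nat.

Lemma card_monom : #|{: monom d n}| = Ndn d n.
Proof.
rewrite /Ndn -bin_sub ?leq_addl // addnK -card_ord_partitions card_sig.
pose f (e : {ffun 'I_n.+1 -> 'I_d.+1}) : n.+1.-tuple 'I_d.+1 := [tuple e i | i < n.+1].
have fi : injective f.
  move=> e e' /(congr1 (fun t => tnth t)) H; apply/ffunP => i.
  by have := congr1 (fun g => g i) H; rewrite !tnth_mktuple.
rewrite -(fintype.card_image fi); apply: eq_card => t; rewrite inE; apply/fintype.imageP/idP.
  move=> [e]; rewrite inE => /eqP He ->; apply/eqP; rewrite -[RHS]He big_tuple.
  by apply: eq_bigr => i _; rewrite tnth_mktuple.
move=> /eqP Ht; exists [ffun i => tnth t i].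
  rewrite inE; apply/eqP; rewrite -[RHS]Ht big_tuple.
  by apply: eq_bigr => i _; rewrite ffunE.
by apply: eq_from_tnth => i; rewrite tnth_mktuple ffunE.
Qed.

(** The binomial grows with n, so n = 2 suffices, where it is (d + 1)(d + 2) / 2. The result
    supplies [N3]. *)
Lemma Ndn_ge : (2 <= d)%N -> (d <= n)%N -> (d + 3 <= Ndn d n)%N.
Proof.
move=> d2 dn; rewrite /Ndn; apply: leq_trans (_ : 'C(2 + d, d) <= _)%N; last first.
  by apply: leq_bin2l; rewrite leq_add2r; apply: leq_trans dn.
rewrite -bin_sub ?leq_addl // addnK bin2 geq_half_double -muln2 /=.
case: d d2 => // k; nia.
Qed.

Lemma card_monom_neq (i0 : 'I_n.+1) : #|{: {e : monom d n | e != purepow d i0}}| = (Ndn d n).-1.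
Proof. by rewrite card_sig -card_monom -(cardC1 (purepow d i0)). Qed.

Lemma card_monom_neq2 (e0 e1 : monom d n) : e1 != e0 ->
  #|{: {e : monom d n | (e != e0) && (e != e1)}}| = (Ndn d n - 2)%N.
Proof.
move=> e10; rewrite card_sig -card_monom.
have := cardC (pred2 e0 e1); rewrite card2 eq_sym e10 /= => <-.
rewrite addKn; apply: eq_card => e; rewrite !inE negb_or //.
Qed.

Hypotheses (d2 : (2 <= d)%N) (dn : (d <= n)%N).

(** As n >= 2 there are two variables besides [i0], and d >= 2 lets both occur in x_j x_l^(d-1). *)
Lemma exists_mixed (i0 : 'I_n.+1) : exists e1 : monom d n,
  exists j l, [/\ j != l, j != i0, l != i0, (0 < (val e1 j : nat))%N & (0 < (val e1 l : nat))%N].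
Proof.
have n2 : (2 <= n)%N by apply: leq_trans dn.
have n0 : (0 < n)%N by lia.
have n1 : (1 < n)%N by lia.
pose j := lift i0 (Ordinal n0); pose l := lift i0 (Ordinal n1).
have jl : j != l by apply/eqP => /lift_inj /(congr1 val).
have sz : size (j :: nseq d.-1 l) = d by rewrite /= size_nseq prednK //; lia.
exists (mon sz), j, l; split => //; rewrite ?[_ == i0]eq_sym ?neq_lift //=; rewrite mon_ffunE //=.
  by rewrite eqxx.
by rewrite count_nseq /= eqxx mul1n; lia.
Qed.

End Counting.

(** * Primitive coefficient vectors on one hyperplane *)

Section HyperplanePrimitive.
Variables (R : realType) (d n : nat).
Hypotheses (d2 : (2 <= d)%N) (dn : (d <= n)%N).
Local Notation T := 'I_n.+1.
Local Notation p := (Ndn d n - 2)%N.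
Local Notation Vp := (Vball R p.+1).
Local Notation c0 := (d * n.+1)%N.

Definition onhyper (x : {ffun T -> int}) (a : {ffun monom d n -> int}) : R := (lin x a == 0)%:R.

Lemma Ndn_sub2_ge : (d.+1 <= p)%N. Proof. by have := Ndn_ge d2 dn; lia. Qed.
Lemma Ndn_sub2K : Ndn d n = p.+2. Proof. by have := Ndn_sub2_ge; lia. Qed.

Definition hypc : R := (p.+2 * (c0 + 1))%:R.
Definition hypK : R := Vp * (p.+1%:R * (1 + hypc) ^+ p) * hypc.
Definition hypS : R := (12 * (2 * c0 + 5) ^ p)%:R.
(** [hypK + 1] serves radii at least rho, the 1 being the zero vector; below rho, [Vp] bounds the
    main term and [hypS] the count. *)
Definition hypC : R := hypK + 1 + Vp + hypS.

Variable x : {ffun T -> int}.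
Hypothesis xprim : primitive T x.
Local Notation rho := ((rhoz x)%:R : R).
Local Notation vx := (vn d (fun i => (x i)%:~R : R)).

Lemma hyper_data : exists i0 e1 (s : int -> {ffun monom d n -> int}),
  [/\ `|x i0|%N = rhoz x, x i0 != 0 & e1 != purepow d i0] /\
  [/\ forall q e, 0 <= s q e <= (c0 * `|x i0|)%:Z,
      forall q, s q (purepow d i0) = 0, forall q, s q e1 = 0 &
      forall q, (mval x (purepow d i0) %| q - lin x (s q))%Z].
Proof.
have [i0 Hi0] := rhoz_attained x.
have x0 : x i0 != 0 by rewrite -absz_gt0 Hi0 lt0n rhoz_eq0 primitive_neq0.
have [e1 He1] := exists_mixed d2 dn i0.
have e10 : e1 != purepow d i0.
  have [j [l [_ ji _ ej _]]] := He1; apply/eqP => E.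
  by move: ej; rewrite E purepowE eq_sym (negbTE ji).
have H q := residue_rep xprim x0 He1 q (leqnn d).
have [s Hs] := boolp.choice H.
exists i0, e1, s; split; first by split.
split => [q|q|q|q]; have [h1 h2 h3 h4] := Hs q => //.
by rewrite mval_purepow.
Qed.

Lemma rho_ge1 : 1 <= rho.
Proof. by rewrite ler1n lt0n rhoz_eq0 primitive_neq0. Qed.

Lemma rho_le_vx : rho ^+ d <= vx.
Proof.
have [i Hi] := rhoz_attained x.
by have := vn_ge d (fun i => (x i)%:~R : R) i; rewrite normzR Hi.
Qed.

Lemma size_hyper_le U : 0 <= U ->
  zsumS (onhyper x) U <= (size (hyper d x U))%:R.
Proof.
move=> U0; rewrite /zsumS /hyper size_filter -sum1_count natr_sum.
rewrite big_mkcond [X in _ <= X]big_mkcond; apply: ler_sum => a _.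
by rewrite /onhyper; case: (_ != 0); case: (_ == 0).
Qed.

Lemma size_hyper_ge U : 0 <= U ->
  (size (hyper d x U))%:R <= zsumS (onhyper x) U + 1.
Proof.
move=> U0; rewrite /zsumS /hyper size_filter -sum1_count natr_sum.
rewrite (bigID (fun a => a != 0)) /=; apply: lerD.
  rewrite big_mkcond [X in _ <= X]big_mkcond; apply: ler_sum => a _.
  by rewrite /onhyper; case: (_ != 0); case: (_ == 0).
apply: (@le_trans _ _ (\sum_(a <- zball (monom d n) U | a == 0) (1 : R))).
  rewrite big_mkcond [X in _ <= X]big_mkcond; apply: ler_sum => a _.
  by case: (a == 0); rewrite ?andbF //=; case: (_ == 0).
rewrite -big_filter (_ : [seq a <- _ | a == 0] = [:: 0]) ?big_seq1 //.
apply: filter_pred1_uniq; first exact: uniq_zball.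
by rewrite mem_zball /znorm big1 ?sqrtr0 // => i _; rewrite ffunE expr0n.
Qed.

Lemma zsumS_large U : rho <= U ->
  `|zsumS (onhyper x) U - Vp / vx * U ^+ p.+1| <= (hypK + 1) * (U ^+ p * rho / rho ^+ d).
Proof.
move=> rU; have r1 := rho_ge1; have rv := rho_le_vx.
have U0 : 0 < U by lra. have U1 : 1 <= U by lra.
have V0 : 0 < Vp := Vball_gt0 R _.
have rd0 : 0 < rho ^+ d by rewrite exprn_gt0 //; lra.
have vx0 : 0 < vx by apply: lt_le_trans rv.
have c0n : (0 < c0)%N by rewrite muln_gt0 /=; lia.
have [i0 [e1 [s [[xr x0 e10] [sb s0 s1 sr]]]]] := hyper_data.
have xmax i : (`|x i| <= `|x i0|)%N by rewrite xr rhoz_ge.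
have up := @hyper_upper R d n x i0 x0 xmax s c0 sb s0 sr c0n U U0.
have low := @hyper_lower R d n x i0 x0 xmax s c0 sb s0 sr c0n U.
have Mv := M_vn R d x0.
rewrite card_monom_neq Ndn_sub2K /= xr in up low Mv.
set Q := Num.sqrt _ in up low Mv.
have Q0 : 0 < Q.
  by rewrite sqrtr_gt0; apply: ltr_wpDr => //; apply: sumr_ge0 => e _; apply: sqr_ge0.
set W := Vp / Q in up low.
have hc0 : 0 <= hypc by apply: ler0n.
have Dt : (p.+2 * (c0 + 1) * rhoz x)%:R = hypc * rho :> R by rewrite natrM.
rewrite Dt in up low.
set M : R := (rhoz x ^ d)%:R in up low Mv.
have ME : M = rho ^+ d by rewrite /M natrX.
have M0 : 0 < M by rewrite ME.
have WM : W = M * (Vp / vx).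
  by rewrite /W -Mv; field; rewrite !gt_eqF.
have W0 : 0 <= W by rewrite WM mulr_ge0 ?divr_ge0 ?(ltW V0) ?(ltW M0) ?(ltW vx0).
have DU : hypc * rho <= hypc * U by rewrite ler_wpM2l.
have D0 : 0 <= hypc * rho by rewrite mulr_ge0.
have X0 : 0 <= M * (size (hyper d x U))%:R by rewrite mulr_ge0 // ltW.
have := sandwich W0 U0 D0 DU X0 up low.
rewrite WM -!(mulrA M) -mulrBr normrM (gtr0_norm M0) ler_pM2l // => S.
have S1 : `|(size (hyper d x U))%:R - Vp / vx * U ^+ p.+1| <= hypK * (U ^+ p * rho / rho ^+ d).
  apply: le_trans S _.
  have -> : hypK * (U ^+ p * rho / rho ^+ d) = Vp / rho ^+ d * (p.+1%:R * (1 + hypc) ^+ p * (hypc * rho * U ^+ p)).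
    by rewrite /hypK; ring.
  rewrite -mulrA ler_wpM2r //.
    by rewrite !mulr_ge0 ?exprn_ge0 ?addr_ge0 // ltW.
  by rewrite ler_wpM2l ?(ltW V0) // lef_pV2 ?posrE.
(* [zsumS] omits the zero vector; the resulting 1 fits into the error because U >= rho and p >=
   d. *)
have one : 1 <= U ^+ p * rho / rho ^+ d.
  rewrite ler_pdivlMr // mul1r.
  apply: (@le_trans _ _ (U ^+ d)); first by apply: lerXn2r; rewrite ?nnegrE // ltW.
  apply: (@le_trans _ _ (U ^+ p)); last by rewrite ler_peMr ?exprn_ge0 // ltW.
  by rewrite ler_weXn2l //; exact: ltnW Ndn_sub2_ge.
have z1 := size_hyper_le (ltW U0); have z2 := size_hyper_ge (ltW U0).
move: S1; rewrite !ler_norml mulrDl mul1r => /andP [h1 h2]; apply/andP; split; lra.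
Qed.

Lemma zsumS_mid U : 1 <= U -> U <= rho ->
  zsumS (onhyper x) U <= hypS * (U ^+ 2 * rho ^+ p / (rho * rho ^+ d)).
Proof.
move=> U1 Ur; have U0 : 0 <= U by lra.
have r1 := rho_ge1.
have [i0 [e1 [s [[xr x0 e10] [sb s0 s1 sr]]]]] := hyper_data.
have t0 : (0 < Num.trunc U)%N by rewrite truncn_gt0.
have tr : (Num.trunc U <= `|x i0|)%N.
  by rewrite xr -(ler_nat R); apply: le_trans Ur; rewrite truncn_le.
have := size_smallhyper_le x0 e10 sb s0 s1 sr t0 tr.
rewrite card_monom_neq2 // Ndn_sub2_ge => /(_ isT).
rewrite xr -(ler_nat R) !natrM !natrX => H.
apply: le_trans (size_hyper_le U0) _.
have h : (size (hyper d x U) <= size (smallhyper d x (Num.trunc U)))%N.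
  apply: (@size_inj_le _ _ _ _ id) => //; first exact/filter_uniq/uniq_zball.
  move=> a; rewrite mem_filter [in X in _ -> X]mem_filter mem_filter => /andP [-> /andP [_ ->]] //.
apply: le_trans (_ : (size (smallhyper d x (Num.trunc U)))%:R <= _); first by rewrite ler_nat.
have pos : 0 < rho * rho ^+ d by rewrite mulr_gt0 ?exprn_gt0 //; lra.
rewrite mulrA ler_pdivlMr // [rho * _]mulrC mulrA.
apply: le_trans H _; rewrite /hypS natrM natrX -mulrA ler_wpM2l ?mulr_ge0 ?exprn_ge0 //.
rewrite ler_wpM2r ?exprn_ge0 //; try lra.
by rewrite expr2; apply: ler_pM; rewrite ?truncn_le.
Qed.

(** The radius U = A / k exceeds rho for small k only. For larger k the count and the main term are
    bounded separately, both by the same quantity times k^-2. *)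
Lemma hyperplane_prim (A : R) : rho <= A ->
  `|zsumP (onhyper x) A - Vp / vx * A ^+ p.+1 / zeta R p.+1| <= 2 * (hypC * (A ^+ p * rho / rho ^+ d)).
Proof.
move=> rA; have r1 := rho_ge1; have rv := rho_le_vx.
have A1 : 1 <= A by lra. have A0 : 0 < A by lra.
have V0 : 0 < Vp := Vball_gt0 R _.
have rd0 : 0 < rho ^+ d by rewrite exprn_gt0 //; lra.
have vx0 : 0 < vx by apply: lt_le_trans rv.
have p2 : (2 <= p)%N := leq_trans (leqW d2) Ndn_sub2_ge.
have hc0 : 0 <= hypc by apply: ler0n.
have hK0 : 0 <= hypK by rewrite !mulr_ge0 ?exprn_ge0 ?addr_ge0 ?(ltW V0).
have hS0 : 0 <= hypS by apply: ler0n.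
apply: (zsumP_asymp (e := 0%N)).
- move=> k a k0; rewrite expr0 invr1 mul1r /onhyper; congr (_%:R); congr nat_of_bool.
  have -> : lin x (zscale k a) = k%:Z * lin x a by rewrite linZ.
  by rewrite mulf_eq0 eqz_nat; case: k k0.
- exact: p2.
move=> k k0; rewrite expr0 invr1 mul1r.
have k1 : 1 <= (k%:R : R) by rewrite ler1n. have kp : 0 < (k%:R : R) by lra.
set U := A / k%:R.
have U0 : 0 < U by rewrite divr_gt0.
have UA : U <= A by rewrite ler_pdivrMr // ler_peMr // ltW.
have -> : Vp / vx * A ^+ p.+1 / k%:R ^+ p.+1 = Vp / vx * U ^+ p.+1.
  by rewrite /U expr_div_n mulrA.
have Up : U ^+ p <= A ^+ p / k%:R ^+ 2.
  rewrite /U expr_div_n ler_wpM2l ?exprn_ge0 ?(ltW A0) // lef_pV2 ?posrE ?exprn_gt0 //.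
  by rewrite ler_weXn2l.
have rr : 0 <= rho / rho ^+ d by rewrite divr_ge0 ?(ltW rd0) //; lra.
have base : U ^+ p * rho / rho ^+ d <= A ^+ p * rho / rho ^+ d / k%:R ^+ 2.
  have -> : A ^+ p * rho / rho ^+ d / k%:R ^+ 2 = (A ^+ p / k%:R ^+ 2) * (rho / rho ^+ d) by ring.
  by rewrite -mulrA ler_wpM2r.
set Z := A ^+ p * rho / rho ^+ d / k%:R ^+ 2 in base *.
have -> : hypC * (A ^+ p * rho / rho ^+ d) / k%:R ^+ 2 = hypC * Z by rewrite -mulrA.
have b0 : 0 <= U ^+ p * rho / rho ^+ d by rewrite -mulrA mulr_ge0 // exprn_ge0 // ltW.
have Z0 : 0 <= Z by apply: le_trans base.
case: (leP rho U) => rU.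
  apply: le_trans (zsumS_large rU) _.
  apply: ler_pM => //; first by rewrite addr_ge0.
  by rewrite /hypC -[X in _ <= X]addrA lerDl addr_ge0 // ltW.
(* Here U < rho, so U^(p+1) / [vx] <= U^p rho / rho^d. *)
have main : 0 <= Vp / vx * U ^+ p.+1 <= Vp * Z.
  rewrite mulr_ge0 ?divr_ge0 ?exprn_ge0 ?(ltW V0) ?(ltW vx0) ?(ltW U0) //=.
  rewrite -mulrA ler_wpM2l ?(ltW V0) //; apply: le_trans base.
  rewrite [_^-1 * _]mulrC exprSr; apply: ler_pM.
  - by rewrite mulr_ge0 ?exprn_ge0 // ltW.
  - by rewrite invr_ge0 ltW.
  - by rewrite ler_wpM2l ?exprn_ge0 // ltW.
  - by rewrite lef_pV2 ?posrE.
have S0 : 0 <= zsumS (onhyper x) U by apply: sumr_ge0 => a _; apply: ler0n.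
have S1 : zsumS (onhyper x) U <= hypS * Z.
  case: (ltP U 1) => U1; first by rewrite zsumS_small // mulr_ge0.
  apply: le_trans (zsumS_mid U1 (ltW rU)) _; rewrite ler_wpM2l //.
  (* The U^2 from [zsumS_mid] already contains k^-2; what remains is rho^(p-2) <= A^(p-2). *)
  have -> : Z = (A / k%:R) ^+ 2 * (A ^+ (p - 2) * rho / rho ^+ d).
    rewrite /Z -{1}(subnKC p2).
    by rewrite exprD expr_div_n; ring.
  have -> : U ^+ 2 * rho ^+ p / (rho * rho ^+ d) = U ^+ 2 * (rho ^+ (p - 2) * rho / rho ^+ d).
    have r0 : 0 < rho by lra.
    rewrite -{1}(subnK p2).
    by rewrite exprD; field; rewrite !gt_eqF.
  rewrite -/U ler_wpM2l ?exprn_ge0 ?(ltW U0) // -!mulrA ler_wpM2r //.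
  by apply: lerXn2r; rewrite ?nnegrE //; lra.
have K1 : 0 <= (hypK + 1) * Z by rewrite mulr_ge0 // addr_ge0.
move: main => /andP [m1 m2].
by rewrite /hypC !mulrDl ler_norml; rewrite mulrDl in K1; apply/andP; split; lra.
Qed.

End HyperplanePrimitive.

(** * Assembly of the estimates *)

Section PrimitiveVectors.
Variables (R : realType) (T : finType) (k : nat).
Hypotheses (Tk : #|T| = k.+1) (k2 : (2 <= k)%N).
Local Notation V := (Vball R k.+1).
Local Notation one := (fun _ : {ffun T -> int} => 1 : R).

Definition ballC : R := V * (k.+1%:R * (1 + k.+2%:R) ^+ k) * k.+2%:R + 1.

Lemma ballC_ge0 : 0 <= ballC.
Proof. by rewrite /ballC addr_ge0 // !mulr_ge0 ?exprn_ge0 ?addr_ge0 // ltW // Vball_gt0. Qed.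

Lemma size_zball (U : R) : 0 < U -> size (zball T U) = size (ellball (fun _ : T => 0) U).
Proof.
move=> U0; apply/perm_size/uniq_perm; [exact: uniq_zball|exact: uniq_ellball|].
move=> z; rewrite mem_zball (mem_ellball _ _ (ltW U0)).
rewrite /ellz /ellq [X in _ + X ^+ 2]big1 ?expr0n ?addr0; last by move=> i _; rewrite mul0r.
by rewrite -znorm_sq ler_pXn2r // nnegrE ?znorm_ge0 // ltW.
Qed.

Lemma zsumS_one (U : R) : 0 <= U -> (size (zball T U))%:R = zsumS one U + 1.
Proof.
move=> U0; rewrite -sum1_size natr_sum (bigID (fun a => a != 0)) /=; congr (_ + _).
rewrite (eq_bigl (fun a => a == 0)) => [|a]; last by rewrite negbK.
rewrite -big_filter (_ : [seq a <- _ | a == 0] = [:: 0]) ?big_seq1 //.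
apply: filter_pred1_uniq; first exact: uniq_zball.
by rewrite mem_zball /znorm big1 ?sqrtr0 // => i _; rewrite ffunE expr0n.
Qed.

Lemma zsumS_ball (U : R) : 1 <= U -> `|zsumS one U - V * U ^+ k.+1| <= ballC * U ^+ k.
Proof.
move=> U1; have U0 : 0 < U by lra.
have c1 (i : T) : `|(fun _ : T => 0 : R) i| <= 1 by rewrite normr0.
have up := size_ellball_le c1 U0.
have low := @size_ellball_ge R T _ c1 U.
rewrite Tk in up low.
have sq1 : Num.sqrt (1 + \sum_(i : T) (0 : R) ^+ 2) = 1.
  by rewrite big1 ?addr0 ?sqrtr1 // => i _; rewrite expr0n.
rewrite sq1 divr1 -size_zball // in up low.
have V0 := ltW (Vball_gt0 R k.+1).
have D0 : 0 <= k.+2%:R :> R by [].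
have DU : k.+2%:R <= k.+2%:R * U by rewrite ler_peMr.
have := sandwich V0 U0 D0 DU (ler0n _ _) up low.
rewrite (zsumS_one (ltW U0)) => S.
have Uk : 1 <= U ^+ k by apply: exprn_ege1.
have E : ballC * U ^+ k = V * (k.+1%:R * (1 + k.+2%:R) ^+ k) * (k.+2%:R * U ^+ k) + U ^+ k.
  by rewrite /ballC; ring.
rewrite E; move: S; rewrite !ler_norml => /andP [h1 h2] {c1 sq1 up low E DU}; apply/andP; split; lra.
Qed.

Lemma zsumP_ball (A : R) : 1 <= A ->
  `|zsumP one A - V * A ^+ k.+1 / zeta R k.+1| <= 2 * ((ballC + V) * A ^+ k).
Proof.
move=> A1; have A0 : 0 < A by lra.
have V0 : 0 < V := Vball_gt0 R _.
have C0 := ballC_ge0.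
apply: (zsumP_asymp (e := 0%N)); [by move=> j a _; rewrite expr0 invr1 mul1r|lia|].
move=> j j0; rewrite expr0 invr1 mul1r.
have j1 : 1 <= (j%:R : R) by rewrite ler1n. have jp : 0 < (j%:R : R) by lra.
set U := A / j%:R.
have U0 : 0 < U by rewrite divr_gt0.
have -> : V * A ^+ k.+1 / j%:R ^+ k.+1 = V * U ^+ k.+1 by rewrite /U expr_div_n mulrA.
have Up : U ^+ k <= A ^+ k / j%:R ^+ 2.
  rewrite /U expr_div_n ler_wpM2l ?exprn_ge0 ?(ltW A0) // lef_pV2 ?posrE ?exprn_gt0 //.
  by rewrite ler_weXn2l.
have Uk0 : 0 <= U ^+ k by rewrite exprn_ge0 // ltW.
apply: (@le_trans _ _ ((ballC + V) * U ^+ k)); last first.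
  by rewrite -mulrA ler_wpM2l // addr_ge0 // ltW.
case: (ltP U 1) => U1.
  rewrite zsumS_small // sub0r normrN ger0_norm ?mulr_ge0 ?exprn_ge0 ?(ltW U0) ?(ltW V0) //.
  rewrite mulrDl exprSr; have : V * (U ^+ k * U) <= V * U ^+ k.
    by rewrite ler_wpM2l ?(ltW V0) // ler_piMr // ltW.
  by have := mulr_ge0 C0 Uk0; lra.
apply: le_trans (zsumS_ball U1) _; rewrite ler_wpM2r // lerDl ltW //.
Qed.

Lemma zsumP_ge1 (A : R) : 1 <= A -> 1 <= zsumP one A.
Proof.
move=> A1; have [i] : exists i : T, i \in T by apply/card_gt0P; rewrite Tk.
move=> _; pose a : {ffun T -> int} := [ffun j => (j == i)%:R].
have za : a \in zball T A.
  rewrite mem_zball; apply: le_trans A1; rewrite /znorm (bigD1 i) //= big1 ?addr0.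
    by rewrite ffunE eqxx expr1n sqrtr1.
  by move=> j /negbTE ji; rewrite ffunE ji expr0n.
have pa : primitive T a.
  rewrite /primitive -dvdn1; apply: dvdn_trans (_ : `|a i| %| _)%N; last by rewrite ffunE eqxx.
  by have /dvd_contentP := dvdnn (vcontent a).
rewrite /zsumP big_mkcond (bigD1_seq a) ?uniq_zball //= pa lerDl.
by apply: sumr_ge0 => b _; case: ifP.
Qed.

(** The number of primitive vectors will be a denominator for every A >= 1. The asymptotic formula
    bounds it below from some A0 on; under A0 a unit vector is enough. *)
Lemma zsumP_lower : exists2 kap : R, 0 < kap & forall A, 1 <= A -> kap * A ^+ k.+1 <= zsumP one A.
Proof.
have V0 : 0 < V := Vball_gt0 R _.
have z1 : 1 <= zeta R k.+1 by apply: zeta_ge1; lia.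
pose c := V / zeta R k.+1; have c0 : 0 < c by rewrite divr_gt0 //; lra.
pose K := 2 * (ballC + V); have K0 : 0 < K by rewrite mulr_gt0 // ltr_wpDl // ballC_ge0.
pose A0 := 1 + 2 * K / c; have A01 : 1 <= A0 by rewrite lerDl; apply: divr_ge0; [apply: mulr_ge0 => //|]; exact: ltW.
have A00 : 0 < A0 ^+ k.+1 by rewrite exprn_gt0 //; lra.
exists (Num.min (c / 2) (A0 ^- k.+1)).
  by rewrite lt_min divr_gt0 //= invr_gt0.
move=> A A1; have Ak : 0 < A ^+ k.+1 by rewrite exprn_gt0 //; lra.
have Ak' : 0 < A ^+ k by rewrite exprn_gt0 //; lra.
case: (leP A0 A) => AA.
  apply: (@le_trans _ _ (c / 2 * A ^+ k.+1)).
    by rewrite ler_wpM2r ?ge_min ?lexx // ltW.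
  have := zsumP_ball A1; rewrite mulrA -/K ler_norml => /andP [h _].
  have -> : c / 2 * A ^+ k.+1 = c * A ^+ k.+1 - c / 2 * A ^+ k.+1 by field.
  have h2 : K * A ^+ k <= c / 2 * A ^+ k.+1.
    have -> : c / 2 * A ^+ k.+1 = (c / 2 * A) * A ^+ k by rewrite exprSr; ring.
    rewrite ler_wpM2r ?(ltW Ak') //.
    have : 2 * K / c <= A by move: AA; rewrite /A0; lra.
    by rewrite ler_pdivrMr //; lra.
  move: h; have -> : V * A ^+ k.+1 / zeta R k.+1 = c * A ^+ k.+1 by rewrite /c mulrAC.
  lra.
apply: le_trans (zsumP_ge1 A1).
apply: (@le_trans _ _ (A0 ^- k.+1 * A ^+ k.+1)).
  by rewrite ler_wpM2r ?ge_min ?lexx ?orbT // ltW.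
rewrite mulrC ler_pdivrMr // mul1r; apply: lerXn2r; rewrite ?nnegrE; lra.
Qed.

End PrimitiveVectors.

Section Assembly.
Variables (R : realType) (d n : nat).
Hypotheses (d2 : (2 <= d)%N) (dn : (d <= n)%N).
Local Notation T := 'I_n.+1.
Local Notation p := (Ndn d n - 2)%N.
Local Notation m := (n - d)%N.
Local Notation one := (fun _ : {ffun monom d n -> int} => 1 : R).

Definition incidence (A X : R) : R := \sum_(x <- zball T X | primitive T x) zsumP (@onhyper R d n x) A.

Lemma fsum_filter (I : choiceType) (r : seq I) (S : set I) (F : I -> R) : uniq r ->
  (forall i, S i <-> i \in r) -> \sum_(i \in S) F i = \sum_(i <- r) F i.
Proof.
move=> ur H; have -> : S = [set` r] by apply/seteqP; split=> i /H.
by rewrite [RHS](fsbig_seq _ _ ur).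
Qed.

Lemma coeffs_sum (A : R) (F : {ffun monom d n -> int} -> R) :
  \sum_(a \in coeffs_upto R d n A) F a = \sum_(a <- zball (monom d n) A | primitive _ a) F a.
Proof.
rewrite -[RHS]big_filter; apply: fsum_filter; first exact/filter_uniq/uniq_zball.
by move=> a; rewrite mem_filter mem_zball; split => [[-> ->]|/andP].
Qed.

Lemma cardVE (A : R) : cardV R d n A = zsumP one A / 2.
Proof. by rewrite /cardV coeffs_sum. Qed.

(** With B = X^(m+1) the height condition becomes ||x|| <= X; the 4 counts the signs of a and of
    x. *)
Lemma sumNVE (A X : R) : 0 <= X -> sumNV R d n A (X ^+ m.+1) = incidence A X / 4.
Proof.
move=> X0; rewrite /sumNV coeffs_sum.
have -> : \sum_(a <- zball (monom d n) A | primitive _ a) NV R d n a (X ^+ m.+1) =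
  \sum_(a <- zball (monom d n) A | primitive _ a) (\sum_(x <- zball T X | primitive T x) @onhyper R d n x a) / 2.
  apply: eq_bigr => a _; rewrite /NV; congr (_ / 2).
  rewrite (fsum_filter (r := [seq x <- [seq x <- zball T X | primitive T x] | form_eval d n a x == 0])).
  - rewrite big_filter big_filter_cond big_mkcondr; apply: eq_bigr => x _.
    by rewrite /onhyper; case: eqP => // ->; rewrite eqxx.
  - exact/filter_uniq/filter_uniq/uniq_zball.
  move=> x; rewrite 2!mem_filter mem_zball /points_upto /= subSn //.
  have -> : (znorm R T x ^+ m.+1 <= X ^+ m.+1) = (znorm R T x <= X).
    by rewrite ler_pXn2r // nnegrE znorm_ge0.
  split; first by move=> [-> [-> ->]]; rewrite eqxx.
  by move=> /andP [/eqP -> /andP [-> ->]].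
rewrite -mulr_suml exchange_big /=.
by rewrite -mulrA -invfM /incidence; congr (_ * _^-1); ring.
Qed.

Definition pointC : R := 2 * n.+1%:R * 3 ^+ n.

Lemma sum_rho_le (X : R) : 0 <= X ->
  \sum_(x <- zball T X | primitive T x) (rhoz x)%:R / (rhoz x)%:R ^+ d <= pointC * X ^+ m.+2.
Proof.
move=> X0; pose h r : R := r%:R / r%:R ^+ d.
have h0 r : 0 <= h r by rewrite divr_ge0 ?exprn_ge0.
have KX : (Num.trunc X)%:R <= X by rewrite truncn_le.
apply: (@le_trans _ _ (\sum_(x <- intbox T (Num.trunc X) | x != 0) h (rhoz x))).
  rewrite /zball big_filter_cond big_mkcond [X in _ <= X]big_mkcond.
  apply: ler_sum => x _; case: (_ <= X) => /=; last by case: (_ != 0).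
  by case: ifP => [/primitive_neq0 -> //|_]; case: (_ != 0).
apply: le_trans (sum_rhoz_le _ _ h0) _; first by rewrite card_ord.
rewrite card_ord /= /pointC ler_wpM2l ?mulr_ge0 ?exprn_ge0 //.
apply: (@le_trans _ _ (\sum_(0 <= r < Num.trunc X) X ^+ m.+1)).
  rewrite !big_nat; apply: ler_sum => r rK; rewrite /h.
  have r0 : 0 < (r.+1%:R : R) by [].
  have -> : n = (d + m)%N by lia.
  rewrite [X in _ <= _ ^+ X](_ : _ = m.+1); last by lia.
  rewrite exprD -mulrA mulKf ?expf_neq0 ?gt_eqF // -exprS.
  apply: lerXn2r; rewrite ?nnegrE //; apply: le_trans KX; rewrite ler_nat; lia.
rewrite sumr_const_nat subn0 -mulr_natl [X ^+ m.+2]exprS ler_wpM2r // exprn_ge0 //.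
Qed.

Local Notation Vp := (Vball R p.+1).
Local Notation VN := (Vball R p.+2).
Local Notation VI := (veroneseI R d n).

(** Replacing each hyperplane count by its main term costs O(A^p X^(m+2)), relatively X / A;
    replacing the sum of 1 / [vn] by its integral costs O(A^(p+1) X^m (1 + ln X)), relatively (1 +
    ln X) / X. *)
Lemma incidence_asymp : exists2 K : R, 0 <= K & forall A X : R, 1 <= X -> X <= A ->
  `|incidence A X - Vp * A ^+ p.+1 / zeta R p.+1 * (VI * X ^+ m.+1 / zeta R n.+1)| <=
  K * (A ^+ p.+1 * X ^+ m.+1) * (X / A + (1 + ln X) / X).
Proof.
have d0 : (0 < d)%N by lia. have n2 : (2 <= n)%N by apply: leq_trans dn.
have pd := Ndn_sub2_ge d2 dn.
have V0 : 0 < Vp := Vball_gt0 R _.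
have z1 : 1 <= zeta R p.+1 by apply: zeta_ge1; lia.
have hC0 : 0 <= hypC R d n.
  have k0 : 0 <= hypK R d n.
    by rewrite !mulr_ge0 ?exprn_ge0 ?addr_ge0 ?ler0n // (ltW V0).
  by rewrite /hypC !addr_ge0 // ?ler0n // ltW.
have vC0 := veroneseC_ge0 R d0 dn; have I0 := veroneseI_gt0 R d0 dn.
pose K1 := 2 * hypC R d n * pointC; pose K2 := Vp * (2 * (veroneseC R d n + VI)).
have pC0 : 0 <= pointC by rewrite !mulr_ge0 ?exprn_ge0.
have K10 : 0 <= K1 by rewrite !mulr_ge0.
have K20 : 0 <= K2.
  by apply: mulr_ge0; [exact: ltW|apply: mulr_ge0 => //; apply: addr_ge0 => //; exact: ltW].
exists (K1 + K2); first exact: addr_ge0.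
move=> A X X1 XA; have X0 : 0 < X by lra. have A0 : 0 < A by lra.
have L0 : 0 <= ln X by apply: ln_ge0.
pose Pz := zsumP (@fz R d n) X.
have B1 : `|incidence A X - Vp * A ^+ p.+1 / zeta R p.+1 * Pz| <= K1 * (A ^+ p * X ^+ m.+2).
  rewrite /Pz /zsumP mulr_sumr /incidence -sumrB.
  apply: le_trans (ler_norm_sum _ _ _) _.
  apply: (@le_trans _ _ (\sum_(x <- zball T X | primitive T x)
     2 * hypC R d n * A ^+ p * ((rhoz x)%:R / (rhoz x)%:R ^+ d))).
    rewrite big_seq_cond [X in _ <= X]big_seq_cond; apply: ler_sum => x /andP [xX px].
    have rA : (rhoz x)%:R <= A.
      have [i <-] := rhoz_attained x; apply: le_trans (normz_le_znorm R x i) _.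
      by apply: le_trans XA; rewrite mem_zball in xX.
    have := hyperplane_prim d2 dn px rA.
    have -> : Vp / vn d (fun i => (x i)%:~R) * A ^+ p.+1 / zeta R p.+1 =
       Vp * A ^+ p.+1 / zeta R p.+1 * fz R d x by rewrite /fz; ring.
    by move/le_trans; apply; rewrite le_eqVlt; apply/orP; left; apply/eqP; ring.
  rewrite -mulr_sumr.
  have -> : K1 * (A ^+ p * X ^+ m.+2) = 2 * hypC R d n * A ^+ p * (pointC * X ^+ m.+2) by rewrite /K1; ring.
  by rewrite ler_wpM2l ?sum_rho_le ?mulr_ge0 ?exprn_ge0 // ltW.
have B2 : `|Vp * A ^+ p.+1 / zeta R p.+1 * Pz - Vp * A ^+ p.+1 / zeta R p.+1 * (VI * X ^+ m.+1 / zeta R n.+1)|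
    <= K2 * (A ^+ p.+1 * (X ^+ m * (1 + ln X))).
  have c0 : 0 <= Vp * A ^+ p.+1 by rewrite mulr_ge0 ?exprn_ge0 // ltW.
  rewrite -mulrBr normrM ger0_norm; last by rewrite divr_ge0 //; lra.
  have := zsumP_veronese d0 dn n2 X1; rewrite -/Pz => h.
  have -> : K2 * (A ^+ p.+1 * (X ^+ m * (1 + ln X))) =
    Vp * A ^+ p.+1 * (2 * ((veroneseC R d n + VI) * (X ^+ m * (1 + ln X)))) by rewrite /K2; ring.
  apply: ler_pM => //; first by rewrite divr_ge0 //; lra.
  by rewrite ler_pdivrMr ?ler_peMr //; lra.
have E1 : A ^+ p * X ^+ m.+2 = A ^+ p.+1 * X ^+ m.+1 * (X / A).
  by rewrite [A ^+ p.+1]exprSr [X ^+ m.+2]exprSr; field; rewrite gt_eqF.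
have E2 : A ^+ p.+1 * (X ^+ m * (1 + ln X)) = A ^+ p.+1 * X ^+ m.+1 * ((1 + ln X) / X).
  by rewrite [X ^+ m.+1]exprSr; field; rewrite gt_eqF.
rewrite E1 in B1; rewrite E2 in B2.
set F := A ^+ p.+1 * X ^+ m.+1 in B1 B2 *.
have F0 : 0 <= F by rewrite mulr_ge0 ?exprn_ge0 // ltW.
rewrite -(subrKA (Vp * A ^+ p.+1 / zeta R p.+1 * Pz)).
apply: le_trans (ler_normD _ _) _; apply: le_trans (lerD B1 B2) _.
have e1 : 0 <= F * (X / A) by rewrite mulr_ge0 ?divr_ge0 // ltW.
have e2 : 0 <= F * ((1 + ln X) / X) by rewrite mulr_ge0 ?divr_ge0 ?addr_ge0 // ltW.
have -> : (K1 + K2) * F * (X / A + (1 + ln X) / X) =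
  K1 * (F * (X / A)) + K2 * (F * ((1 + ln X) / X)) + K2 * (F * (X / A)) + K1 * (F * ((1 + ln X) / X)) by ring.
have := mulr_ge0 K20 e1; have := mulr_ge0 K10 e2; lra.
Qed.

Lemma CdnE : Cdn R d n = (2 * zeta R n.+1)^-1 * (Vp / VN) * (zeta R p.+2 / zeta R p.+1) * VI.
Proof.
(* Rewriting with [Ndn_sub2K] directly would also reach the [Ndn d n] inside p. *)
suff gen (N q : nat) : N = q.+2 ->
    (2 * zeta R n.+1)^-1 * (Vball R N.-1 / Vball R N) * (zeta R N / zeta R N.-1) * VI =
    (2 * zeta R n.+1)^-1 * (Vball R q.+1 / Vball R q.+2) * (zeta R q.+2 / zeta R q.+1) * VI.
  exact: gen (Ndn_sub2K d2 dn).
by move=> ->.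
Qed.

Lemma Cdn_gt0 : 0 < Cdn R d n.
Proof.
have d0 : (0 < d)%N by lia. have pd := Ndn_sub2_ge d2 dn.
have z s : (2 <= s)%N -> 0 < zeta R s by move=> s2; have := zeta_ge1 R s2; lra.
have z1 : 0 < zeta R n.+1 by apply: z; lia.
have z2 : 0 < zeta R p.+1 by apply: z; lia.
have z3 : 0 < zeta R p.+2 by apply: z; lia.
rewrite CdnE; apply: mulr_gt0; last exact: veroneseI_gt0.
apply: mulr_gt0; last by rewrite divr_gt0.
apply: mulr_gt0; last by apply: divr_gt0; exact: Vball_gt0.
by rewrite invr_gt0 mulr_gt0.
Qed.

(** Clearing the denominator reduces the quotient to the difference of Num and 2 Den C X^(m+1) / A,
    where the errors of numerator and denominator add. Dividing again uses Den >= kap A^(p+2), valid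
    on the whole range. *)
Lemma avg_asymp : exists2 K : R, 0 <= K & forall A X : R, 1 <= X -> X <= A ->
  `|incidence A X / 4 / (zsumP one A / 2) - Cdn R d n * (X ^+ m.+1 / A)| <=
  K * (Cdn R d n * (X ^+ m.+1 / A)) * (X / A + (1 + ln X) / X).
Proof.
have pd := Ndn_sub2_ge d2 dn.
have cN : #|{: monom d n}| = p.+2 by rewrite card_monom; exact: Ndn_sub2K.
have p1 : (2 <= p.+1)%N by lia.
have [K1 K10 H1] := incidence_asymp.
have [kap kap0 H2] := @zsumP_lower R _ _ cN p1.
have H3 := @zsumP_ball R _ _ cN p1.
have C0 := Cdn_gt0.
have VN0 : 0 < VN := Vball_gt0 R _.
set K3 := 2 * (ballC R p.+1 + VN).
have K30 : 0 <= K3.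
  by apply: mulr_ge0 => //; apply: addr_ge0; [exact: ballC_ge0|exact: ltW].
have z s : (2 <= s)%N -> 0 < zeta R s by move=> s2; have := zeta_ge1 R s2; lra.
have z1 : 0 < zeta R n.+1 by apply: z; lia.
have z2 : 0 < zeta R p.+1 by apply: z; lia.
have z3 : 0 < zeta R p.+2 by apply: z; lia.
exists ((K1 + 2 * Cdn R d n * K3) / (2 * kap) / Cdn R d n).
  have CC := ltW C0; have kk := ltW kap0.
  apply: divr_ge0 => //; apply: divr_ge0; last exact: mulr_ge0.
  by apply: addr_ge0 => //; apply: mulr_ge0 => //; apply: mulr_ge0.
move=> A X X1 XA; have A1 : 1 <= A by lra. have A0 : 0 < A by lra. have X0 : 0 < X by lra.
have L0 : 0 <= ln X by apply: ln_ge0.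
have B1 := H1 A X X1 XA.
have B2 := H2 A A1; have B3 := H3 A A1.
rewrite [2 * (_ * _)]mulrA -/K3 in B3.
set Den := zsumP one A in B2 B3 *; set Num := incidence A X in B1 *.
set C := Cdn R d n in C0 *; set eps := X / A + _ in B1 *.
have Ap : 0 < A ^+ p.+1 by rewrite exprn_gt0.
have Xm : 0 < X ^+ m.+1 by rewrite exprn_gt0.
have Den0 : 0 < Den by apply: lt_le_trans B2; rewrite mulr_gt0 // exprn_gt0.
set F := A ^+ p.+1 * X ^+ m.+1 in B1.
have F0 : 0 < F by rewrite mulr_gt0.
(* The ratio of the two main terms: this is where the value of [Cdn] arises. *)
have main : Vp * A ^+ p.+1 / zeta R p.+1 * (VI * X ^+ m.+1 / zeta R n.+1) =
   2 * (VN * A ^+ p.+2 / zeta R p.+2) * (C * (X ^+ m.+1 / A)).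
  by rewrite /C CdnE [A ^+ p.+2]exprSr; field; rewrite !gt_eqF.
have -> : Num / 4 / (Den / 2) - C * (X ^+ m.+1 / A) = (Num - 2 * Den * (C * (X ^+ m.+1 / A))) / (2 * Den).
  by field; rewrite !gt_eqF.
(* The relative error 1 / A of the denominator is absorbed into X / A, as X >= 1. *)
have eps1 : A^-1 <= eps.
  apply: (@le_trans _ _ (X / A)); first by rewrite ler_peMl // invr_ge0 ltW.
  by rewrite lerDl divr_ge0 ?addr_ge0 // ltW.
have eps0 : 0 <= eps by apply: le_trans eps1; rewrite invr_ge0 ltW.
have CX : 0 <= C * (X ^+ m.+1 / A) by rewrite mulr_ge0 ?divr_ge0 // ltW.
have N1 : `|Num - 2 * Den * (C * (X ^+ m.+1 / A))| <= (K1 + 2 * C * K3) * F * eps.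
  rewrite -(subrKA (Vp * A ^+ p.+1 / zeta R p.+1 * (VI * X ^+ m.+1 / zeta R n.+1))).
  apply: le_trans (ler_normD _ _) _.
  have -> : (K1 + 2 * C * K3) * F * eps = K1 * F * eps + 2 * C * K3 * F * eps by ring.
  apply: lerD => //.
  rewrite main -mulrBl -mulrBr normrM [X in _ * X <= _]ger0_norm // normrM [`|2|]ger0_norm // distrC.
  have -> : 2 * C * K3 * F * eps = 2 * (K3 * A ^+ p.+1) * (C * X ^+ m.+1 * eps) by rewrite /F; ring.
  apply: ler_pM => //.
    by rewrite ler_wpM2l.
  by rewrite mulrA ler_wpM2l // mulr_ge0 // ?(ltW C0) ?(ltW Xm).
rewrite normrM normfV [X in _ / X]gtr0_norm ?mulr_gt0 // ler_pdivrMr ?mulr_gt0 //.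
apply: le_trans N1 _.
have -> : (K1 + 2 * C * K3) / (2 * kap) / C * (C * (X ^+ m.+1 / A)) * eps * (2 * Den) =
   (K1 + 2 * C * K3) * (X ^+ m.+1 / A) * eps / kap * Den.
  by field; rewrite !gt_eqF.
have W0 : 0 <= (K1 + 2 * C * K3) * (X ^+ m.+1 / A) * eps / kap.
  have CC := ltW C0; have kk := ltW kap0; have XX := ltW Xm; have AA := ltW A0.
  have c0 : 0 <= 2 * C * K3 by apply: mulr_ge0 => //; apply: mulr_ge0.
  apply: divr_ge0 => //; apply: mulr_ge0 => //; apply: mulr_ge0; last exact: divr_ge0.
  exact: addr_ge0.
apply: le_trans (ler_wpM2l W0 B2).
rewrite le_eqVlt; apply/orP; left; apply/eqP.
by rewrite /F [A ^+ p.+2]exprSr; field; rewrite !gt_eqF.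
Qed.

End Assembly.

Unset Implicit Arguments.

Theorem theorem2 (R : realType) (d n : nat) :
  (2 <= d)%N -> (d <= n)%N ->
  0 < Cdn R d n /\
  exists K : R, forall A B : R,
    2 <= B -> B `^ ((n.+1 - d)%:R)^-1 <= A ->
    `| avgNV R d n A B - Cdn R d n * (B / A) |
      <= K * (Cdn R d n * (B / A)) *
         (B `^ ((n.+1 - d)%:R)^-1 / A + ln B / B `^ ((n.+1 - d)%:R)^-1).
Proof.
move=> d2 dn; have C0 := Cdn_gt0 R d2 dn; split => //.
have [K K0 H] := avg_asymp R d2 dn.
have l2 : 0 < ln (2 : R) by apply: ln_gt0; rewrite ltr1n.
(* B >= 2 gives 1 <= ln B / ln 2, and ln X <= ln B, so 1 + ln X <= L ln B. *)
pose L := 1 + (ln (2 : R))^-1.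
have L1 : 1 <= L by rewrite lerDl invr_ge0 ltW.
exists (K * L) => A B B2; rewrite subSn //; set X := B `^ _ => XA.
have m0 : ((n - d).+1%:R : R) != 0 by rewrite pnatr_eq0.
have B0 : 0 < B by lra.
have X0 : 0 < X by apply: powR_gt0.
have XB : X ^+ (n - d).+1 = B.
  by rewrite -powR_mulrn ?(ltW X0) // /X -powRrM mulVf // powRr1 // ltW.
have lB : ln 2 <= ln B by rewrite ler_ln ?posrE.
have lX : ln X = (n - d).+1%:R^-1 * ln B by rewrite /X ln_powR.
have lB0 : 0 < ln B by lra.
have lX0 : 0 <= ln X by rewrite lX mulr_ge0 ?invr_ge0 // ltW.
have lXB : ln X <= ln B.
  by rewrite lX ler_piMl ?(ltW lB0) // invf_le1 // ler1n.
have X1 : 1 <= X by rewrite -ler_ln ?posrE // ln1.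
have := H A X X1 XA; rewrite XB => h.
rewrite /avgNV -XB sumNVE ?(ltW X0) // cardVE XB.
apply: le_trans h _.
have A0 : 0 < A by lra.
have CB : 0 <= Cdn R d n * (B / A) by rewrite mulr_ge0 ?divr_ge0 // ltW.
have -> : K * L * (Cdn R d n * (B / A)) * (X / A + ln B / X) =
  K * (Cdn R d n * (B / A)) * (L * (X / A) + L * ln B / X) by ring.
apply: ler_wpM2l; first exact: mulr_ge0.
have XX := ltW X0; have AA := ltW A0.
apply: lerD; first by apply: ler_peMl => //; apply: divr_ge0.
rewrite ler_wpM2r ?invr_ge0 // /L mulrDl mul1r addrC; apply: lerD => //.
by rewrite -[X in X <= _](mulVf (lt0r_neq0 l2)) ler_wpM2l // invr_ge0 ltW.
Qed.
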